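(* Let $(X,\sigma)$ be a (one-sided or two-sided) shift space whose language $\mathcal L$ admits a decomposition $\mathcal L=\mathcal C^p\mathcal G\mathcal C^s$, and suppose that the following conditions are satisfied: (I) $\mathcal G$ has (S)-specification. (II) $h(\mathcal C^p\cup\mathcal C^s)<h(\mathcal L)=h_{\mathrm{top}}(X,\sigma)$. (III) For every $M\in\mathbb N$ there exists $\tau$ such that given $v\in\mathcal G(M)$, there exist words $u,w$ with $|u|\le\tau$, $|w|\le\tau$ for which $uvw\in\mathcal G$. Then $(X,\sigma)$ is intrinsically ergodic. If moreover $\mathcal G$ has (Per)-specification, then the sequence of probability measures $$\mu_n=\frac{1}{\#\mathrm{Per}(n)}\sum_{x\in\mathrm{Per}(n)}\delta_x,\qquad \mathrm{Per}(n)=\{x\in X \mid \sigma^k(x)=x\text{ for some }1\le k\le n\},$$ converges in the weak* topology to the unique measure of maximal entropy.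
   Context: $\mathbb N=\{0,1,2,\dots\}$. A shift space is a nonempty closed shift-invariant subset $X$ of $\{1,\dots,p\}^{\mathbb N}$ (one-sided) or $\{1,\dots,p\}^{\mathbb Z}$ (two-sided); $\sigma$ is the left shift. Its language $\mathcal L$ is the set of all finite words appearing in sequences of $X$ (including the empty word, of length $0$). $|w|$ is the length of $w$; juxtaposition is concatenation; for $\mathcal D\subset\mathcal L$, $\mathcal D_n$ is the set of words of length $n$ in $\mathcal D$, and $h(\mathcal D)=\varlimsup_{n\to\infty}\frac1n\log\#\mathcal D_n$. For $\mathcal A,\mathcal B\subset\mathcal L$, $\mathcal A\mathcal B=\{vw\in\mathcal L \mid v\in\mathcal A,w\in\mathcal B\}$ (only concatenations lying in $\mathcal L$ are included). A decomposition $\mathcal L=\mathcal C^p\mathcal G\mathcal C^s$ consists of collections $\mathcal C^p,\mathcal G,\mathcal C^s\subset\mathcal L$ (which may contain the empty word) such that every word of $\mathcal L$ can be written (possibly non-uniquely) as $uvw$ with $u\in\mathcal C^p$, $v\in\mathcal G$, $w\in\mathcal C^s$. For $M\in\mathbb N$, $\mathcal G(M)=\{uvw \in\mathcal L\mid u\in\mathcal C^p, v\in\mathcal G, w\in\mathcal C^s, |u|\le M,|w|\le M\}$. (S)-specification for $\mathcal G\subset\mathcal L$, with gap size $t\in\mathbb N$: for all $m\ge1$ and $w^1,\dots,w^m\in\mathcal G$ there exist $v^1,\dots,v^{m-1}\in\mathcal L$ with $|v^i|=t$ for all $i$ such that $x:=w^1v^1w^2v^2\cdots v^{m-1}w^m\in\mathcal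 L$. (Per)-specification: (S)-specification holds (with some gap size $t$) and in addition the cylinder $[x]$ (the sequences having $x$ as the word in coordinates $1,\dots,|x|$) contains a point $y$ with $\sigma^{|x|+t}(y)=y$. A measure of maximal entropy is a $\sigma$-invariant Borel probability measure whose entropy equals $h_{\mathrm{top}}(X,\sigma)$; the system is intrinsically ergodic if it has exactly one. *)

(* Defs.v *)
From HB Require Import structures.
From mathcomp Require Import all_boot all_order all_algebra.
From mathcomp Require Import finmap.
From mathcomp Require Import all_classical all_reals all_analysis.

Set Implicit Arguments.
Unset Strict Implicit.
Unset Printing Implicit Defensive.

Import Order.TTheory GRing.Theory Num.Theory.
Import numFieldNormedType.Exports.

Local Open Scope classical_set_scope.
Local Open Scope ring_scope.

Inductive sidedness := OneSided | TwoSided.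

(* Only [0], [1] and [+] on coordinates are used; the semiring structures of
   [nat] and [int] let both cases share one definition of the shift. *)
Definition coordinate (s : sidedness) : nzSemiRingType :=
  match s with OneSided => nat | TwoSided => int end.

(* A shift space is nonempty, so its alphabet is too: the alphabet
   {1, ..., p + 1} is encoded as ['I_p.+1]. *)
Definition word (p : nat) := seq 'I_p.+1.

Definition fullshift (s : sidedness) (p : nat) : Type :=
  prod_topology (fun _ : coordinate s => discrete_topology 'I_p.+1).

HB.instance Definition _ (s : sidedness) (p : nat) :=
  Topological.copy (fullshift s p)
    (prod_topology (fun _ : coordinate s => discrete_topology 'I_p.+1)).
HB.instance Definition _ (s : sidedness) (p : nat) :=
  isPointed.Build (fullshift s p) (fun _ => ord0).

Definition borel (s : sidedness) (p : nat) :=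
  g_sigma_algebraType (@open (fullshift s p)).

Section ShiftSpaces.
Variables (s : sidedness) (p : nat).
Implicit Types (X : set (fullshift s p)) (x : fullshift s p).
Implicit Types (w : word p) (L Cp G Cs : set (word p)).

Definition left_shift x : fullshift s p := fun i => x (i + 1).

(* Shift-invariance means sigma(X) `<=` X for one-sided sequences, and
   sigma(X) = X when the shift is a homeomorphism. *)
Definition shift_invariant X : Prop :=
  match s with
  | OneSided => left_shift @` X `<=` X
  | TwoSided => left_shift @` X = X
  end.

Definition shift_space X : Prop := [/\ X !=set0, closed X & shift_invariant X].

Definition subword x (i : coordinate s) (n : nat) : word p :=
  mkseq (fun k => x (i + k%:R) : 'I_p.+1) n.

Definition language X : set (word p) :=
  [set w | exists2 x, X x & exists i, subword x i (size w) = w].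

Definition cylinder X w : set (fullshift s p) :=
  [set y | X y /\ subword y 1 (size w) = w].

Definition Per X (n : nat) : set (fullshift s p) :=
  [set x | X x /\ exists2 k, (1 <= k <= n)%N & iter k left_shift x = x].

Definition decomposition L Cp G Cs : Prop :=
  [/\ Cp `<=` L, G `<=` L, Cs `<=` L &
      forall w, L w -> exists u v z, [/\ Cp u, G v, Cs z & w = u ++ v ++ z]].

Definition enlarged L Cp G Cs (M : nat) : set (word p) :=
  [set x | L x /\ exists u v z,
    [/\ Cp u, G v, Cs z, (size u <= M)%N /\ (size z <= M)%N
      & x = u ++ v ++ z]].

(* w ++ v_1 ++ w_1 ++ ... ++ v_m ++ w_m, when [vs] and [ws] have size m *)
Definition interleave w (vs ws : seq (word p)) : word p :=
  w ++ flatten [seq q.1 ++ q.2 | q <- zip vs ws].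

(* The words to be glued are w :: ws, so that there is at least one, and the
   concatenation x obtained from them is required to satisfy P. *)
Definition gluing L G (t : nat) (P : set (word p)) : Prop :=
  forall w (ws : seq (word p)), {in w :: ws, forall z, G z} ->
    exists vs : seq (word p),
      [/\ size vs = size ws,
          {in vs, forall v, L v /\ size v = t} &
          P (interleave w vs ws)].

Definition S_specification L G : Prop :=
  exists t, gluing L G t L.

Definition Per_specification X G : Prop :=
  exists t, gluing (language X) G t
    [set x | language X x /\
      exists2 y, cylinder X x y & iter (size x + t) left_shift y = y].

End ShiftSpaces.

Arguments left_shift {s p} x.

Section Entropy.
Variables (R : realType) (s : sidedness) (p : nat).
Local Open Scope ereal_scope.

(* [lne 0 = -oo], so that a collection containing words of only finitely many
   lengths has entropy [-oo]. *)
Definition word_entropy (D : set (word p)) : \bar R :=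
  limn_esup (fun n : nat => (n%:R^-1)%:E *
    lne (#|[pred w : n.-tuple 'I_p.+1 | (w : word p) \in D]|%:R)%:E).

(* Topological entropy of the shift on X, following Adler, Konheim and
   McAndrew; covers of X consist of open sets of the full shift. *)
Definition open_cover (X : set (fullshift s p))
    (A : set (set (fullshift s p))) : Prop :=
  A `<=` open /\ X `<=` \bigcup_(U in A) U.

(* The join of A, sigma^-1 A, ..., sigma^-(n-1) A. *)
Definition iter_cover (A : set (set (fullshift s p))) (n : nat) :=
  iter n (fun B => [set U `&` left_shift @^-1` V | U in A & V in B]) [set setT].

Definition subcover_number (X : set (fullshift s p))
    (A : set (set (fullshift s p))) : \bar R :=
  ereal_inf [set (#|` F|%:R)%:E | F in
    [set F : {fset set (fullshift s p)} |
      [set` F] `<=` A /\ X `<=` \bigcup_(U in [set` F]) U]].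

Definition cover_entropy (X : set (fullshift s p))
    (A : set (set (fullshift s p))) : \bar R :=
  limn_esup (fun n : nat =>
    (n%:R^-1)%:E * lne (subcover_number X (iter_cover A n))).

Definition topological_entropy (X : set (fullshift s p)) : \bar R :=
  ereal_sup [set cover_entropy X A | A in open_cover X].

(* Kolmogorov-Sinai entropy. A finite measurable partition is given by its
   labelling map [xi]; the atoms of its n-th refinement are indexed by the
   itineraries of length n. Null atoms contribute 0 * ln 0 = 0. *)
Definition atom k (xi : borel s p -> 'I_k) n (a : {ffun 'I_n -> 'I_k}) :
    set (borel s p) :=
  [set x | forall i : 'I_n, xi (iter i left_shift x) = a i].

Definition partition_entropy (mu : probability (borel s p) R)
    k (xi : borel s p -> 'I_k) (n : nat) : R :=
  (- \sum_(a : {ffun 'I_n -> 'I_k})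
      (fine (mu (atom xi a)) * ln (fine (mu (atom xi a)))))%R.

Definition measure_entropy (mu : probability (borel s p) R) : \bar R :=
  ereal_sup [set h | exists k (xi : borel s p -> 'I_k),
    (forall a, measurable (xi @^-1` [set a])) /\
    h = limn_esup (fun n : nat =>
          (n%:R^-1 * partition_entropy mu xi n)%:E)].

Definition shift_invariant_measure (mu : probability (borel s p) R) : Prop :=
  forall B : set (borel s p), measurable B -> mu (left_shift @^-1` B) = mu B.

(* Borel probability measures on X are the Borel probability measures on the
   full shift which give X full measure. *)
Definition is_mme (X : set (fullshift s p)) (mu : probability (borel s p) R)
    : Prop :=
  [/\ mu X = 1, shift_invariant_measure mu &
      measure_entropy mu = topological_entropy X].

(* Measures are compared on measurable sets only: their values elsewhere carry
   no meaning. *)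
Definition intrinsically_ergodic (X : set (fullshift s p)) : Prop :=
  exists mu : probability (borel s p) R, is_mme X mu /\
    forall nu : probability (borel s p) R, is_mme X nu ->
      forall B : set (borel s p), measurable B -> nu B = mu B.

(* [Per X n] is always finite; when it is empty this is the zero measure. *)
Definition per_measure (X : set (fullshift s p)) (n : nat)
    (B : set (borel s p)) : \bar R :=
  (#|` fset_set (Per X n)|%:R^-1)%:E *
    \sum_(x \in Per X n) (\d_(x : borel s p) B : \bar R).

Lemma per_measureE X n : @per_measure X n =
  mscale (#|` fset_set (Per X n)|%:R^-1%:nng : {nonneg R})%R
    (msum (fun i => \d_(nth point (fset_set (Per X n)) i : borel s p))
       #|` fset_set (Per X n)|).
Proof.
apply/funext => B; rewrite /per_measure /mscale /msum/=.
have [finP|infP] := pselect (finite_set (Per X n)); last first.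
  suff -> : fset_set (Per X n) = fset0 by rewrite cardfs0 invr0 !mul0e.
  by rewrite /fset_set; case: pselect.
by rewrite fsbig_finite//= (big_nth point) big_mkord.
Qed.

Let per_measure0 X n : @per_measure X n set0 = 0.
Proof. by rewrite per_measureE measure0. Qed.

Let per_measure_ge0 X n B : 0 <= @per_measure X n B.
Proof. by rewrite per_measureE. Qed.

Let per_measure_sigma_additive X n : semi_sigma_additive (@per_measure X n).
Proof. by rewrite per_measureE; exact: measure_semi_sigma_additive. Qed.

HB.instance Definition _ X n := isMeasure.Build _ _ _ (@per_measure X n)
  (per_measure0 X n) (@per_measure_ge0 X n) (@per_measure_sigma_additive X n).

Definition weak_star_cvg (X : set (fullshift s p))
    (mu_ : nat -> {measure set (borel s p) -> \bar R})
    (mu : {measure set (borel s p) -> \bar R}) : Prop :=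
  forall f : fullshift s p -> R, {within X, continuous f} ->
    \int[mu_ n]_(x in X) (f x)%:E @[n --> \oo] --> \int[mu]_(x in X) (f x)%:E.

End Entropy.

(* Main.v *)
Require Import Defs.
From HB Require Import structures.
From mathcomp Require Import all_boot all_order all_algebra.
From mathcomp Require Import finmap.
From mathcomp Require Import all_classical all_reals all_analysis.
From mathcomp Require Import measurable_realfun.
From mathcomp Require Import zify ring lra.

Set Implicit Arguments.
Unset Strict Implicit.
Unset Printing Implicit Defensive.

Import Order.TTheory GRing.Theory Num.Theory.
Import numFieldNormedType.Exports.

Local Open Scope classical_set_scope.
Local Open Scope ring_scope.

(* Write h for the entropy of the language L, and #D_n for the number of words of
   length n in D.  The gap hypothesis, (S)-specification and submultiplicativity
   give e^{nh} <= #L_n <= K e^{nh} and show that, for M large, G(M) contains all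
   but a small proportion of L_n.

   Spreading mass uniformly over the orbit segments of points carrying the words
   of L_N and passing to an ultrafilter limit in N yields an invariant measure mu
   with mu[u] <= K^2 e^{-nh} for |u| = n, hence of entropy h, and such that, after
   gluing, two cylinders [w], [w'] of words of G(M)_n always satisfy
   mu([w] /\ sigma^{-k}[w']) >= c e^{-2nh} for some k in a window of bounded
   length, with c independent of n.

   If nu1 <> nu2 are measures of maximal entropy, let P be a positive set of the
   Hahn decomposition of nu1 - nu2.  By submodularity nu1 - nu2 takes its maximal
   value also on the union of the preimages of P and on the invariant set E which
   is the decreasing limit of the preimages of that union, so nu1(E) > 0 and
   nu2(E^c) > 0.  Words approximating E and E^c are then, by Gibbs' inequality, at
   least a fixed proportion of L_n each, so mu returns from E to E^c with positive
   probability, contradicting the invariance of E.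

   Under (Per)-specification #Per(n) >= c e^{nh}, while an n-cylinder contains at
   most n points of Per(n).  As the averages over Per(n) are invariant, their
   limits have entropy h, hence all coincide with mu. *)

(** * Finite entropy *)

(** The extensions in (III) have uncontrolled lengths up to tau. So two words of G(M) can be placed
    only at one of 2 tau + 1 possible distances, and lower bounds on [cnt G] are available only for
    one length in each bounded window. What matters throughout is that the constants depend on M and
    tau but never on the length n of the words.

    The pair bound on mu concerns words of G(M) alone. This is why the words carrying E, and those
    carrying its complement, must first be shown to form a fixed proportion of L_n: M is then chosen
    so that G(M) misses less than that. A single set S of words has to approximate E for nu1, nu2
    and mu at once, so that S and its complement are compared at the same length.

    Most upper bounds on the entropy of finite laws are Gibbs' inequality, each with its own
    reference law. Limits are formed for finitely additive functions on sets depending on finitely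
    many coordinates; such a limit becomes a measure as the image of Lebesgue measure under a coding
    of [0,1[ by words. *)

Section LimSup.
Context {R : realType}.
Local Open Scope ereal_scope.
Implicit Types (u : (\bar R)^nat) (c : \bar R).

Lemma limn_esup_le u c N : (forall n, (N <= n)%N -> u n <= c) ->
  limn_esup u <= c.
Proof.
move=> uc; apply: (@le_trans _ _ (ereal_sup (u @` [set n | (N <= n)%N]))).
  by apply: ereal_inf_lbound; exists [set n | (N <= n)%N] => //; exists N.
by apply: ge_ereal_sup => _ [n Nn <-]; exact: uc.
Qed.

Lemma limn_esup_ge u c : (forall N, exists2 n, (N <= n)%N & c <= u n) ->
  c <= limn_esup u.
Proof.
move=> cu; apply: le_ereal_inf_tmp => _ [V [N _ NV] <-].
have [n Nn cn] := cu N; apply: le_trans cn _.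
by apply: ereal_sup_ubound; exists n => //; exact: NV.
Qed.

Lemma limn_esup_lt u c : limn_esup u < c ->
  exists N, forall n, (N <= n)%N -> u n <= c.
Proof.
move=> /ereal_inf_lt [_ [V [N _ NV] <-] Vc]; exists N => n Nn.
apply: le_trans (ltW Vc); apply: ereal_sup_ubound.
by exists n => //; exact: NV.
Qed.

End LimSup.

Section FiniteEntropy.
Context {R : realType}.

Definition ent (T : finType) (d : T -> R) : R := - \sum_t d t * ln (d t).

(** Summation of [ln x <= x - 1] at [x = q t / d t], weighted by [d t]. The last hypothesis keeps
    the conventional value [ln 0 = 0] away from the right-hand side. *)
Lemma gibbs (T : finType) (d q : T -> R) :
  (forall t, 0 <= d t) -> (forall t, 0 <= q t) ->
  \sum_t d t = 1 -> \sum_t q t <= 1 -> (forall t, 0 < d t -> 0 < q t) ->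
  ent d <= - \sum_t d t * ln (q t).
Proof.
move=> d0 q0 d1 q1 dq; rewrite /ent lerN2 -subr_ge0 -sumrB.
apply: (@le_trans _ _ (\sum_t d t - \sum_t q t)); first by rewrite d1 subr_ge0.
rewrite -sumrB.
apply: ler_sum => t _.
have [dt0|dt0] := eqVneq (d t) 0.
  by rewrite dt0 !mul0r subr0 sub0r oppr_le0.
have dt : 0 < d t by rewrite lt_neqAle eq_sym dt0 d0.
have qt := dq _ dt.
rewrite -mulrBr -ler_pdivrMl// mulrBr mulVf// mulrC.
have : ln (q t / d t) <= q t / d t - 1.
  by rewrite -{1}(subrK 1 (q t / d t)) addrC; apply: le_ln1Dx;
    rewrite ltrBrDr addNr divr_gt0.
rewrite ln_div ?posrE//; lra.
Qed.

Definition pushd (T U : finType) (f : T -> U) (d : T -> R) (u : U) : R :=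
  \sum_(t | f t == u) d t.

Lemma pushd_ge0 (T U : finType) (f : T -> U) (d : T -> R) :
  (forall t, 0 <= d t) -> forall u, 0 <= pushd f d u.
Proof. by move=> d0 u; apply: sumr_ge0. Qed.

Lemma pushd_sum (T U : finType) (f : T -> U) (d : T -> R) (F : U -> R) :
  \sum_u pushd f d u * F u = \sum_t d t * F (f t).
Proof.
rewrite [RHS](partition_big f xpredT)//=; apply: eq_bigr => u _.
by rewrite /pushd mulr_suml; apply: eq_bigr => t /eqP ->.
Qed.

Lemma pushd_sum1 (T U : finType) (f : T -> U) (d : T -> R) :
  \sum_u pushd f d u = \sum_t d t.
Proof.
have := pushd_sum f d (fun=> 1).
by under eq_bigr do rewrite mulr1; move=> ->; under eq_bigr do rewrite mulr1.
Qed.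

(** An atom of [d] has at most the mass of the atom of the image that contains it, so each logarithm
    can only grow. *)
Lemma ent_pushd_le (T U : finType) (f : T -> U) (d : T -> R) :
  (forall t, 0 <= d t) -> ent (pushd f d) <= ent d.
Proof.
move=> d0; rewrite /ent pushd_sum lerN2; apply: ler_sum => t _.
have [dt0|dt0] := eqVneq (d t) 0; first by rewrite dt0 !mul0r.
have dt : 0 < d t by rewrite lt_neqAle eq_sym dt0 d0.
have H : d t <= pushd f d (f t).
  by rewrite /pushd (bigD1 t)//= lerDl sumr_ge0.
by rewrite ler_pM2l// ler_ln ?posrE// (lt_le_trans dt).
Qed.

(** Gibbs' inequality against the uniform law on [D]. *)
Lemma ent_le_card (T : finType) (d : T -> R) (D : {set T}) :
  (forall t, 0 <= d t) -> \sum_t d t = 1 -> (forall t, 0 < d t -> t \in D) ->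
  ent d <= ln (#|D|%:R).
Proof.
move=> d0 d1 dD.
have [t0 t0D] : exists t, t \in D.
  have : (0 : R) < \sum_t d t by rewrite d1.
  rewrite lt_neqAle => /andP[+ _]; rewrite eq_sym psumr_neq0//.
  by move=> /hasP[t _ /= dt]; exists t; exact: dD.
have D0 : (0 : R) < #|D|%:R by rewrite ltr0n card_gt0; apply/set0Pn; exists t0.
have Dn : (#|D|%:R : R) != 0 by rewrite gt_eqF.
apply: le_trans (@gibbs _ d (fun t => (t \in D)%:R / #|D|%:R) d0 _ d1 _ _) _.
- by move=> t; rewrite divr_ge0.
- rewrite -mulr_suml -natr_sum.
  have -> : (\sum_t (t \in D) = #|D|)%N.
    by rewrite -sum1_card [RHS]big_mkcond; apply: eq_bigr => t _; case: (t \in D).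
  by rewrite divff.
- by move=> t /dD ->; rewrite divr_gt0.
have -> : ln (#|D|%:R : R) = \sum_t d t * ln (#|D|%:R : R).
  by rewrite -mulr_suml d1 mul1r.
rewrite -sumrN; apply: ler_sum => t _.
have [dt0|dt0] := eqVneq (d t) 0; first by rewrite dt0 !mul0r oppr0.
have -> : t \in D by apply: dD; rewrite lt_neqAle eq_sym dt0 d0.
by rewrite mul1r lnV ?posrE// mulrN opprK.
Qed.

End FiniteEntropy.

Section TupleSums.
Context {R : realType} {A : finType}.

Lemma sum_tuple0 (F : seq A -> R) : \sum_(w : 0.-tuple A) F w = F [::].
Proof.
rewrite (big_pred1 [tuple]) => [//|w /=]; by symmetry; apply/eqP; exact: tuple0.
Qed.

Lemma sum_tuple_cat n m (F : seq A -> R) :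
  \sum_(w : (n + m).-tuple A) F w =
  \sum_(u : n.-tuple A) \sum_(v : m.-tuple A) F (u ++ v).
Proof.
rewrite pair_big/=.
have szt (w : (n + m).-tuple A) : size (take n w) == n.
  by rewrite size_takel// size_tuple leq_addr.
have szd (w : (n + m).-tuple A) : size (drop n w) == m.
  by rewrite size_drop size_tuple addKn.
rewrite (reindex (fun q : n.-tuple A * m.-tuple A => [tuple of q.1 ++ q.2]))//=.
exists (fun w => (Tuple (szt w), Tuple (szd w))).
- move=> [u v] _; congr (_, _); apply/val_inj => /=.
  + by rewrite take_size_cat ?size_tuple.
  + by rewrite drop_size_cat ?size_tuple.
- by move=> w _; apply/val_inj => /=; rewrite cat_take_drop.
Qed.

Lemma sum_tuple1 (F : seq A -> R) :
  \sum_(w : 1.-tuple A) F w = \sum_a F [:: a].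
Proof.
rewrite (reindex (fun a : A => [tuple a])) => [//|].
exists (fun w => thead w) => [a _|w _]; first by rewrite theadE.
by case: w => [[|a [|b u]]//= uP]; exact/val_inj.
Qed.

Lemma sum_tuple_cons n (F : seq A -> R) :
  \sum_(w : n.+1.-tuple A) F w = \sum_a \sum_(v : n.-tuple A) F (a :: v).
Proof.
rewrite -[LHS]/(\sum_(w : (1 + n).-tuple A) F w) sum_tuple_cat.
by rewrite (sum_tuple1 (fun u => \sum_(v : n.-tuple A) F (u ++ v))).
Qed.

Lemma sum_tuple_rcons n (F : seq A -> R) :
  \sum_(w : n.+1.-tuple A) F w = \sum_(v : n.-tuple A) \sum_a F (rcons v a).
Proof.
have -> : \sum_(w : n.+1.-tuple A) F w = \sum_(w : (n + 1).-tuple A) F w.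
  by rewrite addn1.
rewrite sum_tuple_cat; apply: eq_bigr => v _.
by rewrite (sum_tuple1 (fun u => F (v ++ u))); under eq_bigr do rewrite cats1.
Qed.

End TupleSums.

(** * Block entropies of stationary laws *)

Section Stationary.
Context {R : realType} {p : nat}.
Notation A := 'I_p.+1.
Implicit Types (d : word p -> R) (u v w : word p).

(** These are the cylinder probabilities of a shift-invariant law: summing over the last letter
    expresses consistency of the marginals, summing over the first expresses invariance. *)
Definition stationary d : Prop :=
  [/\ d [::] = 1, forall u, 0 <= d u,
      forall u, \sum_a d (rcons u a) = d u &
      forall u, \sum_a d (a :: u) = d u].

Definition block_entropy d n : R := ent (fun w : n.-tuple A => d w).

Lemma stationary_catr d u m : stationary d ->
  \sum_(v : m.-tuple A) d (u ++ v) = d u.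
Proof.
move=> [_ _ dr _]; elim: m => [|m IHm] in u *.
  by rewrite (sum_tuple0 (fun v => d (u ++ v))) cats0.
rewrite (sum_tuple_rcons _ (fun v => d (u ++ v))) -[RHS]IHm.
by apply: eq_bigr => v _; rewrite -[RHS]dr; under eq_bigr do rewrite -rcons_cat.
Qed.

Lemma stationary_catl d u m : stationary d ->
  \sum_(v : m.-tuple A) d (v ++ u) = d u.
Proof.
move=> [_ _ _ dl]; elim: m => [|m IHm] in u *.
  by rewrite (sum_tuple0 (fun v => d (v ++ u))).
rewrite (sum_tuple_cons _ (fun v => d (v ++ u))) exchange_big/= -[RHS]IHm.
by apply: eq_bigr => v _; rewrite -[RHS]dl.
Qed.

Lemma stationary_sum1 d m : stationary d -> \sum_(v : m.-tuple A) d v = 1.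
Proof. by move=> dS; have [<- _ _ _] := dS; rewrite -(stationary_catr [::] m dS). Qed.

Lemma stationary_le_catl d u v : stationary d -> d (u ++ v) <= d u.
Proof.
move=> dS; have [_ d0 _ _] := dS.
by rewrite -(stationary_catr u (size v) dS) (bigD1 (in_tuple v))//= lerDl sumr_ge0.
Qed.

Lemma stationary_le_catr d u v : stationary d -> d (u ++ v) <= d v.
Proof.
move=> dS; have [_ d0 _ _] := dS.
by rewrite -(stationary_catl v (size u) dS) (bigD1 (in_tuple u))//= lerDl sumr_ge0.
Qed.

(** Gibbs' inequality with the product of the two marginals as reference; consistency identifies the
    marginal of the left part, invariance that of the right part. *)
Lemma block_entropyD d n m : stationary d ->
  block_entropy d (n + m) <= block_entropy d n + block_entropy d m.
Proof.
move=> dS; have [_ d0 _ _] := dS.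
pose q w := d (take n w) * d (drop n w).
have qE (u : n.-tuple A) v : q (u ++ v) = d u * d v.
  by rewrite /q take_size_cat ?drop_size_cat ?size_tuple.
apply: le_trans (@gibbs _ _ _ (fun w : (n + m).-tuple A => q w) _ _ _ _ _) _.
- by move=> w; exact: d0.
- by move=> w; apply: mulr_ge0; exact: d0.
- exact: stationary_sum1.
- rewrite (sum_tuple_cat n m q).
  under eq_bigr do under eq_bigr do rewrite qE.
  under eq_bigr do rewrite -mulr_sumr stationary_sum1// mulr1.
  by rewrite stationary_sum1.
- move=> w; rewrite -{1}(cat_take_drop n w) => dw.
  by apply: mulr_gt0; apply: lt_le_trans dw _;
    [exact: stationary_le_catl|exact: stationary_le_catr].
rewrite (sum_tuple_cat n m (fun w => d w * ln (q w))).
under eq_bigr do under eq_bigr do rewrite qE.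
have lnE (u : n.-tuple A) (v : m.-tuple A) :
    d (u ++ v) * ln (d u * d v) = d (u ++ v) * ln (d u) + d (u ++ v) * ln (d v).
  have [duv|duv] := eqVneq (d (u ++ v)) 0; first by rewrite duv !mul0r addr0.
  have duv0 : 0 < d (u ++ v) by rewrite lt_neqAle eq_sym duv d0.
  rewrite lnM ?mulrDr// posrE; apply: lt_le_trans duv0 _;
    [exact: stationary_le_catl|exact: stationary_le_catr].
under eq_bigr do under eq_bigr do rewrite lnE.
under eq_bigr do rewrite big_split/=.
rewrite big_split/= opprD /block_entropy /ent lerD// lerN2.
  apply: ler_sum => u _; rewrite -mulr_suml.
  by rewrite stationary_catr.
rewrite exchange_big/=; apply: ler_sum => v _; rewrite -mulr_suml.
by rewrite stationary_catl.
Qed.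

Lemma block_entropy_ge0 d n : stationary d -> 0 <= block_entropy d n.
Proof.
move=> dS; have [_ d0 _ _] := dS; rewrite /block_entropy /ent -sumrN sumr_ge0//.
move=> w _; rewrite -mulrN mulr_ge0// oppr_ge0 ln_le0//.
by have [<- _ _ _] := dS; exact: (stationary_le_catl [::] w dS).
Qed.

Lemma block_entropy_le d n : stationary d ->
  block_entropy d n <= n%:R * ln (p.+1%:R : R).
Proof.
move=> dS; have [_ d0 _ _] := dS.
have := @ent_le_card R _ (fun w : n.-tuple A => d w) [set: n.-tuple A]
  (fun t => d0 (tval t)) (stationary_sum1 n dS) (fun t _ => finset.in_setT t).
by rewrite cardsT card_tuple card_ord natrX lnXn ?ltr0n// mulr_natl.
Qed.

Lemma block_entropy_mul d q a r : stationary d ->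
  block_entropy d (a * q + r) <=
  a%:R * block_entropy d q + r%:R * ln (p.+1%:R : R).
Proof.
move=> dS; elim: a => [|a IHa].
  by rewrite mul0n add0n mul0r add0r block_entropy_le.
rewrite mulSn -addnA; apply: le_trans (block_entropyD _ _ dS) _.
by rewrite -addn1 natrD addrC mulrDl mul1r addrAC lerD2r.
Qed.

(** With [n = a q + r], the [a] full blocks cost [block_entropy d q] each and the remainder at most
    [q ln (p + 1)]. The error does not grow with [n], so after division by [n q] every single [q]
    bounds the entropy rate by [block_entropy d q / q]. *)
Lemma block_entropy_ratio d q n : stationary d -> (0 < q)%N ->
  block_entropy d n * q%:R <=
  n%:R * block_entropy d q + q%:R * q%:R * ln (p.+1%:R : R).
Proof.
move=> dS q0; rewrite {1}(divn_eq n q).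
have l0 : 0 <= ln (p.+1%:R : R) by rewrite ln_ge0// ler1n.
apply: le_trans (ler_wpM2r _ (block_entropy_mul _ _ _ dS)) _ => //.
rewrite mulrDl lerD//.
  rewrite mulrAC ler_wpM2r ?block_entropy_ge0// -natrM ler_nat.
  exact: leq_trunc_div.
rewrite mulrAC ler_wpM2r// ler_wpM2r// ler_nat ltnW// ltn_mod//.
Qed.

End Stationary.

(** * Counting words *)

Section Counting.
Context {R : realType} {p : nat}.
Notation A := 'I_p.+1.
Implicit Types (D L : set (word p)) (u v : word p).

Definition cnt D (n : nat) : nat :=
  #|[pred w : n.-tuple A | (w : word p) \in D]|.

Lemma cnt_sum D n :
  (cnt D n)%:R = \sum_(w : n.-tuple A) ((w : word p) \in D)%:R :> R.
Proof.
rewrite /cnt -sum1_card natr_sum big_mkcond/=; apply: eq_bigr => w _.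
by rewrite inE; case: (_ \in D).
Qed.

Lemma cnt_sub D D' n : D `<=` D' -> (cnt D n <= cnt D' n)%N.
Proof.
move=> DD'; apply: subset_leq_card; apply/fintype.subsetP => w.
by move=> /set_mem/DD'/mem_set.
Qed.

Lemma cnt_le_full D n : (cnt D n <= p.+1 ^ n)%N.
Proof. by rewrite -[X in (X ^ _)%N]card_ord -card_tuple max_card. Qed.

Lemma cnt0_le1 D : (cnt D 0 <= 1)%N.
Proof. by rewrite (leq_trans (cnt_le_full D 0)). Qed.

Lemma cnt_gt0 D u : D u -> (0 < cnt D (size u))%N.
Proof.
by move=> Du; apply/card_gt0P; exists (in_tuple u); exact: mem_set.
Qed.

Lemma cnt_ge_inj (T : finType) (P : {pred T}) (f : T -> word p) D n :
  (forall t, t \in P -> D (f t) /\ size (f t) = n) ->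
  {in P &, injective f} -> (#|P| <= cnt D n)%N.
Proof.
move=> fP finj; pose g t : n.-tuple A := insubd [tuple of nseq n ord0] (f t).
have gE t : t \in P -> g t = f t :> seq A.
  by move=> /fP[_ /eqP szf]; rewrite /g val_insubd szf.
rewrite -(@card_in_imset _ _ g P) => [|t t' tP t'P gtt'].
  apply: subset_leq_card; apply/fintype.subsetP => w /finset.imsetP[t tP ->].
  by apply: mem_set; rewrite gE//; have [] := fP _ tP.
by apply: finj => //; rewrite -gE// -gE// gtt'.
Qed.

Lemma cnt_le_inj (T : finType) (P : {pred T}) (f : word p -> T) D n :
  (forall u, D u -> size u = n -> f u \in P) ->
  (forall u v, D u -> D v -> size u = n -> size v = n -> f u = f v -> u = v) ->
  (cnt D n <= #|P|)%N.
Proof.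
move=> fP finj.
rewrite /cnt -(@card_in_imset _ _ (fun w : n.-tuple A => f w)) => [|w w'].
  apply: subset_leq_card; apply/fintype.subsetP => _ /finset.imsetP[w + ->].
  by move=> /set_mem Dw; rewrite fP ?size_tuple.
move=> /set_mem Dw /set_mem Dw' fww'.
by apply/val_inj => /=; apply: finj fww'; rewrite ?size_tuple.
Qed.

Lemma cnt_cat_le D D1 D2 n m :
  (forall u v, size u = n -> size v = m -> D (u ++ v) -> D1 u /\ D2 v) ->
  (cnt D (n + m) <= cnt D1 n * cnt D2 m)%N.
Proof.
move=> DD; rewrite -(ler_nat R) natrM !cnt_sum.
rewrite (sum_tuple_cat n m (fun w : word p => (w \in D)%:R)).
rewrite mulr_suml; apply: ler_sum => u _; rewrite mulr_sumr.
apply: ler_sum => v _; rewrite -natrM ler_nat.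
case: (boolP (_ \in D)) => // /set_mem /DD -[]; rewrite ?size_tuple// => D1u D2v.
by rewrite !mem_set.
Qed.

(** Extension is to the right, because a one-sided shift space may contain words that cannot be
    extended to the left. *)
Definition language_axioms L : Prop :=
  [/\ L [::], forall u v, L (u ++ v) -> L u, forall u v, L (u ++ v) -> L v &
      forall u, L u -> exists a, L (rcons u a)].

End Counting.

Section Growth.
Context {R : realType} {p : nat}.
Notation A := 'I_p.+1.
Implicit Types (C : set (word p)) (u v : word p).

Lemma word_entropy_lt C (h : R) : (word_entropy R C < h%:E)%E ->
  exists h' K : R, [/\ h' < h, 0 < K &
    forall n, (cnt C n)%:R <= K * expR (n%:R * h')].
Proof.
move=> Ch.
(* The entropy may be [-oo], when [C] has words of finitely many lengths only; any [h'] below [h]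
   then does. *)
have [h' Ch' h'h] : exists2 h' : R, (word_entropy R C < h'%:E)%E & h' < h.
  move: Ch; case: (word_entropy R C) => [r| |]; rewrite ?lte_fin//.
    by move=> rh; exists ((r + h) / 2); rewrite ?lte_fin; lra.
  by move=> _; exists (h - 1); [rewrite ltNyr|lra].
have [N CN] := limn_esup_lt Ch'.
have p0 : 0 < p.+1%:R :> R by rewrite ltr0n.
(* For lengths below [N] the trivial bound [(p + 1) ^ N] is used. The second factor compensates for
   a negative [h'], for which [expR (n h')] is less than 1. *)
exists h', (p.+1%:R ^+ N * expR (N%:R * `|h'|)).
split=> [//||n]; first by rewrite mulr_gt0 ?exprn_gt0 ?expR_gt0.
have [nN|Nn] := ltnP n N.
  apply: (@le_trans _ _ (p.+1%:R ^+ N)).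
    rewrite -natrX ler_nat (leq_trans (cnt_le_full C n))//.
    by rewrite leq_pexp2l// ltnW.
  rewrite -mulrA ler_peMr ?exprn_ge0// -expRD -[leLHS]expR0 ler_expR.
  have : - (n%:R * h') <= N%:R * `|h'|.
    rewrite -mulrN; apply: (@le_trans _ _ (n%:R * `|h'|)).
      by rewrite ler_wpM2l// -normrN ler_norm.
    by rewrite ler_wpM2r// ler_nat ltnW.
  by move=> ?; lra.
apply: (@le_trans _ _ (expR (n%:R * h'))); last first.
  rewrite ler_peMl ?expR_ge0// -[X in X <= _]mulr1 ler_pM//.
    by rewrite -natrX ler1n expn_gt0.
  by rewrite -[leLHS]expR0 ler_expR mulr_ge0.
have [->|c0] := posnP (cnt C n); first exact: expR_ge0.
have [n0|n0] := posnP n.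
  by rewrite n0 mul0r expR0 (ler_nat R _ 1) cnt0_le1.
have := CN _ Nn; rewrite -/(cnt C n) lne_EFin ?ltr0n//.
rewrite -EFinM lee_fin ler_pdivrMl ?ltr0n// => H.
by rewrite -[leLHS]lnK ?posrE ?ltr0n// ler_expR.
Qed.

Section Language.
Variable L : set (word p).
Hypothesis Llang : language_axioms L.

Lemma language_extend u N : L u -> (size u <= N)%N ->
  exists v, L (u ++ v) /\ size (u ++ v) = N.
Proof.
have [_ _ _ Lr] := Llang; move=> Lu /subnKC <-.
elim: (N - size u)%N => [|n [v [Lv vn]]]; first by exists [::]; rewrite cats0 addn0.
have [a La] := Lr _ Lv; exists (rcons v a).
by rewrite -rcons_cat size_rcons vn addnS.
Qed.

Lemma cntL_gt0 n : (0 < cnt L n)%N.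
Proof.
have [L0 _ _ _] := Llang.
by have [v [/cnt_gt0 + vn]] := language_extend L0 (leq0n n); rewrite vn.
Qed.

Lemma cntL_ge1 n : 1 <= (cnt L n)%:R :> R.
Proof. by rewrite ler1n cntL_gt0. Qed.

Lemma cntLD n m : (cnt L (n + m) <= cnt L n * cnt L m)%N.
Proof.
have [_ Ll Lr _] := Llang.
by apply: (@cnt_cat_le R) => u v _ _ Luv; split; [exact: Ll Luv|exact: Lr Luv].
Qed.

Lemma cntL_mul a n r : (cnt L (a * n + r) <= cnt L n ^ a * p.+1 ^ r)%N.
Proof.
elim: a => [|a IHa]; first by rewrite mul0n add0n mul1n cnt_le_full.
rewrite mulSn -addnA (leq_trans (cntLD _ _))// expnS -mulnA.
by rewrite leq_mul2l IHa orbT.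
Qed.

Let lnc n : R := ln (cnt L n)%:R.

Let lnc_ge0 n : 0 <= lnc n. Proof. by rewrite ln_ge0// cntL_ge1. Qed.

Let word_entropyE :
  word_entropy R L = limn_esup (fun n => (n%:R^-1 * lnc n)%:E).
Proof.
congr limn_esup; apply/funext => n.
by rewrite -/(cnt L n) lne_EFin ?ltr0n ?cntL_gt0.
Qed.

Let p1_gt0 : 0 < p.+1%:R :> R. Proof. by rewrite ltr0n. Qed.

Let lnc_mul a n r :
  lnc (a * n + r) <= a%:R * lnc n + r%:R * ln (p.+1%:R : R).
Proof.
have c0 m : 0 < (cnt L m)%:R :> R by rewrite ltr0n cntL_gt0.
have -> : a%:R * lnc n + r%:R * ln (p.+1%:R : R) =
    ln ((cnt L n)%:R ^+ a * p.+1%:R ^+ r).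
  by rewrite lnM ?posrE ?exprn_gt0// lnXn// lnXn// !mulr_natl.
rewrite ler_ln ?posrE// ?mulr_gt0 ?exprn_gt0//.
by rewrite -!natrX -natrM ler_nat cntL_mul.
Qed.

(** The upper half of Fekete's lemma: if [m = a n + r], the remainder [r < n] contributes a bounded
    amount, which disappears after division by [m]. *)
Let lnc_ratio n : (0 < n)%N -> (word_entropy R L <= (lnc n / n%:R)%:E)%E.
Proof.
move=> n0; rewrite word_entropyE; apply/lee_addgt0Pr => e e0.
have nR : 0 < n%:R :> R by rewrite ltr0n.
have l0 : 0 <= ln (p.+1%:R : R) by rewrite ln_ge0// ler1n.
have [N Ne] : exists N : nat, n%:R * ln (p.+1%:R : R) / e <= N%:R.
  exists (Num.trunc (n%:R * ln (p.+1%:R : R) / e)).+1.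
  by rewrite ltW// truncnS_gt.
apply: (@limn_esup_le _ _ _ N.+1) => m Nm.
have m0 : 0 < m%:R :> R by rewrite ltr0n (leq_trans _ Nm).
rewrite -EFinD lee_fin ler_pdivrMl// {1}(divn_eq m n).
apply: le_trans (lnc_mul _ _ _) _; rewrite mulrDr lerD//.
  rewrite mulrCA mulrC ler_wpM2l// ler_pdivlMr// -natrM ler_nat.
  exact: leq_trunc_div.
apply: (@le_trans _ _ (n%:R * ln (p.+1%:R : R))).
  by rewrite ler_wpM2r// ler_nat ltnW// ltn_mod.
by rewrite -ler_pdivrMr// (le_trans Ne)// ler_nat ltnW.
Qed.

(** By submultiplicativity the growth rate is a lower bound of all the ratios, so the lower bound on
    [cnt L n] has constant 1. The upper bound loses an arbitrary [e]; under the decomposition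
    [cntL_le] improves it to a constant factor. *)
Lemma language_entropy : exists h : R, [/\ 0 <= h, word_entropy R L = h%:E,
  forall n, expR (n%:R * h) <= (cnt L n)%:R &
  forall e, 0 < e -> exists N, forall n, (N <= n)%N ->
    (cnt L n)%:R <= expR (n%:R * (h + e))].
Proof.
have L0 : (0 <= word_entropy R L)%E.
  rewrite word_entropyE; apply: limn_esup_ge => N; exists N => //.
  by rewrite lee_fin mulr_ge0// invr_ge0.
have Lfin : word_entropy R L \is a fin_num.
  rewrite ge0_fin_numE//; exact: le_lt_trans (lnc_ratio (ltn0Sn 0)) (ltry _).
have lnLK m : expR (lnc m) = (cnt L m)%:R by rewrite lnK// posrE ltr0n cntL_gt0.
exists (fine (word_entropy R L)); split.
- exact: fine_ge0.
- by rewrite fineK.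
- move=> n; have [->|n0] := posnP n; first by rewrite mul0r expR0 cntL_ge1.
  rewrite -lnLK ler_expR -ler_pdivlMl ?ltr0n// mulrC -lee_fin fineK//.
  exact: lnc_ratio.
- move=> e e0.
  have : (word_entropy R L < (fine (word_entropy R L) + e)%:E)%E.
    by rewrite EFinD fineK// lteDl// lte_fin.
  rewrite {1}word_entropyE => /limn_esup_lt[N LN]; exists N.+1 => n Nn.
  have n0 : 0 < n%:R :> R by rewrite ltr0n (leq_trans _ Nn).
  by rewrite -lnLK ler_expR -ler_pdivrMl// -lee_fin LN// ltnW.
Qed.

End Language.
End Growth.

Section Gluing.
Context {R : realType} {p : nat}.
Notation A := 'I_p.+1.
Implicit Types (D : set (word p)) (u v w : word p) (vs ws : seq (word p)).

Lemma cnt_cover (I : finType) (P : {pred I}) (E : I -> set (word p)) D n :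
  (forall w, D w -> size w = n -> exists2 i, i \in P & E i w) ->
  (cnt D n <= \sum_(i in P) cnt (E i) n)%N.
Proof.
move=> DE; rewrite -(ler_nat R) natr_sum cnt_sum.
under eq_bigr do rewrite cnt_sum.
rewrite exchange_big/=; apply: ler_sum => w _.
case: (boolP (_ \in D)) => [/set_mem Dw|_]; last by apply: sumr_ge0.
have [i iP Ew] := DE _ Dw (size_tuple w).
by rewrite (bigD1 i)//= mem_set//= lerDl sumr_ge0.
Qed.

Lemma size_flatten_zip n t vs ws : size vs = size ws ->
  {in vs, forall v, size v = t} -> {in ws, forall w, size w = n} ->
  size (flatten [seq q.1 ++ q.2 | q <- zip vs ws]) = (size ws * (t + n))%N.
Proof.
elim: vs ws => [|v vs IH] [|w ws]//= [vw] vt wn.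
rewrite size_cat size_cat vt ?mem_head// wn ?mem_head// IH//.
  by move=> x xvs; apply: vt; rewrite in_cons xvs orbT.
by move=> x xws; apply: wn; rewrite in_cons xws orbT.
Qed.

Lemma flatten_zip_inj n t vs ws vs' ws' :
  size vs = size ws -> size vs' = size ws' -> size ws = size ws' ->
  {in vs, forall v, size v = t} -> {in vs', forall v, size v = t} ->
  {in ws, forall w, size w = n} -> {in ws', forall w, size w = n} ->
  flatten [seq q.1 ++ q.2 | q <- zip vs ws] =
  flatten [seq q.1 ++ q.2 | q <- zip vs' ws'] -> ws = ws'.
Proof.
elim: vs ws vs' ws' => [|v vs IH] [|w ws] [|v' vs'] [|w' ws']//=.
move=> [vw] [vw'] [ww'] vt vt' wn wn'.
have vE : size v = size v' by rewrite vt ?vt' ?mem_head.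
have wE : size w = size w' by rewrite wn ?wn' ?mem_head.
move=> /eqP; rewrite eqseq_cat ?size_cat ?vE ?wE// eqseq_cat//.
move=> /andP[/andP[_ /eqP ->]] /eqP flE; congr cons.
apply: IH flE => // x xs; [apply: vt|apply: vt'|apply: wn|apply: wn'];
  by rewrite in_cons xs orbT.
Qed.

(** Gaps of fixed length [t] put the glued words of length [n] at fixed positions, so the
    concatenation determines them and distinct tuples give distinct words of [L]. *)
Lemma gluing_cnt (L G : set (word p)) t n k : gluing L G t L ->
  (cnt G n * cnt G n ^ k <= cnt L (n + k * (t + n)))%N.
Proof.
move=> glue.
pose PG := [pred w : n.-tuple A | (w : word p) \in G].
pose P := predX PG (ffun_on PG : {pred {ffun 'I_k -> n.-tuple A}}).
pose W (g : {ffun 'I_k -> n.-tuple A}) : seq (word p) :=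
  [seq tval (g i) | i <- enum 'I_k].
have Wn g : {in W g, forall w, size w = n}.
  by move=> w /mapP[i _ ->]; rewrite size_tuple.
have Wk g : size (W g) = k by rewrite size_map size_enum_ord.
have ex (q : n.-tuple A * {ffun 'I_k -> n.-tuple A}) :
    exists vs : seq (word p), q \in P -> [/\ size vs = size (W q.2),
      {in vs, forall v, size v = t} & L (interleave q.1 vs (W q.2))].
  have [qP|_] := boolP (q \in P); last by exists [::].
  move: qP => /andP[/set_mem q1 /ffun_onP q2].
  have [|vs [vsW vst Lx]] := glue q.1 (W q.2).
    move=> z; rewrite in_cons => /orP[/eqP ->//|/mapP[i _ ->]].
    exact: (set_mem (q2 i)).
  by exists vs => _; split => // v /vst[].
(* One choice of gap words for each tuple; the injectivity below holds whatever gaps were chosen. *)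
have [F FP] := boolp.choice ex.
have -> : (cnt G n * cnt G n ^ k = #|P|)%N.
  by rewrite cardX card_ffun_on card_ord.
pose f (q : n.-tuple A * {ffun 'I_k -> n.-tuple A}) :=
  interleave q.1 (F q) (W q.2).
apply: (@cnt_ge_inj p _ P f L _).
  move=> q /FP[szF Ft Lq]; split=> //.
  by rewrite size_cat size_tuple (size_flatten_zip szF Ft (@Wn _)) Wk.
move=> [q g] [q' g'] /FP/=[szF Ft Lq] /FP/=[szF' Ft' Lq'].
rewrite /f /interleave/= => /eqP; rewrite eqseq_cat ?size_tuple// => /andP[/eqP/val_inj qE /eqP fE].
subst q'; congr (_, _); have WE : W g = W g'.
  by apply: (@flatten_zip_inj n t) fE; rewrite ?szF ?szF' ?Wk//; exact: Wn.
apply/ffunP => i; apply/val_inj; have := congr1 (nth [::] ^~ i) WE.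
by rewrite /= !(nth_map i) -?enumT ?size_enum_ord// nth_ord_enum.
Qed.

End Gluing.

(** * Counting with the decomposition *)

Section GrowthEstimates.
Context {R : realType} {p : nat}.
Notation A := 'I_p.+1.
Implicit Types (u v w z : word p).
Variables (L Cp G Cs : set (word p)) (t : nat) (h h' K : R).
Hypothesis Llang : language_axioms L.
Hypothesis Ldec : decomposition L Cp G Cs.
Hypothesis glue : gluing L G t L.
Hypothesis h_ge0 : 0 <= h.
Hypothesis L_lower : forall n, expR (n%:R * h) <= (cnt L n)%:R.
Hypothesis L_upper : forall e : R, 0 < e -> exists N, forall n, (N <= n)%N ->
  (cnt L n)%:R <= expR (n%:R * (h + e)).
Hypothesis h'h : h' < h.
Hypothesis K_gt0 : 0 < K.
Hypothesis C_upper : forall n, (cnt (Cp `|` Cs) n)%:R <= K * expR (n%:R * h').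
Hypothesis ext : forall M, exists tau, forall v, enlarged L Cp G Cs M v ->
  exists u w, [/\ (size u <= tau)%N, (size w <= tau)%N & G (u ++ v ++ w)].

(** Gluing [N + 1] words gives [cnt G n ^ (N + 1)] words of [L] of length at most [(N + 1)(n + t)].
    The number of these grows at rate [h], so taking the root of order [N + 1] with [N] large
    removes all constants. *)
Lemma cntG_le n : (cnt G n)%:R <= expR ((n + t)%:R * h).
Proof.
have [->|G0] := posnP (cnt G n); first exact: expR_ge0.
have [nt0|nt0] := posnP (n + t)%N.
  rewrite nt0; have -> : n = 0%N by lia.
  by rewrite mul0r expR0 (ler_nat R _ 1) cnt0_le1.
have gR : 0 < (cnt G n)%:R :> R by rewrite ltr0n.
rewrite -[leLHS]lnK ?posrE// ler_expR; apply/ler_addgt0Pr => e e0.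
have ntR : 0 < (n + t)%:R :> R by rewrite ltr0n.
have e'0 : 0 < e / (n + t)%:R by rewrite divr_gt0.
have [N LN] := L_upper e'0.
have NN : (N <= n + N * (t + n))%N by nia.
have := le_trans (_ : (cnt G n ^ N.+1)%:R <= _) (LN _ NN).
rewrite ler_nat expnS => /(_ (gluing_cnt n N glue)).
rewrite -expnS natrX -[X in X ^+ _ <= _]lnK ?posrE// -expRM_natl ler_expR => H.
rewrite -(ler_pM2l (_ : 0 < N.+1%:R)) ?ltr0n//; apply: le_trans H _.
have -> : (n + t)%:R * h + e = (n + t)%:R * (h + e / (n + t)%:R).
  by rewrite mulrDr mulrCA divff ?mulr1// gt_eqF.
rewrite mulrA ler_wpM2r ?addr_ge0 ?(ltW e'0)//.
by rewrite -natrM ler_nat; nia.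
Qed.

(* s ^+ 2 is the ratio between the growth rates of Cp `|` Cs and of L. *)
Let s : R := expR ((h' - h) / 2).

Let s_lt1 : s < 1.
Proof. by rewrite /s -[ltRHS]expR0 ltr_expR pmulr_llt0 ?invr_gt0// subr_lt0. Qed.

Let s_ge0 : 0 <= s. Proof. exact: expR_ge0. Qed.

Let K_ge0 : 0 <= K. Proof. exact: ltW. Qed.

Let geometric_sum_le N : \sum_(i < N) s ^+ i <= (1 - s)^-1.
Proof.
have s1 : 0 < 1 - s by rewrite subr_gt0.
rewrite -[leRHS]mul1r ler_pdivlMr// mulrC.
rewrite -(opprB s 1) mulNr -subrX1 opprB.
by rewrite gerBl exprn_ge0// ltW.
Qed.

Let pieces i j k : set (word p) := [set w | exists u v z,
  [/\ Cp u, G v & Cs z] /\ [/\ w = u ++ v ++ z, size u = i, size v = j & size z = k]].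

Let cnt_pieces i j k :
  (cnt (pieces i j k) (i + (j + k)) <= cnt Cp i * (cnt G j * cnt Cs k))%N.
Proof.
apply: leq_trans (_ : cnt Cp i * cnt [set w | exists v z,
  [/\ G v, Cs z, w = v ++ z, size v = j & size z = k]] (j + k) <= _)%N.
  apply: (@cnt_cat_le R) => u v ui vjk [u' [v' [z' [[Cu Gv Cz] [/eqP E u'i v'j z'k]]]]].
  move: E; rewrite eqseq_cat ?ui ?u'i// => /andP[/eqP -> /eqP ->].
  by split=> //; exists v', z'.
rewrite leq_mul2l; apply/orP; right.
apply: (@cnt_cat_le R) => u v uj vk [v' [z' [Gv Cz /eqP + v'j z'k]]].
by rewrite eqseq_cat ?uj ?v'j// => /andP[/eqP -> /eqP ->].
Qed.

Let B : R := K ^+ 2 * expR (t%:R * h) * (1 - s)^-1 ^+ 2.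

(** Words with prefix length [i], suffix length [k] and core length [j] number at most [K^2
    e^((i+k)h') e^((j+t)h) = K^2 e^(th) s^(2(i+k)) e^(nh)]. Of the two factors [s^(i+k)], one is at
    most [s^N]; the other is summed over all [i] and [k] and gives [(1 - s)^-2]. *)
Let cnt_prefix_suffix_le N (D : set (word p)) n :
  (forall w, D w -> exists u v z,
     [/\ Cp u, G v, Cs z, w = u ++ v ++ z & (N <= size u + size z)%N]) ->
  (cnt D n)%:R <= B * s ^+ N * expR (n%:R * h).
Proof.
move=> DN.
pose P := [pred q : 'I_n.+1 * 'I_n.+1 | (N <= q.1 + q.2)%N && (q.1 + q.2 <= n)%N].
have Dle : (cnt D n <=
    \sum_(q in P) cnt (pieces q.1 (n - q.1 - q.2) q.2) n)%N.
  apply: (@cnt_cover R) => w /DN[u [v [z [Cu Gv Cz -> Nuz]]]] szw.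
  move: szw; rewrite !size_cat => szw.
  have un : (size u < n.+1)%N by lia.
  have zn : (size z < n.+1)%N by lia.
  exists (Ordinal un, Ordinal zn); first by rewrite inE/= Nuz/=; lia.
  by exists u, v, z; split=> //; split=> //=; lia.
apply: le_trans (_ : (\sum_(q in P) cnt (pieces q.1 (n - q.1 - q.2) q.2) n)%:R <= _).
  by rewrite ler_nat.
rewrite natr_sum.
have C1 i : (cnt Cp i)%:R <= K * expR (i%:R * h').
  by apply: le_trans (C_upper i); rewrite ler_nat; apply: cnt_sub; left.
have C2 i : (cnt Cs i)%:R <= K * expR (i%:R * h').
  by apply: le_trans (C_upper i); rewrite ler_nat; apply: cnt_sub; right.
apply: (@le_trans _ _ (\sum_(q : 'I_n.+1 * 'I_n.+1)
    (K ^+ 2 * expR (t%:R * h) * s ^+ N * expR (n%:R * h)) * (s ^+ q.1 * s ^+ q.2))).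
  rewrite [leRHS](bigID (mem P))/= -[leLHS]addr0 lerD//; last first.
    by apply: sumr_ge0 => q _; rewrite !mulr_ge0 ?exprn_ge0 ?expR_ge0.
  apply: ler_sum => -[i k]; rewrite inE/= => /andP[Nik ikn].
  set j := (n - i - k)%N.
  have En : n = (i + (j + k))%N by rewrite /j; lia.
  apply: le_trans (_ : (cnt Cp i * (cnt G j * cnt Cs k))%:R <= _).
    by rewrite ler_nat; have := cnt_pieces i j k; rewrite -En.
  rewrite !natrM.
  apply: (@le_trans _ _ (K * expR (i%:R * h') *
      (expR ((j + t)%:R * h) * (K * expR (k%:R * h'))))).
    rewrite ler_pM ?mulr_ge0 ?ler0n ?C1//.
    by rewrite ler_pM ?ler0n ?C2 ?cntG_le.
  rewrite -exprD.
  have -> : K * expR (i%:R * h') * (expR ((j + t)%:R * h) * (K * expR (k%:R * h')))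
    = K ^+ 2 * expR (t%:R * h) * (s ^+ (i + k) * s ^+ (i + k) * expR (n%:R * h)).
    have En' : n%:R = i%:R + (j%:R + k%:R) :> R by rewrite [in LHS]En !natrD.
    have -> : s ^+ (i + k) = expR ((i + k)%:R * ((h' - h) / 2)).
      by rewrite /s expRM_natl.
    rewrite [LHS](_ : _ = K ^+ 2 * expR (i%:R * h' + ((j + t)%:R * h + k%:R * h'))).
      by rewrite -[RHS]mulrA -!expRD; congr (_ * expR _); rewrite En' !natrD; field.
    by rewrite !expRD; ring.
  rewrite [leRHS](_ : _ = K ^+ 2 * expR (t%:R * h) *
    (s ^+ N * s ^+ (i + k) * expR (n%:R * h))); last by ring.
  rewrite ler_wpM2l ?mulr_ge0 ?exprn_ge0 ?expR_ge0// ler_wpM2r ?expR_ge0//.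
  by rewrite ler_wpM2r ?exprn_ge0// ler_wiXn2l// ltW.
rewrite -mulr_sumr /B.
have -> : \sum_(q : 'I_n.+1 * 'I_n.+1) s ^+ q.1 * s ^+ q.2 = (\sum_(i < n.+1) s ^+ i) ^+ 2.
  rewrite -(pair_bigA _ (fun i j : 'I_n.+1 => s ^+ i * s ^+ j))/=.
  by under eq_bigr do rewrite -mulr_sumr; rewrite -mulr_suml.
set S := \sum_(i < n.+1) _.
have S0 : 0 <= S by apply: sumr_ge0 => i _; rewrite exprn_ge0// ltW.
have H : S ^+ 2 <= (1 - s)^-1 ^+ 2.
  by rewrite ler_pXn2r// ?nnegrE ?invr_ge0 ?subr_ge0 ?(ltW s_lt1)// geometric_sum_le.
apply: le_trans (ler_wpM2l _ H) _.
  by rewrite !mulr_ge0 ?exprn_ge0 ?expR_ge0.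
by rewrite le_eqVlt; apply/orP; left; apply/eqP; ring.
Qed.

(** The case [N = 0] of the bound on prefixes and suffixes, for which every word of [L]
    qualifies. *)
Lemma cntL_le : exists2 C : R, 1 <= C &
  forall n, (cnt L n)%:R <= C * expR (n%:R * h).
Proof.
have LB n : (cnt L n)%:R <= B * expR (n%:R * h).
  have [_ _ _ dec] := Ldec.
  rewrite -[B]mulr1 -(expr0 s); apply: cnt_prefix_suffix_le => w /dec.
  by move=> [u [v [z [? ? ? ?]]]]; exists u, v, z.
exists B => //; have := le_trans (L_lower 0) (LB 0%N).
by rewrite mul0r expR0 mulr1.
Qed.

(** In every decomposition of a word outside G(M) the prefix or the suffix is longer than [M], so
    the geometric factor [s ^+ M] applies. *)
Lemma cnt_not_enlarged (de : R) : 0 < de -> exists M, forall n,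
  (cnt (L `\` enlarged L Cp G Cs M) n)%:R <= de * expR (n%:R * h).
Proof.
move=> de0.
have [M HM] : exists M, B * s ^+ M <= de.
  have : (fun n => B * s ^+ n) @ \oo --> B * 0.
    by apply: cvgMr; apply: cvg_expr; rewrite ger0_norm// ltW.
  rewrite mulr0 => /cvgr0_norm_le/(_ _ de0)[M _ HM]; exists M.
  by apply: le_trans (ler_norm _) _; apply: HM => /=.
exists M => n; apply: le_trans (cnt_prefix_suffix_le (N := M) _ _) _.
  have [_ _ _ dec] := Ldec => w [Lw nGw].
  have [u [v [z [Cu Gv Cz wE]]]] := dec _ Lw; exists u, v, z; split=> //.
  rewrite leqNgt; apply/negP => uzM; apply: nGw; split=> //.
  by exists u, v, z; split=> //; lia.
by rewrite ler_wpM2r ?expR_ge0.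
Qed.

(** For a suitable M at least [e^(nh) / 2] words of length [n] lie in G(M). Each extends to a word
    of [G] by at most [tau] letters on either side, and one of the [(tau + 1)^2] pairs of extension
    lengths must serve a fixed fraction of them. *)
Lemma G_syndetic : exists tau (c : R), 0 < c /\ forall n, exists2 j,
  (j <= tau)%N & c * expR ((n + j)%:R * h) <= (cnt G (n + j))%:R.
Proof.
have [M HM] := @cnt_not_enlarged (2^-1) ltac:(by []).
have [tau Htau] := ext M.
(* The factors stand for the half of the words kept, the number of pairs of extension lengths, and
   the passage from [n] to [n + j] in the exponent. *)
pose c : R := 2^-1 * (tau.+1%:R ^+ 2)^-1 * expR (- (tau + tau)%:R * h).
exists (tau + tau)%N, c; split.
  by rewrite !mulr_gt0 ?expR_gt0 ?invr_gt0 ?exprn_gt0 ?ltr0n.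
move=> n.
have En : 2^-1 * expR (n%:R * h) <= (cnt (enlarged L Cp G Cs M) n)%:R.
  have : (cnt L n <= cnt (L `\` enlarged L Cp G Cs M) n + cnt (enlarged L Cp G Cs M) n)%N.
    have := @cnt_cover R p bool xpredT
      (fun b => if b then L `\` enlarged L Cp G Cs M else enlarged L Cp G Cs M) L n.
    rewrite big_bool/=; apply => w Lw _.
    by have [Ew|Ew] := pselect (enlarged L Cp G Cs M w); [exists false|exists true].
  rewrite -(ler_nat R) natrD => H; have := le_trans (L_lower n) H.
  by have := HM n; lra.
pose E (q : 'I_tau.+1 * 'I_tau.+1) : set (word p) :=
  [set w | exists u v, [/\ size u = q.1, size v = q.2 & G (u ++ w ++ v)]].
have cover : (cnt (enlarged L Cp G Cs M) n <= \sum_(q : 'I_tau.+1 * 'I_tau.+1) cnt (E q) n)%N.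
  apply: (@cnt_cover R p _ xpredT) => w /Htau[u [v [ut vt Guv]]] _.
  by exists (Ordinal (ut : (size u < tau.+1)%N), Ordinal (vt : (size v < tau.+1)%N))
    => //; exists u, v.
(* Once the lengths of both extensions are fixed, [w] sits at a fixed position in its extension, so
   extending is injective. *)
have cE (q : 'I_tau.+1 * 'I_tau.+1) : (cnt (E q) n <= cnt G (n + (q.1 + q.2)))%N.
  have exE (w : word p) : exists uv : word p * word p, E q w ->
      [/\ size uv.1 = q.1, size uv.2 = q.2 & G (uv.1 ++ w ++ uv.2)].
    have [[u [v Huv]]|nE] := pselect (E q w); last by exists ([::], [::]).
    by exists (u, v).
  have [F FP] := boolp.choice exE.
  apply: (@cnt_ge_inj p _ _ (fun w : n.-tuple A => (F w).1 ++ w ++ (F w).2)).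
    move=> w /set_mem/FP[u v Guv]; split=> //.
    by rewrite !size_cat size_tuple u v; lia.
  move=> w w' /set_mem/FP[u v _] /set_mem/FP[u' v' _] /eqP.
  rewrite eqseq_cat ?u ?u'// => /andP[_]; rewrite eqseq_cat ?size_tuple//.
  by move=> /andP[/eqP/val_inj].
have [q Hq] : exists q : 'I_tau.+1 * 'I_tau.+1,
    2^-1 * expR (n%:R * h) / (tau.+1%:R ^+ 2) <= (cnt G (n + (q.1 + q.2)))%:R.
  apply: contrapT => /forallNP H.
  have : \sum_(q : 'I_tau.+1 * 'I_tau.+1) (cnt (E q) n)%:R <
      \sum_(q : 'I_tau.+1 * 'I_tau.+1) 2^-1 * expR (n%:R * h) / (tau.+1%:R ^+ 2).
    apply: ltr_sum; first by apply/hasP; exists (ord0, ord0); rewrite ?mem_index_enum.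
    move=> q _; rewrite ltNge; apply/negP => Hq; apply: (H q).
    by apply: le_trans Hq _; rewrite ler_nat cE.
  rewrite sumr_const card_prod card_ord -[X in _ < X]mulr_natr natrM -expr2 mulfVK.
    by rewrite ltNge -natr_sum (le_trans En)// ler_nat.
  by rewrite expf_neq0.
exists (q.1 + q.2)%N; first by rewrite leq_add// -ltnS.
apply: le_trans Hq; rewrite /c -!mulrA ler_pM2l ?invr_gt0// -expRD mulrC.
rewrite ler_wpM2r ?invr_ge0 ?exprn_ge0// ler_expR -mulrDl ler_wpM2r//.
have : (n + (q.1 + q.2))%:R <= n%:R + (tau + tau)%:R :> R.
  by rewrite -natrD ler_nat leq_add2l leq_add// -ltnS.
by lra.
Qed.

End GrowthEstimates.

(** * Gluing two words at a prescribed distance *)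

Section PairCount.
Context {R : realType} {p : nat}.
Notation A := 'I_p.+1.
Implicit Types (u v w x y z : word p).

Definition occurs u (i : nat) v : Prop := take (size u) (drop i v) = u.

Lemma occurs_cat u i x y : size x = i -> occurs u i (x ++ u ++ y).
Proof. by move=> xi; rewrite /occurs drop_size_cat// take_size_cat. Qed.

Lemma sum_inj_le (I J : finType) (e : I -> J) (f : J -> nat) : injective e ->
  (\sum_i f (e i) <= \sum_j f j)%N.
Proof.
move=> einj; have -> : (\sum_i f (e i) = \sum_(j in [set e i | i in [set: I]]%SET) f j)%N.
  by rewrite big_imset//=; [apply: eq_bigl => i; rewrite finset.in_setT|move=> i j _ _; exact: einj].
by rewrite [leqRHS](bigID (mem [set e i | i in [set: I]]%SET))/= leq_addr.
Qed.

Variables (L Cp G Cs : set (word p)) (t : nat).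
Hypothesis Llang : language_axioms L.
Hypothesis glue : gluing L G t L.

Definition pair_set w w' i k : set (word p) :=
  [set v | [/\ L v, occurs w i v & occurs w' (i + k) v]].

(** Four words are glued: a free word of [G] of length [l1], the two prescribed ones, and a free
    word of length [l2]. The positions are fixed by the lengths, so each pair of free words yields
    its own word of length [N]. *)
Lemma pair_count x w y x' w' y' l1 l2 N :
  G (x ++ w ++ y) -> G (x' ++ w' ++ y') ->
  (l1 + 3 * t + size (x ++ w ++ y) + size (x' ++ w' ++ y') + l2 <= N)%N ->
  (cnt G l1 * cnt G l2 <=
   cnt (pair_set w w' (l1 + t + size x) (size w + size y + t + size x')) N)%N.
Proof.
move=> Gg Gg' lN.
pose PG l := [pred a : l.-tuple A | (a : word p) \in G].
pose P := predX (PG l1) (PG l2).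
have -> : (cnt G l1 * cnt G l2 = #|P|)%N by rewrite cardX.
have ex (q : l1.-tuple A * l2.-tuple A) : exists v : word p, q \in P ->
    [/\ L v, size v = N & exists v1 v2 v3 e : word p,
      [/\ size v1 = t, size v2 = t, size v3 = t &
      v = q.1 ++ v1 ++ (x ++ w ++ y) ++ v2 ++ (x' ++ w' ++ y') ++ v3 ++ q.2 ++ e]].
  have [/andP[/set_mem q1 /set_mem q2]|_] := boolP (q \in P); last by exists [::].
  have [|vs [szvs vst Lx]] :=
      glue (w := q.1) (ws := [:: x ++ w ++ y; x' ++ w' ++ y'; tval q.2]).
    by move=> z; rewrite !in_cons orbF => /or4P[] /eqP ->.
  case: vs szvs vst Lx => [|v1 [|v2 [|v3 [|? ?]]]]//= _ vst Lx.
  have [vt1 vt2 vt3] : [/\ size v1 = t, size v2 = t & size v3 = t].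
    by split; apply: (vst _ _).2; rewrite !in_cons eqxx ?orbT.
  (* Padding on the right reaches the exact length [N] without moving any of the four words. *)
  have := language_extend Llang Lx.
  move=> /(_ N) -[|e [Le eN]].
    rewrite /interleave/=; move: lN; rewrite !size_cat !size_tuple vt1 vt2 vt3/=; lia.
  exists (interleave q.1 [:: v1; v2; v3] [:: x ++ w ++ y; x' ++ w' ++ y'; tval q.2] ++ e).
  move=> _; split=> //; exists v1, v2, v3, e; split=> //.
  by rewrite /interleave/= cats0 -!catA.
have [F FP] := boolp.choice ex.
apply: (@cnt_ge_inj p _ P F _ N).
  move=> q /FP[LF szF [v1 [v2 [v3 [e [v1t v2t v3t FE]]]]]]; split=> //; split=> //.
    rewrite FE (_ : _ ++ _ = (q.1 ++ v1 ++ x) ++ w ++ (y ++ v2 ++ (x' ++ w' ++ y') ++ v3 ++ q.2 ++ e)).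
      by apply: occurs_cat; rewrite !size_cat size_tuple v1t; lia.
    by rewrite -!catA.
  rewrite FE (_ : _ ++ _ =
    (q.1 ++ v1 ++ (x ++ w ++ y) ++ v2 ++ x') ++ w' ++ (y' ++ v3 ++ q.2 ++ e)).
    by apply: occurs_cat; rewrite !size_cat size_tuple v1t v2t; lia.
  by rewrite -!catA.
move=> [a b] [a' b'] /FP[_ _ [v1 [v2 [v3 [e [v1t v2t v3t ->]]]]]].
move=> /FP[_ _ [v1' [v2' [v3' [e' [v1't v2't v3't ->]]]]]] /eqP /=.
rewrite eqseq_cat ?size_tuple// eqseq_cat ?v1t ?v1't// eqseq_cat// eqxx.
rewrite eqseq_cat ?v2t ?v2't// eqseq_cat// eqxx eqseq_cat ?v3t ?v3't//.
rewrite eqseq_cat ?size_tuple//.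
by rewrite !andTb => /and5P[/eqP/val_inj -> _ _ _ /andP[/eqP/val_inj -> _]].
Qed.

Variables (h : R) (h_ge0 : 0 <= h).
Variables (tau0 : nat) (c1 : R).
Hypothesis c1_gt0 : 0 < c1.
Hypothesis synd : forall n, exists2 j,
  (j <= tau0)%N & c1 * expR ((n + j)%:R * h) <= (cnt G (n + j))%:R.

(** Starting positions are taken one in each block of length [tau0 + 1], at the place where [synd]
    provides many words of [G] before it. Each position contributes a multiple of [e^((N - 2n)h)],
    and their number is proportional to [N]. Only [N0], not [c], depends on the words and on [n]. *)
Lemma pair_frequency (tau : nat) : exists2 c : R, 0 < c &
  forall n x w y x' w' y', size w = n -> size w' = n ->
    (size x <= tau)%N -> (size y <= tau)%N ->
    (size x' <= tau)%N -> (size y' <= tau)%N ->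
    G (x ++ w ++ y) -> G (x' ++ w' ++ y') ->
    exists N0, forall N, (N0 <= N)%N ->
      c * N%:R * expR (N%:R * h) <= expR ((n + n)%:R * h) *
      (\sum_(i < N) cnt (pair_set w w' i (size w + size y + t + size x')) N)%:R.
Proof.
(* The exponent is the length lost to free words: three gaps, four extensions of at most [tau]
   letters, and at most [tau0] letters of padding at the right end. *)
pose c2 : R := c1 * c1 * expR (- ((3 * t + 4 * tau + tau0)%:R * h)).
have c2_gt0 : 0 < c2 by rewrite !mulr_gt0 ?expR_gt0.
exists (c2 / (2 * tau0.+1%:R)); first by rewrite divr_gt0// mulr_gt0.
move=> n x w y x' w' y' wn w'n xt yt x't y't Gg Gg'.
set g := x ++ w ++ y; set g' := x' ++ w' ++ y'.
set S := (3 * t + size g + size g' + tau0 + tau0)%N.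
(* From this length on, the usable blocks, those leaving room for the rest of the glued word, cover
   at least half of [N]. *)
exists (2 * (S + tau0))%N => N NN.
set NB := ((N - S) %/ tau0.+1)%N.
have NBN : (NB * tau0.+1 + S <= N)%N.
  have := leq_trunc_div (N - S) tau0.+1; rewrite -/NB; lia.
have NB2 : (N <= 2 * tau0.+1 * NB)%N.
  have := divn_eq (N - S) tau0.+1; rewrite -/NB.
  have := @ltn_pmod (N - S) tau0.+1 isT; nia.
have ex (b : nat) : exists j, (j <= tau0)%N /\
    c1 * expR ((b * tau0.+1 + j)%:R * h) <= (cnt G (b * tau0.+1 + j))%:R.
  by have [j ? ?] := synd (b * tau0.+1)%N; exists j.
have [J JP] := boolp.choice ex.
pose I b := (b * tau0.+1 + J b + t + size x)%N.
have Ilt (b : 'I_NB) : (I b < N)%N.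
  have [Jb _] := JP b; have := ltn_ord b.
  have : (size x <= size g)%N by rewrite size_cat leq_addr.
  by rewrite /I; move: NBN; rewrite /S; nia.
have Iinj : injective (fun b : 'I_NB => Ordinal (Ilt b)).
  move=> b b' /(congr1 val)/=; rewrite /I => E; apply/val_inj => /=.
  by have [Jb _] := JP b; have [Jb' _] := JP b'; nia.
set k := (size w + size y + t + size x')%N.
have := sum_inj_le (fun i : 'I_N => cnt (pair_set w w' i k) N) Iinj.
rewrite -(ler_nat R) => H; apply: le_trans (ler_wpM2l (expR_ge0 _) H).
have Hb (b : 'I_NB) : c2 * expR (N%:R * h) <=
    expR ((n + n)%:R * h) * (cnt (pair_set w w' (I b) k) N)%:R.
  have [Jb Gb] := JP b; set l1 := (b * tau0.+1 + J b)%N in Gb *.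
  set r := (N - (l1 + 3 * t + size g + size g'))%N.
  have l1N : (l1 + 3 * t + size g + size g' + tau0 <= N)%N.
    have := ltn_ord b; move: NBN; rewrite /S /l1; nia.
  (* Aiming [tau0] below the available room [r] ensures that the length supplied by [synd] still
     fits. *)
  have [j jt Gr] := synd (r - tau0)%N; set l2 := (r - tau0 + j)%N in Gr.
  have l2N : (l1 + 3 * t + size g + size g' + l2 <= N)%N by rewrite /l2 /r; lia.
  have := pair_count Gg Gg' l2N.
  rewrite -(ler_nat R) natrM -/k -/(I b) => H1.
  apply: le_trans (ler_wpM2l (expR_ge0 _) H1).
  apply: (@le_trans _ _ (expR ((n + n)%:R * h) *
      (c1 * expR (l1%:R * h) * (c1 * expR (l2%:R * h))))); last first.
    by rewrite ler_wpM2l ?expR_ge0// ler_pM// mulr_ge0 ?expR_ge0// ltW.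
  rewrite [leRHS](_ : _ = c1 * c1 * expR ((n + n)%:R * h + l1%:R * h + l2%:R * h)).
    rewrite /c2 -mulrA -expRD ler_wpM2l ?mulr_ge0 ?(ltW c1_gt0)// ler_expR.
    rewrite -!mulrDl -mulNr -mulrDl ler_wpM2r// -!natrD.
    rewrite -(@lerD2r _ ((3 * t + 4 * tau + tau0)%:R)) addrAC addNr add0r.
    rewrite -natrD ler_nat.
    have sg : (size g <= n + 2 * tau)%N by rewrite /g !size_cat; lia.
    have sg' : (size g' <= n + 2 * tau)%N by rewrite /g' !size_cat; lia.
    by rewrite /l2 /r; lia.
  by rewrite !expRD; ring.
rewrite natr_sum mulr_sumr.
apply: (@le_trans _ _ (\sum_(b < NB) c2 * expR (N%:R * h))); last first.
  by apply: ler_sum => b _; exact: Hb.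
rewrite sumr_const card_ord -[leRHS]mulr_natr.
rewrite [leLHS](_ : _ = c2 * expR (N%:R * h) * (N%:R / (2 * tau0.+1%:R))); last first.
  by set D := (2 * _)^-1; ring.
apply: ler_wpM2l; first by apply: mulr_ge0; [exact: ltW|exact: expR_ge0].
rewrite ler_pdivrMr ?mulr_gt0// mulrC -!natrM ler_nat//.
Qed.

End PairCount.

(** * Words, windows and finitary sets *)

Section Words.
Context {s : sidedness} {p : nat}.
Notation A := 'I_p.+1.
Implicit Types (x y : fullshift s p) (u v w : word p) (i : coordinate s).

Lemma iter_left_shift k x i : iter k left_shift x i = x (i + k%:R).
Proof.
elim: k i => [|k IHk] i; first by rewrite addr0.
by rewrite iterS /left_shift IHk -addrA -natr1 [1 + _]addrC.
Qed.

Lemma size_subword x i n : size (subword x i n) = n.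
Proof. exact: size_mkseq. Qed.

Lemma nth_subword x i n k a : (k < n)%N -> nth a (subword x i n) k = x (i + k%:R).
Proof. by move=> kn; rewrite nth_mkseq. Qed.

Lemma subword_shift k x i n :
  subword (iter k left_shift x) i n = subword x (i + k%:R) n.
Proof.
by apply: eq_mkseq => j; rewrite iter_left_shift addrAC.
Qed.

Lemma subword_cat x i n m :
  subword x i (n + m) = subword x i n ++ subword x (i + n%:R) m.
Proof.
rewrite /subword /mkseq iotaD map_cat; congr (_ ++ _).
rewrite add0n -[n in iota n m]addn0 iotaDl -map_comp; apply: eq_map => j /=.
by rewrite natrD addrA.
Qed.

Lemma subword_eqP x y i n : subword x i n = subword y i n <->
  forall k, (k < n)%N -> x (i + k%:R) = y (i + k%:R).
Proof.
split=> [E k kn|E].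
  by rewrite -(nth_subword x i ord0 kn) E nth_subword.
by apply/eq_in_map => k; rewrite mem_iota => /andP[_ kn]; exact: E.
Qed.

Lemma take_drop_subword x i n k m : (k + m <= n)%N ->
  take m (drop k (subword x i n)) = subword x (i + k%:R) m.
Proof.
move=> kmn; have -> : n = (k + (m + (n - k - m)))%N by lia.
rewrite subword_cat drop_size_cat ?size_subword// subword_cat.
by rewrite take_size_cat ?size_subword.
Qed.

Lemma subword_rcons x i n : subword x i n.+1 = rcons (subword x i n) (x (i + n%:R)).
Proof. by rewrite -addn1 subword_cat /= -cats1 /subword/mkseq/= addr0. Qed.

Lemma subword_cons x i n : subword x i n.+1 = x i :: subword x (i + 1) n.
Proof. by rewrite -add1n subword_cat /subword/mkseq/= addr0. Qed.

(* The windows [lo m, lo m + 2m] exhaust the coordinates as m grows. *)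
Definition lo (m : nat) : coordinate s :=
  match s return coordinate s with OneSided => 0%N | TwoSided => - m%:Z end.

Definition window (m : nat) x : word p := subword x (lo m) (m + m).+1.

End Words.

Lemma coordinate_natr (n : nat) : n%:R = n :> coordinate OneSided.
Proof. exact: natn. Qed.

Lemma coordinate_intr (n : nat) : n%:R = n%:Z :> coordinate TwoSided.
Proof. exact: natz. Qed.

Lemma lo_shift s m : exists2 j, (j <= m)%N & lo m + j%:R = 0 :> coordinate s.
Proof.
case: s; first by exists 0%N; rewrite // addr0.
by exists m => //; rewrite coordinate_intr; exact: addNr.
Qed.

Lemma lo_mono s m m' : (m <= m')%N -> exists k,
  (k + (m + m).+1 <= (m' + m').+1)%N /\ lo m = lo m' + k%:R :> coordinate s.
Proof.
move=> mm'; case: s; first by exists 0%N; rewrite addr0; split => //; lia.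
exists (m' - m)%N; split; first lia.
by rewrite coordinate_intr; change (- m%:Z = - m'%:Z + (m' - m)%N%:Z)%R; lia.
Qed.

Lemma coordinate_window s (i : coordinate s) :
  exists m k, (k < (m + m).+1)%N /\ i = lo m + k%:R.
Proof.
case: s i => i.
  exists i, i; split; first lia.
  by rewrite coordinate_natr; change (i = 0 + i)%N; rewrite add0n.
exists `|i|%N, (`|(i + `|i|%N%:Z)%R|)%N; rewrite coordinate_intr.
by split; [lia|change (i = - `|i|%N%:Z + `|(i + `|i|%N%:Z)%R|%N%:Z)%R; lia].
Qed.

Section Windows.
Context {s : sidedness} {p : nat}.
Notation A := 'I_p.+1.
Implicit Types (x y : fullshift s p) (u v w : word p) (i : coordinate s).

Lemma size_window m x : size (window m x) = (m + m).+1.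
Proof. exact: size_subword. Qed.

Lemma window_take m m' : (m <= m')%N ->
  exists f : word p -> word p, forall x, window m x = f (window m' x).
Proof.
move=> /(lo_mono s)[k [km mE]].
exists (fun u => take (m + m).+1 (drop k u)) => x.
by rewrite /window take_drop_subword// -mE.
Qed.

Lemma window_coord i : exists m (f : word p -> A), forall x, x i = f (window m x).
Proof.
have [m [k [km ->]]] := coordinate_window i.
by exists m, (fun u => nth ord0 u k) => x; rewrite nth_subword.
Qed.

Lemma window_subword i n : exists m (f : word p -> word p),
  forall x, subword x i n = f (window m x).
Proof.
elim: n => [|n [m [f fE]]]; first by exists 0%N, (fun=> [::]).
have [m' [g gE]] := window_coord (i + n%:R).
have [f1 f1E] := window_take (leq_maxl m m').
have [g1 g1E] := window_take (leq_maxr m m').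
exists (maxn m m'), (fun u => rcons (f (f1 u)) (g (g1 u))) => x.
by rewrite subword_rcons fE gE f1E g1E.
Qed.

Lemma nbhs_coord x i : nbhs x [set y | y i = x i].
Proof.
have := @proj_continuous (coordinate s) (fun=> discrete_topology A) i x.
by move=> /(_ _ (@discrete_set1 (discrete_topology A) (x i))).
Qed.

Lemma nbhs_subword x i n : nbhs x [set y | subword y i n = subword x i n].
Proof.
elim: n => [|n IHn].
  by rewrite (_ : [set y | _] = setT); [exact: filterT|exact/seteqP].
apply: filterS2 IHn (nbhs_coord x (i + n%:R)) => y /= E1 E2.
by rewrite !subword_rcons E1 E2.
Qed.

Lemma open_window m (S : set (word p)) : open [set x : fullshift s p | S (window m x)].
Proof.
rewrite openE => x /= Sx; apply: filterS (nbhs_subword x (lo m) (m + m).+1).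
by move=> y /=; rewrite /window => ->.
Qed.

Let window_filter x : set_system (fullshift s p) :=
  [set U | exists m, forall y, window m y = window m x -> U y].

Let window_filterF x : Filter (window_filter x).
Proof.
split; first by exists 0%N.
  move=> P Q [m Pm] [m' Qm]; exists (maxn m m') => y E.
  have [f fE] := window_take (leq_maxl m m').
  have [g gE] := window_take (leq_maxr m m').
  by split; [apply: Pm; rewrite !fE E|apply: Qm; rewrite !gE E].
by move=> P Q PQ [m Pm]; exists m => y /Pm/PQ.
Qed.

(** The sets fixing a window of [x] generate a filter that converges to [x] in every coordinate,
    hence in the product topology. *)
Lemma nbhs_window x (U : set (fullshift s p)) : nbhs x U ->
  exists m, forall y, window m y = window m x -> U y.
Proof.
have FF := window_filterF x.
suff : window_filter x --> x by apply.
apply/cvg_sup => i; apply/cvg_image.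
  rewrite eqEsubset; split => a //= _; exists (fun=> a) => //.
move=> V /nbhs_singleton Vxi; exists ((fun y : fullshift s p => y i) @^-1` V).
  have [m [f fE]] := window_coord i; exists m => y E /=.
  by rewrite fE E -fE.
rewrite eqEsubset; split => [_ [y ? <-] //|a Va]; by exists (fun=> a).
Qed.

End Windows.

(** * Finitary sets and Borel measures *)

Section Finitary.
Context {s : sidedness} {p : nat}.
Notation A := 'I_p.+1.
Notation FS := (fullshift s p).
Implicit Types (B : set FS) (i : coordinate s).

(** These are the clopen subsets of the full shift. They form an algebra that generates the Borel
    sets, and measures are determined, approximated and constructed through it. *)
Definition finitary B : Prop :=
  exists m (S : set (word p)), B = [set x | S (window m x)].

Lemma finitary_subword i n (S : set (word p)) :
  finitary [set x : FS | S (subword x i n)].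
Proof.
have [m [f fE]] := @window_subword s p i n.
by exists m, (S \o f); apply/seteqP; split => x /=; rewrite fE.
Qed.

Lemma finitaryC B : finitary B -> finitary (~` B).
Proof. by move=> [m [S ->]]; exists m, (~` S). Qed.

Lemma finitaryI B B' : finitary B -> finitary B' -> finitary (B `&` B').
Proof.
move=> [m [S ->]] [m' [S' ->]].
have [f fE] := @window_take s p _ _ (leq_maxl m m').
have [g gE] := @window_take s p _ _ (leq_maxr m m').
exists (maxn m m'), [set u | S (f u) /\ S' (g u)].
by apply/seteqP; split => x /=; rewrite fE gE.
Qed.

Lemma finitaryU B B' : finitary B -> finitary B' -> finitary (B `|` B').
Proof.
by move=> /finitaryC fB /finitaryC fB'; rewrite -[B `|` _]setCK setCU;
  exact/finitaryC/finitaryI.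
Qed.

Lemma finitaryT : finitary setT.
Proof. by exists 0%N, setT; apply/seteqP; split. Qed.

Lemma finitary0 : finitary set0.
Proof. by exists 0%N, set0; apply/seteqP; split. Qed.

Lemma finitary_shift k B : finitary B -> finitary ((iter k left_shift) @^-1` B).
Proof.
move=> [m [S ->]].
rewrite (_ : _ @^-1` _ = [set x | S (subword x (lo m + k%:R) (m + m).+1)]).
  exact: finitary_subword.
by apply/seteqP; split => x /=; rewrite /window subword_shift.
Qed.

Lemma open_finitary B : finitary B -> open B.
Proof. by move=> [m [S ->]]; exact: open_window. Qed.

Lemma open_bigcup_finitary (U : set FS) : open U ->
  exists F : nat -> set FS, (forall m, finitary (F m)) /\ U = \bigcup_m F m.
Proof.
move=> oU; pose F m := [set x : FS | forall y : FS, window m y = window m x -> U y].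
exists F; split.
  move=> m; exists m, [set u | forall y : FS, window m y = u -> U y].
  by apply/seteqP; split.
apply/seteqP; split => [x Ux|x [m _ Fx]]; last exact: (Fx x).
have [m Um] := nbhs_window (open_nbhs_nbhs (conj oU Ux)).
by exists m.
Qed.

Lemma measurable_open (U : set FS) : open U -> measurable (U : set (borel s p)).
Proof. by move=> oU; apply: sub_sigma_algebra. Qed.

Lemma measurable_finitary B : finitary B -> measurable (B : set (borel s p)).
Proof. by move=> /open_finitary/measurable_open. Qed.

Lemma measurable_closed (U : set FS) : closed U -> measurable (U : set (borel s p)).
Proof.
move=> cU; rewrite -[U]setCK; apply: measurableC.
by apply: measurable_open; rewrite openC.
Qed.

Lemma borel_generated : @measurable _ (borel s p) = <<s finitary >>.
Proof.
apply/seteqP; split; apply: smallest_sub; try exact: smallest_sigma_algebra.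
  move=> U /open_bigcup_finitary[F [fF ->]].
  by apply: sigma_algebra_bigcup => m; exact: sub_sigma_algebra.
by move=> B fB; exact: measurable_finitary.
Qed.

Lemma measurable_iter_left_shift k :
  measurable_fun setT (iter k left_shift : borel s p -> borel s p).
Proof.
have := @measurability _ _ (borel s p) (borel s p) setT (iter k left_shift)
  finitary borel_generated.
apply=> _ [B fB <-]; rewrite setTI; apply: measurable_finitary.
exact: finitary_shift.
Qed.

Lemma measurable_preimage_shift k (B : set (borel s p)) : measurable B ->
  measurable ((iter k left_shift : borel s p -> borel s p) @^-1` B).
Proof.
by move=> mB; rewrite -[X in measurable X]setTI; exact: measurable_iter_left_shift.
Qed.

End Finitary.

Section BorelMeasures.
Context {R : realType} {s : sidedness} {p : nat}.
Notation BS := (borel s p).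
Local Open Scope ereal_scope.

Lemma borel_measure_unique (m1 m2 : {measure set BS -> \bar R}) :
  m1 setT < +oo -> (forall B, finitary B -> m1 B = m2 B) ->
  forall B, measurable B -> m1 B = m2 B.
Proof.
move=> m1T m12 B mB.
apply: (@measure_unique _ R BS (@finitary s p) (fun=> setT) borel_generated) => //.
- by move=> B1 B2; exact: finitaryI.
- by move=> _; exact: finitaryT.
- by rewrite bigcup_const.
Qed.

(** The sets that can be approximated form a sigma-algebra containing the finitary ones. For a
    countable union, a finite part is approximated and the rest [D N], which decreases to the empty
    set, is made small by finiteness of [m]. *)
Lemma finitary_approx (m : {measure set BS -> \bar R}) (E : set BS) :
  m setT < +oo -> measurable E ->
  forall e : R, (0 < e)%R -> exists B : set BS, finitary B /\
    m ((E `\` B) `|` (B `\` E)) <= e%:E.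
Proof.
move=> mT.
pose C : set (set BS) := [set E | measurable E /\ forall e : R, (0 < e)%R ->
  exists B : set BS, finitary B /\ m ((E `\` B) `|` (B `\` E)) <= e%:E].
have CF B : finitary B -> C B.
  move=> fB; split; first exact: measurable_finitary.
  by move=> e e0; exists B; split => //; rewrite setDv setU0 measure0 lee_fin ltW.
have mD E1 E2 : measurable E1 -> measurable E2 ->
    measurable ((E1 `\` E2) `|` (E2 `\` E1) : set BS).
  by move=> m1 m2; apply: measurableU; exact: measurableD.
have CU E1 E2 : C E1 -> C E2 -> C (E1 `|` E2).
  move=> [m1 c1] [m2 c2]; split; first exact: measurableU.
  move=> e e0; have e20 : (0 < e / 2)%R by rewrite divr_gt0.
  have [B1 [f1 l1]] := c1 _ e20; have [B2 [f2 l2]] := c2 _ e20.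
  exists (B1 `|` B2); split; first exact: finitaryU.
  have mB1 := measurable_finitary f1; have mB2 := measurable_finitary f2.
  rewrite [e]splitr EFinD; refine (le_trans _ (leeD l1 l2)).
  apply: le_trans (measureU2 m (mD _ _ m1 mB1) (mD _ _ m2 mB2)).
  apply: le_measure; rewrite ?inE.
  - by apply: mD; exact: measurableU.
  - by apply: measurableU; exact: mD.
  - move=> x /= [[[?|?] /not_orP[? ?]]|[[?|?] /not_orP[? ?]]]; tauto.
have Cbig (F : nat -> set BS) N : (forall k, C (F k)) -> C (\big[setU/set0]_(k < N) F k).
  move=> CFk; elim: N => [|N IHN]; first by rewrite big_ord0; exact/CF/finitary0.
  by rewrite big_ord_recr/=; exact: CU.
suff sC : sigma_algebra setT C.
  have sub : @measurable _ BS `<=` C.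
    by rewrite borel_generated; apply: smallest_sub => // B /CF.
  by move=> /sub[].
split; first exact/CF/finitary0.
  move=> E1 [m1 c1]; split; first by rewrite setTD; exact: measurableC.
  move=> e /c1[B [fB lB]]; exists (~` B); split; first exact: finitaryC.
  rewrite (_ : _ `|` _ = (E1 `\` B) `|` (B `\` E1))//.
  by apply/seteqP; split => x /=; have [?|?] := pselect (B x);
    have [?|?] := pselect (E1 x); tauto.
move=> F CFk; have mFk k : measurable (F k) by have [] := CFk k.
split; first exact: bigcupT_measurable.
move=> e e0; have e20 : (0 < e / 2)%R by rewrite divr_gt0.
pose U N := \big[setU/set0]_(k < N) F k.
have mU N : measurable (U N) by apply: bigsetU_measurable => k _.
pose D N := (\bigcup_k F k) `\` U N.
have mDN N : measurable (D N) by apply: measurableD => //; exact: bigcupT_measurable.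
have Dcap : \bigcap_N D N = set0.
  apply/seteqP; split => // x Dx.
  have [[k _ Fkx] _] := Dx 0%N I; have [_] := Dx k.+1 I; apply.
  by rewrite /U big_ord_recr/=; right.
have : m (D N) @[N --> \oo] --> m (\bigcap_N D N).
  apply: nonincreasing_cvg_mu => //.
  - by apply: le_lt_trans mT; apply: le_measure; rewrite ?inE.
  - by rewrite Dcap.
  move=> N N' NN'; apply/subsetPset; apply: setDS; exact: subset_bigsetU.
rewrite Dcap measure0 => /fine_cvgP[_ /cvgr0_norm_le/(_ _ e20)[N _ HN]].
have [_ /(_ _ e20)[B [fB lB]]] := Cbig F N CFk.
exists B; split=> //; rewrite [e]splitr EFinD.
have mB := measurable_finitary fB.
apply: (@le_trans _ _ (m (D N) + m ((U N `\` B) `|` (B `\` U N)))).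
  apply: le_trans (measureU2 m (mDN N) (mD _ _ (mU N) mB)).
  have mbig : measurable (\bigcup_k F k) by exact: bigcupT_measurable.
  apply: le_measure; rewrite ?inE.
  - exact: mD.
  - by apply: measurableU => //; exact: mD.
  move=> x /= [[Fx nBx]|[Bx nFx]]; rewrite /D/=.
    by have [?|?] := pselect (U N x); tauto.
  right; right; split=> // UNx; apply: nFx.
  by move: UNx; rewrite /U -bigcup_mkord => -[k _ ?]; exists k.
apply: leeD => //.
have Dfin : m (D N) \is a fin_num.
  rewrite ge0_fin_numE//; apply: le_lt_trans mT.
  by apply: le_measure; rewrite ?inE.
rewrite -(fineK Dfin) lee_fin; apply: le_trans (HN N _) => /=; last exact: leqnn.
exact: ler_norm.
Qed.

End BorelMeasures.

(** * Shift spaces and finitely additive set functions *)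

Section ShiftLanguage.
Context {s : sidedness} {p : nat}.
Notation A := 'I_p.+1.
Notation FS := (fullshift s p).
Variable X : set FS.
Hypothesis X_shift : shift_space X.
Implicit Types (x y : FS) (u v w : word p) (i : coordinate s).

Lemma mem_language x i n : X x -> language X (subword x i n).
Proof. by move=> Xx; exists x => //; exists i; rewrite size_subword. Qed.

Lemma iter_shift_mem k x : X x -> X (iter k left_shift x).
Proof.
have [_ _] := X_shift; rewrite /shift_invariant.
move=> inv Xx; elim: k => [//|k]; rewrite iterS; move: (iter k left_shift x) => y.
by case: s X inv y {x Xx} => Y inv y Yy; [apply: inv|rewrite -inv]; exists y.
Qed.

(** A word may be moved to the left by shifting. In the two-sided case it must also be moved to the
    right, which uses that the shift maps [X] onto itself. *)
Lemma language_at w m : language X w ->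
  exists2 x, X x & subword x (lo m) (size w) = w.
Proof.
move=> [x Xx [i xw]].
suff [y Xy yx] : exists2 y, X y & forall k : nat, y (lo m + k%:R) = x (i + k%:R).
  exists y => //; rewrite -[RHS]xw; apply: eq_mkseq => k; exact: yx.
have Xit := iter_shift_mem.
case: s X X_shift Xit x Xx i {xw} => [Y _ Yit|Y [_ _ Yinv] Yit] x Yx i.
  exists (iter i left_shift x); first exact: Yit.
  move=> k; rewrite iter_left_shift; congr x.
  by rewrite !coordinate_natr; change (0 + k + i = i + k)%N; lia.
(* Going back [|i| + m] steps makes the forward shift that follows, by [i + |i| + 2m],
   nonnegative. *)
have [z Yz zx] : exists2 z, Y z & iter (`|i|%N + m) left_shift z = x.
  elim: (`|i|%N + m)%N => [|n [z Yz zx]]; first by exists x.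
  move: Yz; rewrite -{1}Yinv => -[z' Yz' z'z]; exists z' => //.
  by rewrite iterSr z'z.
exists (iter `|(i + (`|i|%N + m + m)%N%:Z)%R|%N left_shift z).
  exact: Yit.
move=> k; rewrite -zx !iter_left_shift; congr z.
rewrite !coordinate_intr.
change (- m%:Z + k%:Z + `|(i + (`|i|%N + m + m)%N%:Z)%R|%N%:Z =
  i + k%:Z + (`|i|%N + m)%N%:Z)%R.
lia.
Qed.

Lemma lo0 : lo 0 = 0 :> coordinate s.
Proof. by case: s. Qed.

Lemma language_at0 w : language X w -> exists2 x, X x & subword x 0 (size w) = w.
Proof. by move=> /(language_at 0); rewrite lo0. Qed.

Lemma language_shift_space : language_axioms (language X).
Proof.
have [[x0 Xx0] _ _] := X_shift; split.
- by exists x0 => //; exists 0.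
- move=> u v [x Xx [i]]; rewrite size_cat subword_cat => /eqP.
  rewrite eqseq_cat ?size_subword// => /andP[/eqP xu _].
  by exists x => //; exists i.
- move=> u v [x Xx [i]]; rewrite size_cat subword_cat => /eqP.
  rewrite eqseq_cat ?size_subword// => /andP[_ /eqP xv].
  by exists x => //; exists (i + (size u)%:R).
- move=> u [x Xx [i xu]]; exists (x (i + (size u)%:R)); exists x => //.
  by exists i; rewrite size_rcons subword_rcons xu.
Qed.

(** A point all of whose windows lie in the language is a limit of points of [X] sharing these
    windows, and [X] is closed. *)
Lemma shift_space_bigcap :
  X = \bigcap_m [set x | language X (window m x)].
Proof.
apply/seteqP; split => [x Xx m _|x Lx]; first exact: mem_language.
have [_ cX _] := X_shift; apply: cX => U /nbhs_window[m Um].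
have [y Xy] := language_at m (Lx m I); rewrite size_window => yx.
by exists y; split => //; exact: Um.
Qed.

End ShiftLanguage.

Section FinitelyAdditive.
Context {R : realType} {T : Type}.
Implicit Types (C : set (set T)) (m : set T -> R) (B : set T).

Definition setalg C : Prop :=
  [/\ C set0, forall B, C B -> C (~` B) & forall B B', C B -> C B' -> C (B `&` B')].

(** The algebra [C] is a parameter: Borel sets for genuine measures, finitary sets for averages over
    points and for their limits. *)
Definition finite_additive C m : Prop :=
  [/\ m setT = 1, forall B, C B -> 0 <= m B &
      forall B B', C B -> C B' -> B `&` B' = set0 -> m (B `|` B') = m B + m B'].

Variables (C : set (set T)) (m : set T -> R).
Hypotheses (Calg : setalg C) (madd : finite_additive C m).

Lemma setalgU B B' : C B -> C B' -> C (B `|` B').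
Proof.
have [_ CC CI] := Calg; move=> CB CB'.
by rewrite -[B `|` B']setCK setCU; apply/CC/CI; exact: CC.
Qed.

Lemma setalgT : C setT.
Proof. by have [C0 CC _] := Calg; rewrite -setC0; exact: CC. Qed.

Lemma setalgD B B' : C B -> C B' -> C (B `\` B').
Proof. by have [_ CC CI] := Calg; move=> CB CB'; rewrite setDE; apply/CI/CC. Qed.

Lemma fadd0 : m set0 = 0.
Proof.
have [C0 _ _] := Calg; have [_ _ mU] := madd.
have := mU _ _ C0 C0 (setI0 _); rewrite setU0 => /eqP.
by rewrite addrC -subr_eq subrr => /eqP.
Qed.

Lemma fadd_le B B' : C B -> C B' -> B `<=` B' -> m B <= m B'.
Proof.
have [_ m0 mU] := madd; move=> CB CB' BB'.
have CD := setalgD CB' CB.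
rewrite (_ : B' = B `|` (B' `\` B)); last by rewrite setDUK.
by rewrite mU// ?lerDl ?m0// setDIK.
Qed.

Lemma fadd_leU B B' : C B -> C B' -> m (B `|` B') <= m B + m B'.
Proof.
have [_ m0 mU] := madd; move=> CB CB'.
have CD := setalgD CB' CB.
rewrite (_ : B `|` B' = B `|` (B' `\` B)); last by rewrite setUDr setDv setD0.
rewrite mU ?setDIK// lerD2l; apply: fadd_le => //; exact: subDsetl.
Qed.

Lemma fadd_le1 B : C B -> m B <= 1.
Proof. by move=> CB; have [<- _ _] := madd; apply: fadd_le => //; exact: setalgT. Qed.

Lemma fadd_partition (I : finType) (f : T -> I) B : C B ->
  (forall i, C [set x | f x = i]) -> m B = \sum_i m (B `&` [set x | f x = i]).
Proof.
have [C0 CC CI] := Calg; have [_ _ mU] := madd; move=> CB Cf.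
have H (r : seq I) : uniq r -> C (B `&` [set x | f x \in r]) /\
    m (B `&` [set x | f x \in r]) = \sum_(i <- r) m (B `&` [set x | f x = i]).
  elim: r => [_|i r IHr /= /andP[ir /IHr[Cr mr]]].
    by rewrite (_ : _ `&` _ = set0) ?big_nil ?fadd0//; apply/seteqP; split => x//= [].
  have E : B `&` [set x | f x \in i :: r] =
      (B `&` [set x | f x = i]) `|` (B `&` [set x | f x \in r]).
    rewrite -setIUr; congr (_ `&` _); apply/seteqP; split => x /=; rewrite in_cons.
      by case/orP => [/eqP|]; [left|right].
    by case=> [/eqP|] ->; rewrite ?orbT.
  have Ci : C (B `&` [set x | f x = i]) by exact: CI.
  rewrite E big_cons; split; first exact: setalgU.
  rewrite mU ?mr//; apply/seteqP; split => x//= [[_ ->] [_]].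
  by rewrite (negPf ir).
have [_] := H _ (index_enum_uniq I).
by rewrite (_ : _ `&` _ = B)//; apply/seteqP; split => x /= => [[]|]//; rewrite mem_index_enum.
Qed.

Lemma fadd_fibers (I : finType) (f : T -> I) (P : {pred I}) :
  (forall i, C [set x | f x = i]) ->
  C [set x | P (f x)] /\ m [set x | P (f x)] = \sum_(i | P i) m [set x | f x = i].
Proof.
have [C0 CC CI] := Calg; move=> Cf.
have CP : C [set x | P (f x)].
  rewrite (_ : [set x | _] = \big[setU/set0]_(i | P i) [set x | f x = i]).
    by elim/big_rec: _ => // i B _ CB; exact: setalgU.
  rewrite -bigcup_seq_cond; apply/seteqP; split => x /=.
    by move=> Px; exists (f x) => //=; rewrite mem_index_enum.
  by move=> [i /andP[_ Pi] ->].
split=> //; rewrite (fadd_partition CP Cf) [RHS]big_mkcond/=.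
apply: eq_bigr => i _; case: ifPn => Pi.
  congr m; apply/seteqP; split => [x []//|x /= fx]; split => //.
  by rewrite fx.
rewrite (_ : _ `&` _ = set0) ?fadd0//; apply/seteqP; split => x//= [Px fx].
by rewrite -fx Px in Pi.
Qed.

Lemma fadd_sum1 (I : finType) (f : T -> I) :
  (forall i, C [set x | f x = i]) -> \sum_i m [set x | f x = i] = 1.
Proof.
move=> Cf; have [<- _ _] := madd; rewrite (fadd_partition setalgT Cf).
by apply: eq_bigr => i _; rewrite setTI.
Qed.

Lemma fadd_pushd (I J : finType) (f : T -> I) (g : I -> J) :
  (forall i, C [set x | f x = i]) -> forall j,
  m [set x | g (f x) = j] = pushd g (fun i => m [set x | f x = i]) j.
Proof.
move=> Cf j; have [_] := fadd_fibers [pred i | g i == j] Cf.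
by move=> E; apply: etrans E; congr m; apply/seteqP; split => x /= /eqP.
Qed.

End FinitelyAdditive.

Section WordDistribution.
Context {R : realType} {s : sidedness} {p : nat}.
Notation A := 'I_p.+1.
Notation FS := (fullshift s p).
Notation BS := (borel s p).
Implicit Types (m : set FS -> R) (u v w : word p) (i : coordinate s).

Lemma setalg_finitary : setalg (@finitary s p).
Proof.
split; [exact: finitary0|exact: finitaryC|exact: finitaryI].
Qed.

Lemma setalg_measurable : setalg (@measurable _ BS).
Proof. by split; [exact: measurable0|exact: measurableC|exact: measurableI]. Qed.

Lemma probability_fadd (mu : probability BS R) :
  finite_additive measurable (fun B : set BS => fine (mu B)).
Proof.
split; first by rewrite probability_setT.
  by move=> B _; exact: fine_ge0.
move=> B B' mB mB' BB'; rewrite measureU// fineD//; exact: fin_num_measure.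
Qed.

Lemma finite_additive_sub (T : Type) (C C' : set (set T)) (m : set T -> R) :
  C `<=` C' -> finite_additive C' m -> finite_additive C m.
Proof.
move=> CC' [m1 m0 mU]; split=> // [B /CC'|B B' /CC' CB /CC' CB'].
  exact: m0.
exact: mU.
Qed.

Lemma probability_fadd_finitary (mu : probability BS R) :
  finite_additive finitary (fun B : set FS => fine (mu B)).
Proof.
apply: finite_additive_sub (probability_fadd mu) => B; exact: measurable_finitary.
Qed.

Lemma probability_lty (mu : probability BS R) : (mu setT < +oo)%E.
Proof.
by suff : (1 < +oo :> \bar R)%E; [rewrite -(probability_setT mu)|exact: ltry].
Qed.

Definition subtuple i n (x : FS) : n.-tuple A :=
  Tuple (introT eqP (size_subword x i n)).

Lemma finitary_subtuple i n (w : n.-tuple A) :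
  finitary [set x | subtuple i n x = w].
Proof.
rewrite (_ : [set x | _] = [set x | [set u | u = tval w] (subword x i n)]).
  exact: finitary_subword.
by apply/seteqP; split => x /= [] => [<-//|E]; exact/val_inj.
Qed.

Definition wd m u : R := m [set x | subword x 0 (size u) = u].

Lemma wd_tuple m n (w : n.-tuple A) : wd m w = m [set x | subtuple 0 n x = w].
Proof.
rewrite /wd; congr m; apply/seteqP; split => x /=; rewrite size_tuple.
  by move=> E; exact/val_inj.
by move=> <-.
Qed.

Definition invariant_on_finitary m : Prop :=
  forall B, finitary B -> m (left_shift @^-1` B) = m B.

Section Stationarity.
Variable m : set FS -> R.
Hypothesis madd : finite_additive finitary m.
Hypothesis minv : invariant_on_finitary m.

Lemma invariant_iter k B : finitary B -> m (iter k left_shift @^-1` B) = m B.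
Proof.
move=> fB; elim: k => [//|k IHk].
rewrite (_ : _ @^-1` B = left_shift @^-1` (iter k left_shift @^-1` B)).
  by rewrite minv//; exact: finitary_shift.
by apply/seteqP; split => x /=; rewrite -iterSr.
Qed.

Lemma invariant_subword k n (S : set (word p)) :
  m [set x | S (subword x (lo k) n)] = m [set x | S (subword x 0 n)].
Proof.
have [j _ j0] := @lo_shift s k.
rewrite -(invariant_iter j (@finitary_subword s p (lo k) n S)); congr m.
by apply/seteqP; split => x /=; rewrite subword_shift j0.
Qed.

Lemma invariant_subword_nat k n (S : set (word p)) :
  m [set x | S (subword x k%:R n)] = m [set x | S (subword x 0 n)].
Proof.
rewrite -(invariant_iter k (@finitary_subword s p 0 n S)); congr m.
by apply/seteqP; split => x /=; rewrite subword_shift add0r.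
Qed.

Let finitary_coord (k : nat) (a : A) : finitary [set x : FS | x k%:R = a].
Proof.
rewrite (_ : [set x | _] = [set x | [set u | u = [:: a]] (subword x k%:R 1)]).
  exact: finitary_subword.
apply/seteqP; split => x /=; rewrite /subword/mkseq/= addr0; first by move=> ->.
by case.
Qed.

Lemma stationary_wd : stationary (wd m).
Proof.
have [mT m0 _] := madd; split.
- rewrite /wd/= (_ : [set x | _] = setT)//; exact/seteqP.
- by move=> u; apply: m0; exact: (finitary_subword 0 _ [set v | v = u]).
- move=> u; rewrite /wd.
  rewrite (fadd_partition setalg_finitary madd
    (@finitary_subword s p 0 (size u) [set v | v = u]) (finitary_coord (size u))).
  apply: eq_bigr => a _; congr m; apply/seteqP; split => x /=.
    rewrite size_rcons subword_rcons add0r => /eqP; rewrite eqseq_rcons.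
    by move=> /andP[/eqP ? /eqP ?].
  by move=> [xu xa]; rewrite size_rcons subword_rcons add0r xu xa.
- move=> u; rewrite [RHS]/wd -(invariant_subword_nat 1 (size u) [set v | v = u]).
  rewrite (fadd_partition setalg_finitary madd
    (@finitary_subword s p 1%:R (size u) [set v | v = u]) (finitary_coord 0)).
  apply: eq_bigr => a _; rewrite /wd; congr m; apply/seteqP; split => x /=.
    by rewrite subword_cons add0r => -[? ?].
  by move=> [xu xa]; rewrite subword_cons add0r xu xa.
Qed.

Lemma wd_sum n (D : set (word p)) : m [set x | D (subword x 0 n)] =
  \sum_(w : n.-tuple A | (w : word p) \in D) wd m w.
Proof.
have [_] := fadd_fibers setalg_finitary madd
  [pred w : n.-tuple A | (w : word p) \in D] (@finitary_subtuple 0 n).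
move=> E; rewrite (_ : [set x | D _] = [set x | [pred w : n.-tuple A | (w : word p) \in D] (subtuple 0 n x)]).
  by rewrite E; apply: eq_bigr => w _; rewrite wd_tuple.
by apply/seteqP; split => x /=; [move=> ?; exact: mem_set|move=> /set_mem].
Qed.

End Stationarity.

Lemma invariant_measure_finitary (mu : probability BS R) :
  shift_invariant_measure mu ->
  invariant_on_finitary (fun B : set FS => fine (mu B)).
Proof. by move=> inv B /measurable_finitary mB; rewrite inv. Qed.

Lemma invariant_measure_iter (mu : probability BS R) k (B : set BS) :
  shift_invariant_measure mu -> measurable B ->
  mu (iter k left_shift @^-1` B) = mu B.
Proof.
move=> inv mB; elim: k => [//|k IHk].
rewrite (_ : _ @^-1` B = left_shift @^-1` (iter k left_shift @^-1` B)).
  by rewrite inv//; exact: measurable_preimage_shift.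
by apply/seteqP; split => x /=; rewrite -iterSr.
Qed.

Lemma invariant_measureW (mu : probability BS R) :
  invariant_on_finitary (fun B : set FS => fine (mu B)) ->
  shift_invariant_measure mu.
Proof.
move=> inv B mB.
have mS : measurable_fun setT (left_shift : BS -> BS).
  exact: (@measurable_iter_left_shift s p 1).
have := @borel_measure_unique R s p (pushforward mu (left_shift : BS -> BS)) mu.
apply => //.
  exact: probability_lty.
move=> B' fB'; rewrite /pushforward.
have mB' := measurable_finitary fB'.
have mB'' : measurable (left_shift @^-1` B' : set BS).
  exact: (measurable_preimage_shift 1).
rewrite -[LHS]fineK ?fin_num_measure// -[RHS]fineK ?fin_num_measure//.
by congr EFin; exact: inv.
Qed.

End WordDistribution.

(** * Entropy of invariant measures and of shift spaces *)

Section KolmogorovSinai.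
Context {R : realType} {s : sidedness} {p : nat}.
Notation A := 'I_p.+1.
Notation FS := (fullshift s p).
Notation BS := (borel s p).
Variable mu : probability BS R.
Hypothesis mu_inv : shift_invariant_measure mu.

Let fm (B : set BS) : R := fine (mu B).
Let d := wd (fm : set FS -> R).

Let fadd : finite_additive measurable fm. Proof. exact: probability_fadd. Qed.

Let dS : stationary d.
Proof.
apply: stationary_wd; first exact: probability_fadd_finitary.
exact: invariant_measure_finitary.
Qed.

Let malg : setalg (@measurable _ BS). Proof. exact: setalg_measurable. Qed.

Lemma fiber_pair (I J : finType) (f : BS -> I) (g : BS -> J) :
  (forall i, measurable [set x | f x = i]) ->
  (forall j, measurable [set x | g x = j]) ->
  forall q, measurable [set x | (f x, g x) = q].
Proof.
move=> mf mg [i j].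
rewrite (_ : [set x | _] = [set x | f x = i] `&` [set x | g x = j]).
  exact: measurableI.
by apply/seteqP; split => x /= [-> ->].
Qed.

Section Partition.
Variables (k : nat) (xi : BS -> 'I_k).
Hypothesis mxi : forall a, measurable (xi @^-1` [set a]).

Lemma measurable_atom n (a : {ffun 'I_n -> 'I_k}) : measurable (atom xi a).
Proof.
rewrite (_ : atom xi a = \bigcap_(i in [set: 'I_n])
    (iter i left_shift @^-1` (xi @^-1` [set a i]))).
  apply: fin_bigcap_measurable => [|i _]; first exact: finite_finset.
  exact: measurable_preimage_shift.
by apply/seteqP; split => x /= H i; [move=> _; exact: H|exact: (H i I)].
Qed.

Definition itinerary n (x : BS) : {ffun 'I_n -> 'I_k} :=
  [ffun i : 'I_n => xi (iter i left_shift x)].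

Lemma atom_itinerary n (a : {ffun 'I_n -> 'I_k}) :
  atom xi a = [set x | itinerary n x = a].
Proof.
apply/seteqP; split => x /=.
  by move=> H; apply/ffunP => i; rewrite ffunE H.
by move=> <- i; rewrite ffunE.
Qed.

(** Each of the [k] atoms is replaced by a finitary set up to mass [e / k]. Where no symmetric
    difference is met, the window lies in exactly one of these sets, the one labelled [xi x]. *)
Lemma finitary_partition_approx (e : R) : 0 < e -> exists m (eta : word p -> 'I_k),
  measurable [set x : BS | xi x != eta (window m x)] /\
  fm [set x | xi x != eta (window m x)] <= e.
Proof.
move=> e0.
have k0 : (0 < k)%N by case: k xi => [|//] xi0; case: (xi0 point).
have e0' : 0 < e / k%:R by rewrite divr_gt0// ltr0n.
have ex (a : 'I_k) : exists B : set BS, finitary B /\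
    (mu ((xi @^-1` [set a] `\` B) `|` (B `\` xi @^-1` [set a])) <= (e / k%:R)%:E)%E.
  by apply: finitary_approx => //; exact: probability_lty.
have [B HB] := boolp.choice ex.
have [m [S BS_]] : exists m (S : 'I_k -> set (word p)), forall a,
    B a = [set x | S a (window m x)].
  have Bfin a : exists m S, B a = [set x | S (window m x)] by have [] := HB a.
  have [mm H] := boolp.choice Bfin.
  exists (\max_a mm a); suff : forall a, exists S : set (word p),
      B a = [set x | S (window (\max_a mm a) x)] by move=> /boolp.choice[S HS]; exists S.
  move=> a; have [S ->] := H a.
  have [f fE] := @window_take s p _ _ (leq_bigmax a : (mm a <= \max_a mm a)%N).
  by exists (S \o f); apply/seteqP; split => x /=; rewrite fE.
(* The default label is taken only for windows outside all [S a]; such a point already lies in the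
   symmetric difference of its own atom. *)
pose eta u : 'I_k := odflt (Ordinal k0) [pick a | u \in S a].
pose D a := (xi @^-1` [set a] `\` B a) `|` (B a `\` xi @^-1` [set a]).
have mD a : measurable (D a).
  have [/measurable_finitary mB _] := HB a.
  by apply: measurableU; apply: measurableD.
have mbad : measurable [set x : BS | xi x != eta (window m x)].
  have Sf (b : 'I_k) : measurable [set x : BS | eta (window m x) = b].
    apply: measurable_finitary.
    exact: (@finitary_subword s p (lo m) (m + m).+1 [set u | eta u = b]).
  have := (fadd_fibers malg fadd [pred q : 'I_k * 'I_k | q.1 != q.2]
    (fiber_pair mxi Sf)).1.
  by [].
exists m, eta; split=> //.
have sub : [set x : BS | xi x != eta (window m x)] `<=` \big[setU/set0]_a D a.
  move=> x /= bad; rewrite -bigcup_seq/=; apply: contrapT => nD.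
  have nDa a : ~ D a x by move=> Da; apply: nD; exists a => //=; rewrite mem_index_enum.
  have BE a : (window m x \in S a) = (xi x == a).
    apply/idP/eqP => [/set_mem Sa|xa].
      by apply: contrapT => xa; apply: (nDa a); right; split => //; rewrite BS_.
    apply/mem_set; apply: contrapT => Sa; apply: (nDa a); left; split => //.
    by rewrite BS_.
  move: bad; rewrite /eta; case: pickP => [a|]; last by move=> /(_ (xi x)); rewrite BE eqxx.
  by rewrite BE => ->.
have CU (r : seq 'I_k) : measurable (\big[setU/set0]_(a <- r) D a) /\
    fm (\big[setU/set0]_(a <- r) D a) <= \sum_(a <- r) (e / k%:R).
  elim: r => [|a r [Cr Hr]].
    by rewrite !big_nil; split; [exact: measurable0|rewrite /fm measure0].
  rewrite !big_cons; split; first exact: measurableU.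
  apply: le_trans (fadd_leU malg fadd (mD a) Cr) _; apply: lerD => //.
  have [_ HD] := HB a.
  have fD : mu (D a) \is a fin_num by apply: fin_num_measure; exact: mD.
  by rewrite -lee_fin /fm fineK.
have [CD HD] := CU (index_enum 'I_k).
apply: le_trans (fadd_le malg fadd mbad CD sub) _; apply: le_trans HD _.
rewrite sumr_const card_ord -[leLHS]mulr_natr divfK// pnatr_eq0; lia.
Qed.

(* Gibbs' inequality against the reference law obtained by reading the itinerary
   of the finitary partition eta through a channel that errs with probability
   de. *)
Lemma partition_entropy_le (e : R) : 0 < e -> exists m, forall n,
  partition_entropy mu xi n <= block_entropy d (n + m) + n%:R * e.
Proof.
move=> e0.
have k0 : (0 < k)%N by case: k xi => [|//] xi0; case: (xi0 point).
have kR : 0 < k%:R :> R by rewrite ltr0n.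
(* Chosen so that a letter transmitted correctly costs at most [- ln (1 - de) = e / 2]. *)
pose de : R := 1 - expR (- (e / 2)).
have de1 : de < 1 by rewrite gtrBl expR_gt0.
have de0 : 0 < de by rewrite subr_gt0 -[ltRHS]expR0 ltr_expR oppr_lt0 divr_gt0.
have c1E : ln (1 - de) = - (e / 2) by rewrite /de opprB addrC subrK expRK.
pose c2 : R := - ln (de / k%:R).
have dek : 0 < de / k%:R by rewrite divr_gt0.
have dek1 : de / k%:R <= 1.
  by rewrite ler_pdivrMr// mul1r (le_trans (ltW de1))// ler1n.
have c2_ge0 : 0 <= c2 by rewrite oppr_ge0 ln_le0.
(* A wrong letter costs at most [c2] more; with errors this rare, [n] letters cost at most [n e / 2]
   on account of errors. *)
have ep0 : 0 < e / 2 / (c2 + 1) by rewrite !divr_gt0// ltr_wpDl.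
have [m [eta [mbad bad]]] := finitary_partition_approx ep0.
(* The windows of the first [n] iterates together cover [n + 2m] consecutive letters. *)
exists (m + m)%N => n; set N := (n + (m + m))%N.
pose W (i : 'I_n) (u : word p) := eta (take (m + m).+1 (drop i u)).
pose U := @subtuple s p (lo m) N.
have mU w : measurable [set x : BS | U x = w].
  by apply: measurable_finitary; exact: finitary_subtuple.
have WE (i : 'I_n) x : W i (U x) = eta (window m (iter i left_shift x)).
  rewrite /W /U/= take_drop_subword ?/N; last by have := ltn_ord i; lia.
  by rewrite /window subword_shift.
have mit a : measurable [set x | itinerary n x = a].
  by rewrite -atom_itinerary; exact: measurable_atom.
pose f x := (itinerary n x, U x).
have mf q : measurable [set x | f x = q] by exact: fiber_pair.
pose df q := fm [set x | f x = q].
have df0 q : 0 <= df q by exact: fine_ge0.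
have df1 : \sum_q df q = 1 by exact: fadd_sum1 malg fadd _ _ mf.
have d1E : (fun a : {ffun 'I_n -> 'I_k} => fm (atom xi a)) = pushd fst df.
  by apply/funext => a; rewrite -(fadd_pushd malg fadd fst mf) atom_itinerary.
have d2E : (fun w : N.-tuple A => d w) = pushd snd df.
  apply/funext => w; rewrite -(fadd_pushd malg fadd snd mf).
  rewrite /d (wd_tuple (s := s)).
  transitivity (fm [set x : FS | [set u | u = tval w] (subword x 0 N)]).
    by congr fm; apply/seteqP; split => x /= [] => [<-//|?]; exact/val_inj.
  apply: etrans (esym (invariant_subword (invariant_measure_finitary mu_inv) m N
    [set u | u = tval w])) _; congr fm.
  by apply/seteqP; split => x /= [] => [?|<-//]; exact/val_inj.
(* The channel transmits [b] with probability [1 - de] and otherwise draws a uniform letter, so that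
   every output has positive probability. *)
pose Kr (b a : 'I_k) : R := (1 - de) * (a == b)%:R + de / k%:R.
have Kr0 b a : 0 < Kr b a.
  by rewrite ltr_wpDl// mulr_ge0// subr_ge0 ltW.
have Kr1 b : \sum_a Kr b a = 1.
  rewrite big_split/= -mulr_sumr sumr_const card_ord -[X in _ + X]mulr_natr divfK ?gt_eqF//.
  rewrite (bigD1 b)//= eqxx big1 ?addr0 ?mulr1 ?subrK// => a ab.
  by rewrite (negPf ab).
have lnKr b a : - ln (Kr b a) <= e / 2 + (a != b)%:R * c2.
  have [->|ab]/= := eqVneq a b; rewrite /Kr.
    rewrite eqxx mul0r addr0 mulr1 lerNl -c1E ler_ln ?posrE ?lerDl ?ltW//.
      by rewrite subr_gt0.
    by rewrite ltr_wpDl// subr_ge0 ltW.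
  by rewrite (negPf ab) mulr0 add0r mul1r lerDr divr_ge0 ?ltW.
pose q (a : {ffun 'I_n -> 'I_k}) : R :=
  \sum_(u : N.-tuple A) d u * \prod_i Kr (W i u) (a i).
have [_ d0 _ _] := dS.
(* Bounding [q a] below by the term of one word [u] turns its logarithm into that of a product,
   which separates block entropy from the cost of errors. *)
have q_ge (a : {ffun 'I_n -> 'I_k}) (u : N.-tuple A) : d (tval u) * \prod_i Kr (W i (tval u)) (a i) <= q a.
  rewrite /q (bigD1 u)//= lerDl sumr_ge0// => v _.
  by rewrite mulr_ge0// prodr_ge0// => i _; exact: ltW.
have q0 (a : {ffun 'I_n -> 'I_k}) : 0 <= q a.
  by rewrite sumr_ge0// => v _; rewrite mulr_ge0// prodr_ge0// => i _; exact: ltW.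
have q1 : \sum_a q a = 1.
  rewrite exchange_big/= -[RHS](stationary_sum1 N dS); apply: eq_bigr => u _.
  rewrite -mulr_sumr -(bigA_distr_bigA (fun i a => Kr (W i u) a))/=.
  by rewrite big1 ?mulr1.
have df_le (a : {ffun 'I_n -> 'I_k}) (u : N.-tuple A) : df (a, u) <= d (tval u).
  rewrite -[d _]/((fun w : N.-tuple A => d w) u) d2E /pushd.
  by rewrite (bigD1 (a, u))//= lerDl sumr_ge0.
have pos (a : {ffun 'I_n -> 'I_k}) (u : N.-tuple A) : 0 < df (a, u) -> 0 < d (tval u) * \prod_i Kr (W i (tval u)) (a i).
  move=> dfq; rewrite mulr_gt0//; first exact: lt_le_trans dfq (df_le _ _).
  by rewrite prodr_gt0.
rewrite /partition_entropy -[leLHS]/(ent (fun a => fm (atom xi a))) d1E.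
apply: le_trans (@gibbs _ _ _ q _ _ _ _ _) _ => //.
- exact: pushd_ge0.
- by rewrite pushd_sum1.
- by rewrite q1.
- move=> a; rewrite /pushd lt_neqAle => /andP[+ _]; rewrite eq_sym psumr_neq0//.
  move=> /hasP[[a' u] _ /andP[/eqP/= -> dfq]].
  exact: lt_le_trans (pos _ _ dfq) (q_ge _ _).
rewrite pushd_sum.
apply: (@le_trans _ _ (\sum_q df q * (- ln (d (tval q.2)) +
    \sum_(i < n) (e / 2 + (q.1 i != W i (tval q.2))%:R * c2)))).
  rewrite -sumrN; apply: ler_sum => -[a u] _ /=; rewrite -mulrN.
  have [->|dfq] := eqVneq (df (a, u)) 0; first by rewrite !mul0r.
  have dfq0 : 0 < df (a, u) by rewrite lt_neqAle eq_sym dfq df0.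
  rewrite ler_wpM2l//.
  have du0 : 0 < d (tval u) by exact: lt_le_trans dfq0 (df_le _ _).
  apply: (@le_trans _ _ (- ln (d (tval u) * \prod_i Kr (W i (tval u)) (a i)))).
    rewrite lerN2 ler_ln ?posrE ?pos//.
    exact: lt_le_trans (pos _ _ dfq0) (q_ge _ _).
  rewrite lnM ?posrE ?prodr_gt0// opprD lerD2l.
  rewrite (_ : ln _ = \sum_i ln (Kr (W i (tval u)) (a i))); last first.
    apply: (big_morph_in (Num.pos : {pred R})).
    - by move=> x y; rewrite !posrE; exact: mulr_gt0.
    - by rewrite posrE.
    - exact: lnM.
    - by rewrite ln1.
    - by move=> i _; rewrite posrE.
  by rewrite -sumrN; apply: ler_sum => i _; exact: lnKr.
under eq_bigr do rewrite mulrDr.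
rewrite big_split/= lerD//.
  have := pushd_sum snd df (fun u : N.-tuple A => - ln (d u)).
  rewrite -d2E /block_entropy /ent => <-.
  by rewrite -sumrN; apply: ler_sum => u _; rewrite mulrN.
under eq_bigr do rewrite mulr_sumr.
rewrite exchange_big/=.
have -> : n%:R * e = \sum_(i < n) e by rewrite sumr_const card_ord mulr_natl.
apply: ler_sum => i _; under eq_bigr do rewrite mulrDr.
rewrite big_split/= -mulr_suml df1 mul1r [leRHS]splitr lerD2l.
under eq_bigr do rewrite mulrA.
rewrite -mulr_suml.
have -> : \sum_q df q * (q.1 i != W i (tval q.2))%:R =
    fm [set x | xi x != eta (window m x)].
  transitivity (fm (iter i left_shift @^-1` [set x | xi x != eta (window m x)])).
    pose Q := [pred q : {ffun 'I_n -> 'I_k} * N.-tuple A | q.1 i != W i (tval q.2)].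
    rewrite (_ : _ @^-1` _ = [set x | Q (f x)]).
      have [_ ->] := fadd_fibers malg fadd Q mf.
      rewrite [RHS]big_mkcond/=; apply: eq_bigr => q' _.
      by case: ifP; rewrite ?mulr1 ?mulr0.
    by apply/seteqP; split => x /=; rewrite WE ffunE.
  by rewrite /fm invariant_measure_iter.
apply: le_trans (ler_wpM2r c2_ge0 bad) _.
rewrite mulrAC ler_pdivrMr ?ltr_wpDl//.
by rewrite ler_wpM2l ?divr_ge0 ?ltW// ltrDl.
Qed.

End Partition.

(** Every partition entropy is compared with block entropies at an error [n e], and these are at
    most [n / q] blocks of length [q] up to a bounded term. *)
Lemma measure_entropy_le q : (0 < q)%N ->
  (measure_entropy mu <= (block_entropy d q / q%:R)%:E)%E.
Proof.
move=> q0; have qR : 0 < q%:R :> R by rewrite ltr0n.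
apply: ge_ereal_sup => _ [k [xi [mxi ->]]].
apply/lee_addgt0Pr => e e0; rewrite -EFinD.
have e20 : 0 < e / 2 by rewrite divr_gt0.
have [m Hm] := partition_entropy_le mxi e20.
set l := ln (p.+1%:R : R).
have l0 : 0 <= l by rewrite ln_ge0// ler1n.
pose c : R := m%:R * block_entropy d q / q%:R + q%:R * l.
have c0 : 0 <= c.
  by rewrite addr_ge0 ?mulr_ge0 ?block_entropy_ge0 ?invr_ge0// ltW.
have [N0 HN0] : exists N : nat, c / (e / 2) <= N%:R.
  by exists (Num.trunc (c / (e / 2))).+1; rewrite ltW// truncnS_gt.
apply: (@limn_esup_le _ _ _ N0.+1) => n Nn.
have nR : 0 < n%:R :> R by rewrite ltr0n (leq_trans _ Nn).
rewrite lee_fin ler_pdivrMl//; apply: le_trans (Hm n) _.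
have H := block_entropy_ratio (n + m) dS q0.
have {}H : block_entropy d (n + m) <= n%:R * (block_entropy d q / q%:R) + c.
  rewrite -(ler_pM2r qR); apply: le_trans H _; rewrite /c natrD -/l.
  by rewrite le_eqVlt; apply/orP; left; apply/eqP; field; rewrite gt_eqF.
have Hc : c <= n%:R * (e / 2).
  rewrite -ler_pdivrMr//; apply: le_trans HN0 _; rewrite ler_nat; exact: ltnW.
have E : n%:R * (e / 2) + n%:R * (e / 2) = n%:R * e by rewrite -mulrDr -splitr.
rewrite mulrDr -E addrA lerD2r; apply: le_trans H _; by rewrite lerD2l.
Qed.

(** The partition by the letter at coordinate 0 suffices: the law of words of length [n] is an image
    of the law of its itineraries. *)
Lemma measure_entropy_ge (h c : R) :
  (forall n, n%:R * h - c <= block_entropy d n) -> (h%:E <= measure_entropy mu)%E.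
Proof.
move=> Hh.
pose xi (x : BS) : A := x 0.
have mxi a : measurable (xi @^-1` [set a]).
  rewrite (_ : _ @^-1` _ = [set x : FS | [set u | u = [:: a]] (subword x 0 1)]).
    by apply: measurable_finitary; exact: finitary_subword.
  apply/seteqP; split => x /=; rewrite /subword/mkseq/= addr0 /xi.
    by move=> ->.
  by case.
apply: (@le_trans _ _ (limn_esup (fun n => (n%:R^-1 * partition_entropy mu xi n)%:E))).
  apply/lee_addgt0Pr => e e0.
  have [N0 HN0] : exists N : nat, `|c| / e <= N%:R.
    by exists (Num.trunc (`|c| / e)).+1; rewrite ltW// truncnS_gt.
  rewrite -leeBlDr//; apply: limn_esup_ge => N; exists (maxn N N0.+1); first exact: leq_maxl.
  set n := maxn N N0.+1.
  have nR : 0 < n%:R :> R by rewrite ltr0n (leq_trans _ (leq_maxr _ _)).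
  rewrite -EFinB lee_fin ler_pdivlMl//.
  apply: (@le_trans _ _ (block_entropy d n)).
    apply: le_trans (Hh n); rewrite mulrBr lerD2l lerN2.
    apply: le_trans (ler_norm c) _.
    rewrite -ler_pdivrMr//; apply: le_trans HN0 _; rewrite ler_nat ltnW//.
    exact: leq_maxr.
  pose g (a : {ffun 'I_n -> A}) : n.-tuple A := [tuple a i | i < n].
  have mit a : measurable [set x | itinerary xi n x = a].
    by rewrite -atom_itinerary; exact: measurable_atom.
  rewrite /block_entropy (_ : (fun w : n.-tuple A => d w) =
      pushd g (fun a => fm (atom xi a))).
    by apply: ent_pushd_le => a; exact: fine_ge0.
  apply/funext => w.
  rewrite (_ : (fun a => fm (atom xi a)) = (fun a => fm [set x | itinerary xi n x = a])).
    rewrite -(fadd_pushd malg fadd g mit) /d wd_tuple; congr fm.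
    have gE (x : FS) : subtuple 0 n x = g (itinerary xi n x).
      apply/eq_from_tnth => i; rewrite tnth_mktuple ffunE /xi iter_left_shift.
      by rewrite (tnth_nth ord0)/= nth_subword.
    by apply/seteqP; split => x /=; rewrite gE.
  by apply/funext => a; rewrite atom_itinerary.
by apply: ereal_sup_ubound; exists p.+1, xi.
Qed.

End KolmogorovSinai.

(** * Topological entropy as the growth rate of the language *)

Section TopologicalEntropy.
Context {R : realType} {s : sidedness} {p : nat}.
Notation A := 'I_p.+1.
Notation FS := (fullshift s p).
Variable X : set FS.
Hypothesis X_shift : shift_space X.
Let L := language X.

Lemma compact_fullshift : compact [set: FS].
Proof.
have := @tychonoff (coordinate s) (fun=> discrete_topology A) (fun=> setT).
rewrite (_ : [set f | _] = [set: FS]); last by apply/seteqP; split.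
by apply => i; apply: finite_compact; exact: (@finite_finset A).
Qed.

Lemma compact_shift_space : compact X.
Proof.
have [_ cX _] := X_shift.
by apply: subclosed_compact compact_fullshift _ => //.
Qed.

(** Compactness of [X] in its near-covering form. The property is required for all larger [m']
    because it must hold on a neighbourhood of [x] times a neighbourhood of infinity. *)
Lemma uniform_window (P : nat -> FS -> Prop) :
  (forall x, X x -> exists m, forall m' y, (m <= m')%N ->
    window m y = window m x -> P m' y) ->
  exists m, forall x, X x -> P m x.
Proof.
move=> H; have := (compact_near_coveringP X).1 compact_shift_space nat \oo P _.
case=> [x Xx|M _ HM]; last by exists M => x Xx; exact: (HM M (leqnn M)).
have [m Hm] := H x Xx.
exists ([set y | window m y = window m x], [set m' | (m <= m')%N]).
  by split; [exact: (nbhs_subword x (lo m))|exists m].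
by move=> [y m'] [/= yx mm']; exact: Hm.
Qed.

Lemma iter_cover_word (C : set (set FS)) m :
  (forall x, X x -> exists2 U, C U & forall y, window m y = window m x -> U y) ->
  forall n x, X x -> exists2 V, iter_cover C n V &
    forall y, subword y (lo m) (n + (m + m)) = subword x (lo m) (n + (m + m)) -> V y.
Proof.
move=> HC; elim => [|n IHn] x Xx; first by exists setT.
have [U CU HU] := HC x Xx.
have [V CV HV] := IHn _ (iter_shift_mem X_shift 1 Xx).
exists (U `&` left_shift @^-1` V); first by exists U => //; exists V.
move=> y E; split.
  apply: HU; have := congr1 (take (m + m).+1) E.
  have T (z : FS) : take (m + m).+1 (subword z (lo m) (n.+1 + (m + m))) = window m z.
    have := @take_drop_subword s p z (lo m) (n.+1 + (m + m)) 0 (m + m).+1.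
    by rewrite drop0 addr0; apply; lia.
  by rewrite !T.
apply: HV; have Sh (z : FS) : subword (left_shift z) (lo m) (n + (m + m)) =
    behead (subword z (lo m) (n.+1 + (m + m))).
  by rewrite addSn subword_cons/= -(subword_shift 1).
by rewrite /= !Sh E.
Qed.

Lemma iter_cover_coord_word n V :
  iter_cover [set [set x : FS | x 0 = a] | a in [set: A]] n V ->
  exists w : word p, forall x, V x -> subword x 0 n = w.
Proof.
elim: n V => [|n IHn] V; first by move=> _; exists [::].
move=> [U [a _ <-]] [V' /IHn[w Hw] <-]; exists (a :: w) => x [/= xa /Hw].
by rewrite subword_cons xa (subword_shift 1) add0r => ->.
Qed.

(** Some window size [m] refines a given cover, so a word of length [n + 2m] selects an element of
    its [n]-fold join; the [2m] extra letters do not affect the rate. Conversely, an element of the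
    [n]-fold join of the cover by the letter at 0 determines the word of length [n], so a subcover
    has at least [cnt L n] elements. *)
Lemma topological_entropyE : topological_entropy R X = word_entropy R L.
Proof.
have Llang := language_shift_space X_shift.
have [h [h0 Lh Llow Lup]] := @language_entropy R p L Llang.
rewrite Lh; apply/eqP; rewrite eq_le; apply/andP; split.
- apply: ge_ereal_sup => _ [C [oC XC] <-].
  have [m Hm] : exists m, forall x, X x -> exists2 U, C U &
      forall y, window m y = window m x -> U y.
    apply: uniform_window => x /XC[U CU Ux].
    have [m Hm] := nbhs_window (open_nbhs_nbhs (conj (oC U CU) Ux)).
    exists m => m' y mm' yx; exists U => // z zy; apply: Hm.
    by have [f fE] := @window_take s p m m' mm'; rewrite -yx !fE zy.
  have sub n : (subcover_number R X (iter_cover C n) <= (cnt L (n + (m + m)))%:R%:E)%E.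
    set N := (n + (m + m))%N.
    have ex (w : word p) : exists V, L w -> size w = N -> iter_cover C n V /\
        forall y, subword y (lo m) N = w -> V y.
      have [Lw|nLw] := pselect (L w); last by exists setT.
      have [wN|wN] := pselect (size w = N); last by exists setT.
      have [x Xx xw] := language_at X_shift m Lw.
      have [V CV HV] := iter_cover_word Hm n Xx.
      by exists V => _ _; split => // y yw; apply: HV; rewrite -/N yw -wN xw.
    have [g Hg] := boolp.choice ex.
    pose P := [pred w : N.-tuple A | (w : word p) \in L].
    pose F : {fset set FS} := [fset V in [seq g (tval w) | w <- enum P]]%fset.
    apply: (@le_trans _ _ (#|` F|%:R)%:E).
      apply: ereal_inf_lbound; exists F => //; split.
        move=> V /=; rewrite !inE/= => /mapP[w]; rewrite mem_enum => /set_mem Lw ->.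
        by have [] := Hg _ Lw (size_tuple w).
      move=> x Xx; have Lw := mem_language (lo m) N Xx.
      exists (g (subword x (lo m) N)).
        rewrite /= !inE/=; apply/mapP; exists (subtuple (lo m) N x) => //.
        by rewrite mem_enum; exact: mem_set.
      by have [_] := Hg _ Lw (size_subword _ _ _); apply.
    rewrite lee_fin ler_nat card_fseq (leq_trans (size_undup _))//.
    by rewrite size_map -cardE.
  apply/lee_addgt0Pr => e e0.
  have e20 : 0 < e / 2 by rewrite divr_gt0.
  have [N0 HN0] := Lup _ e20.
  have [N1 HN1] : exists N : nat, (m + m)%:R * (h + e / 2) / (e / 2) <= N%:R.
    by exists (Num.trunc ((m + m)%:R * (h + e / 2) / (e / 2))).+1; rewrite ltW// truncnS_gt.
  rewrite -EFinD; apply: (@limn_esup_le _ _ _ (N0 + N1.+1)%N) => n Nn.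
  have nR : 0 < n%:R :> R by rewrite ltr0n; lia.
  apply: (@le_trans _ _ ((n%:R^-1)%:E * ((n + (m + m))%:R * (h + e / 2))%:E)%E).
    apply: lee_wpmul2l; first by rewrite lee_fin invr_ge0.
    apply: le_trans (_ : (lne (cnt L (n + (m + m)))%:R%:E <= _)%E).
      rewrite lee_lne ?in_itv/= ?lee_fin ?ler0n ?leey//.
      by rewrite andbT; apply: le_ereal_inf_tmp => _ [F _ <-]; rewrite lee_fin.
    rewrite lne_EFin ?ltr0n ?cntL_gt0// lee_fin.
    rewrite -ler_expR lnK ?posrE ?ltr0n ?cntL_gt0//; apply: HN0; lia.
  rewrite -EFinM lee_fin ler_pdivrMl// natrD mulrDl [in leRHS](splitr e) addrA.
  rewrite [leRHS]mulrDr lerD2l -ler_pdivrMr//; apply: le_trans HN1 _.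
  by rewrite ler_nat; lia.
- pose C := [set [set x : FS | x 0 = a] | a in [set: A]].
  have oC : open_cover X C.
    split; last by move=> x Xx; exists [set y | y 0 = x 0] => //; exists (x 0).
    move=> _ [a _ <-]; rewrite openE => x /= <-; exact: nbhs_coord.
  apply: (@le_trans _ _ (cover_entropy R X C)); last first.
    by apply: ereal_sup_ubound; exists C.
  apply: limn_esup_ge => N; exists N.+1 => //; set n := N.+1.
  have nR : 0 < n%:R :> R by rewrite ltr0n.
  have sub : ((cnt L n)%:R%:E <= subcover_number R X (iter_cover C n))%E.
    apply: le_ereal_inf_tmp => _ [F [FC XF] <-]; rewrite lee_fin ler_nat.
    have ex (w : word p) : exists V, L w -> size w = n -> V \in F /\
        exists2 x, V x & subword x 0 n = w.
      have [Lw|nLw] := pselect (L w); last by exists setT.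
      have [wN|wN] := pselect (size w = n); last by exists setT.
      have [x Xx xw] := language_at0 X_shift Lw.
      have [V /= FV Vx] := XF _ Xx; exists V => _ _; split=> //.
      by exists x => //; rewrite -wN.
    have [g Hg] := boolp.choice ex.
    pose P := [pred w : n.-tuple A | (w : word p) \in L].
    rewrite /cnt cardE -(size_map (fun w : n.-tuple A => g w)); apply: uniq_leq_size.
      rewrite map_inj_in_uniq ?enum_uniq// => w w'.
      rewrite !mem_enum => /set_mem Lw /set_mem Lw' gww'.
      have [Fw [x gx xw]] := Hg _ Lw (size_tuple w).
      have [_ [y gy yw]] := Hg _ Lw' (size_tuple w').
      have [v Hv] := iter_cover_coord_word (FC _ Fw).
      by apply/val_inj; rewrite /= -xw -yw Hv// [RHS]Hv// gww'.
    move=> V /mapP[w]; rewrite mem_enum => /set_mem Lw ->.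
    by have [] := Hg _ Lw (size_tuple w).
  apply: (@le_trans _ _ ((n%:R^-1)%:E * (n%:R * h)%:E)%E).
    by rewrite -EFinM mulKf// gt_eqF.
  apply: lee_wpmul2l; first by rewrite lee_fin invr_ge0.
  apply: (@le_trans _ _ (lne (cnt L n)%:R%:E)).
    rewrite lne_EFin ?ltr0n ?cntL_gt0// lee_fin -ler_expR lnK ?Llow//.
    by rewrite posrE ltr0n cntL_gt0.
  rewrite lee_lne ?in_itv/= ?lee_fin ?ler0n ?leey//.
  by rewrite andbT; apply: le_trans sub; rewrite lee_fin.
Qed.

End TopologicalEntropy.

(** * Measures from their values on cylinders *)

Section IntervalCoding.
Context {R : realType} {p : nat}.
Notation A := 'I_p.+1.
Implicit Types (u v : word p) (a b : A) (t : R).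
Variable c : word p -> R.
Hypotheses (c_ge0 : forall u, 0 <= c u) (c_nil : c [::] = 1)
  (c_rcons : forall u, \sum_a c (rcons u a) = c u).

(** The bound [n] is a natural number rather than a letter, so that [offset u a.+1] is also the
    right end of the last subinterval, where it equals [c u]. *)
Definition offset u (n : nat) : R := \sum_(b : A | (b < n)%N) c (rcons u b).

Definition left_end u : R :=
  \sum_(i < size u) offset (take i u) (nth ord0 u i).

(* The words of length n cut [0, 1[ into intervals of lengths c u; [codeword t n]
   is the word whose interval contains t. *)
Definition digit u t : A := odflt ord0
  [pick a : A | left_end u + offset u a <= t < left_end u + offset u a.+1].

Fixpoint codeword t n : word p :=
  if n is n'.+1 then rcons (codeword t n') (digit (codeword t n') t) else [::].

Lemma size_codeword t n : size (codeword t n) = n.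
Proof. by elim: n => //= n IHn; rewrite size_rcons IHn. Qed.

Lemma offset0 u : offset u 0 = 0. Proof. by rewrite /offset big_pred0. Qed.

Lemma offsetT u : offset u p.+1 = c u.
Proof. by rewrite -c_rcons /offset; apply: eq_bigl => b; rewrite ltn_ord. Qed.

Lemma offsetS u a : offset u a.+1 = offset u a + c (rcons u a).
Proof.
rewrite /offset (bigD1 a)//= addrC; congr (_ + _); apply: eq_bigl => b.
by rewrite ltnS [in RHS]ltn_neqAle andbC -val_eqE.
Qed.

Lemma offset_mono u n n' : (n <= n')%N -> offset u n <= offset u n'.
Proof.
move=> nn'; rewrite /offset [leRHS](bigID (fun b : A => (b < n)%N))/=.
rewrite [X in _ <= X + _](eq_bigl (fun b : A => (b < n)%N)).
  by rewrite lerDl sumr_ge0.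
by move=> b /=; apply: andb_idl => /leq_trans; exact.
Qed.

Lemma left_end_rcons u a : left_end (rcons u a) = left_end u + offset u a.
Proof.
rewrite /left_end size_rcons big_ord_recr/= nth_rcons ltnn eqxx.
rewrite -cats1 take_size_cat//; congr (_ + _); apply: eq_bigr => i _.
by rewrite nth_cat ltn_ord takel_cat// ltnW.
Qed.

Lemma left_end_rconsS u a :
  left_end (rcons u a) + c (rcons u a) = left_end u + offset u a.+1.
Proof. by rewrite left_end_rcons offsetS addrA. Qed.

Lemma digit_bounds u t : left_end u <= t < left_end u + c u ->
  left_end (rcons u (digit u t)) <= t <
  left_end (rcons u (digit u t)) + c (rcons u (digit u t)).
Proof.
move=> /andP[ut tu]; rewrite left_end_rconsS left_end_rcons /digit.
case: pickP => [a //|nopick].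
have ex : exists n, t < left_end u + offset u n by exists p.+1; rewrite offsetT.
have := ex_minnP ex; case=> -[|n] Hn Hmin.
  by move: Hn; rewrite offset0 addr0 ltNge ut.
have np : (n < p.+1)%N by apply: Hmin; rewrite offsetT.
have := nopick (Ordinal np); rewrite /= Hn andbT leNgt => /negbFE/Hmin.
by rewrite ltnn.
Qed.

Lemma codeword_bounds t n : 0 <= t < 1 ->
  left_end (codeword t n) <= t < left_end (codeword t n) + c (codeword t n).
Proof.
move=> t01; elim: n => [|n IHn /=]; last exact: digit_bounds.
by rewrite /left_end big_ord0 c_nil add0r.
Qed.

Lemma digit_uniq u a t : left_end (rcons u a) <= t <
  left_end (rcons u a) + c (rcons u a) -> digit u t = a.
Proof.
rewrite left_end_rconsS left_end_rcons => /andP[at_ ta].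
rewrite /digit; case: pickP => [b /andP[bt tb]|/(_ a)]; last by rewrite at_ ta.
apply/val_inj/eqP => /=; rewrite eqn_leq; apply/andP; split; rewrite leqNgt; apply/negP => H.
  by have := lt_le_trans ta (le_trans _ bt); rewrite ltxx => /(_ _)H';
    apply: notF; apply: H'; rewrite lerD2l offset_mono.
by have := lt_le_trans tb (le_trans _ at_); rewrite ltxx => /(_ _)H';
  apply: notF; apply: H'; rewrite lerD2l offset_mono.
Qed.

Lemma codeword_uniq u t : left_end u <= t < left_end u + c u ->
  0 <= t < 1 /\ codeword t (size u) = u.
Proof.
elim/last_ind: u => [|u a IHu] H.
  by move: H; rewrite /left_end big_ord0 c_nil add0r.
have [|t01 tu] := IHu.
  move: H; rewrite left_end_rconsS left_end_rcons => /andP[at_ ta].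
  apply/andP; split.
    by apply: le_trans at_; rewrite lerDl -(offset0 u) offset_mono.
  by apply: lt_le_trans ta _; rewrite lerD2l -offsetT offset_mono.
by rewrite size_rcons/= tu (digit_uniq H).
Qed.

Lemma codeword_fiber u : [set t | 0 <= t < 1 /\ codeword t (size u) = u] =
  [set` `[left_end u, left_end u + c u[ ].
Proof.
apply/seteqP; split => t /=; rewrite in_itv/=; last exact: codeword_uniq.
by move=> [t01 tu]; have := codeword_bounds (size u) t01; rewrite tu.
Qed.

Lemma codeword_nth t k n : (k < n)%N -> nth ord0 (codeword t n) k = digit (codeword t k) t.
Proof.
elim: n => // n IHn; rewrite ltnS leq_eqVlt => /orP[/eqP ->|kn] /=.
  by rewrite nth_rcons size_codeword ltnn eqxx.
by rewrite nth_rcons size_codeword kn IHn.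
Qed.

Local Notation leb := (@lebesgue_measure R).

Lemma measurable_codeword_fiber n (u : n.-tuple A) :
  measurable ([set t | 0 <= t < 1 /\ codeword t n = u] : set (measurableTypeR R)).
Proof.
have := codeword_fiber u; rewrite size_tuple => ->; exact: measurable_itv.
Qed.

(** [insubd] merely views a word of length [n] as a tuple; its default value never occurs. *)
Lemma codeword_pred n (P : {pred n.-tuple A}) :
  [set t | 0 <= t < 1 /\ (insubd [tuple of nseq n ord0] (codeword t n) : n.-tuple A) \in P] =
  \big[setU/set0]_(u in P) [set t | 0 <= t < 1 /\ codeword t n = u].
Proof.
rewrite -bigcup_seq_cond; apply/seteqP; split => t /=.
  move=> [t01 Pt]; exists (insubd [tuple of nseq n ord0] (codeword t n)).
    by rewrite /= mem_index_enum.
  by split => //; rewrite val_insubd size_codeword eqxx.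
move=> [u /andP[_ Pu] [t01 tu]]; split=> //.
by rewrite (_ : insubd _ _ = u)//; apply/val_inj; rewrite /= val_insubd size_codeword eqxx.
Qed.

Lemma lebesgue_codeword n (P : {pred n.-tuple A}) :
  measurable ([set t | 0 <= t < 1 /\
    (insubd [tuple of nseq n ord0] (codeword t n) : n.-tuple A) \in P] : set (measurableTypeR R)) /\
  leb [set t | 0 <= t < 1 /\
    (insubd [tuple of nseq n ord0] (codeword t n) : n.-tuple A) \in P] =
  (\sum_(u in P) c u)%:E.
Proof.
rewrite codeword_pred; split.
  by apply: bigsetU_measurable => u _; exact: measurable_codeword_fiber.
rewrite big_enum_val measure_bigsetU_ord//; first last.
- move=> i j _ _ [t [[_ ti] [_ tj]]]; apply: enum_val_inj; apply/val_inj.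
  by rewrite /= -ti -tj.
- by move=> i; exact: measurable_codeword_fiber.
rewrite -(big_enum_val (fun u : n.-tuple A => leb [set t | 0 <= t < 1 /\ codeword t n = u])).
rewrite -sumEFin; apply: eq_bigr => u _.
have := codeword_fiber u; rewrite size_tuple => ->.
rewrite lebesgue_measure_itv/= lte_fin ltrDl; case: ifPn => [_|].
  by rewrite -EFinD addrAC subrr add0r.
by rewrite -leNgt => c0; congr EFin; apply/eqP; rewrite eq_le c0 c_ge0.
Qed.

End IntervalCoding.

Definition encode s : coordinate s -> nat :=
  match s return coordinate s -> nat with
  | OneSided => fun i : nat => i
  | TwoSided => fun i : int => choice.pickle i
  end.

(** A number that codes no integer is sent to coordinate 0, so a prefix may read this coordinate
    several times. Words in which these readings disagree simply receive weight 0. *)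
Definition decode s : nat -> coordinate s :=
  match s return nat -> coordinate s with
  | OneSided => fun n => n
  | TwoSided => fun n => odflt (0 : int) (choice.unpickle n)
  end.

Lemma encodeK s : cancel (@encode s) (@decode s).
Proof. by case: s => i //=; rewrite choice.pickleK. Qed.

Section MeasureOfContent.
Context {R : realType} {s : sidedness} {p : nat}.
Notation A := 'I_p.+1.
Notation FS := (fullshift s p).
Notation BS := (borel s p).
Implicit Types (u v : word p) (t : R) (i : coordinate s).
Variable m : set FS -> R.
Hypothesis madd : finite_additive finitary m.

Let pfx K (x : FS) : word p := mkseq (fun k => x (decode s k) : A) K.

Let pfx_rcons K x : pfx K.+1 x = rcons (pfx K x) (x (decode s K)).
Proof. exact: mkseqS. Qed.

Let size_pfx K x : size (pfx K x) = K. Proof. exact: size_mkseq. Qed.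

Let finitary_pfx K (S : set (word p)) : finitary [set x | S (pfx K x)].
Proof.
suff [k [f fE]] : exists k (f : word p -> word p), forall x, pfx K x = f (window k x).
  by exists k, (S \o f); apply/seteqP; split => x /=; rewrite fE.
elim: K => [|K [k [f fE]]]; first by exists 0%N, (fun=> [::]).
have [k' [g gE]] := @window_coord s p (decode s K).
have [f1 f1E] := @window_take s p _ _ (leq_maxl k k').
have [g1 g1E] := @window_take s p _ _ (leq_maxr k k').
exists (maxn k k'), (fun u => rcons (f (f1 u)) (g (g1 u))) => x.
by rewrite pfx_rcons fE gE f1E g1E.
Qed.

Let c u : R := m [set x | pfx (size u) x = u].

Let c_ge0 u : 0 <= c u.
Proof.
by have [_ m0 _] := madd; apply: m0; exact: (finitary_pfx _ [set v | v = u]).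
Qed.

Let c_nil : c [::] = 1.
Proof.
have [<- _ _] := madd; rewrite /c; congr m.
by apply/seteqP; split => x.
Qed.

Let c_rcons u : \sum_a c (rcons u a) = c u.
Proof.
have fa (a : A) : finitary [set x : FS | x (decode s (size u)) = a].
  have [k [g gE]] := @window_coord s p (decode s (size u)).
  exists k, [set v | g v = a].
  by apply/seteqP; split => x /=; rewrite gE.
rewrite [RHS](fadd_partition setalg_finitary madd
  (finitary_pfx (size u) [set v | v = u]) fa).
apply: eq_bigr => a _; rewrite /c; congr m; apply/seteqP; split => x /=.
  by rewrite size_rcons pfx_rcons => /eqP; rewrite eqseq_rcons => /andP[/eqP ? /eqP ?].
by move=> [xu xa]; rewrite size_rcons pfx_rcons xu xa.
Qed.

Let point_of t : BS := fun i => digit c (codeword c t (encode i)) t.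

Let unit_itv : set (measurableTypeR R) := [set t : R | 0 <= t < 1].

Let munit : measurable unit_itv.
Proof.
rewrite (_ : unit_itv = [set` `[0, 1[ ]); first exact: measurable_itv.
by apply/seteqP; split => t /=; rewrite in_itv.
Qed.

Let window_codeword k : exists K (f : word p -> word p),
  (forall x, window k x = f (pfx K x)) /\
  (forall t, window k (point_of t) = f (codeword c t K)).
Proof.
pose e j := encode (lo k + j%:R : coordinate s).
pose K := (\max_(j < (k + k).+1) e j).+1.
have eK j : (j < (k + k).+1)%N -> (e j < K)%N.
  by move=> jk; rewrite ltnS; exact: (leq_bigmax (Ordinal jk)).
exists K, (fun v => mkseq (fun j => nth ord0 v (e j)) (k + k).+1); split => [x|t].
  apply/eq_in_map => j; rewrite mem_iota => /andP[_ jk].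
  by rewrite nth_mkseq ?eK// encodeK.
apply/eq_in_map => j; rewrite mem_iota => /andP[_ jk].
by rewrite codeword_nth ?eK.
Qed.

Let content_preimage (B : set FS) : finitary B ->
  measurable (unit_itv `&` point_of @^-1` B) /\
  lebesgue_measure (unit_itv `&` point_of @^-1` B) = (m B)%:E.
Proof.
move=> [k [S ->]]; have [K [f [fx ft]]] := window_codeword k.
pose P := [pred u : K.-tuple A | `[< S (f u) >]].
have [mP lP] := lebesgue_codeword c_ge0 c_nil c_rcons P.
have E : unit_itv `&` point_of @^-1` [set x | S (window k x)] =
    [set t | 0 <= t < 1 /\ (insubd [tuple of nseq K ord0] (codeword c t K) : K.-tuple A) \in P].
  have inP t : ((insubd [tuple of nseq K ord0] (codeword c t K) : K.-tuple A) \in P)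
      = `[< S (f (codeword c t K)) >].
    by rewrite /P/= [LHS]inE/= val_insubd size_codeword eqxx.
  apply/seteqP; split => t /= [t01]; rewrite /= ?ft ?inP => H; split => //.
    exact/asboolP.
  by move: H => /asboolP.
rewrite E; split => //; rewrite [LHS]lP; congr EFin.
have pf (u : K.-tuple A) : finitary [set x | (insubd [tuple of nseq K ord0] (pfx K x) : K.-tuple A) = u].
  rewrite (_ : [set x | _] = [set x | pfx K x = u]).
    exact: (finitary_pfx K [set v | v = tval u]).
  apply/seteqP; split => x /=.
    by move=> <-; rewrite val_insubd size_pfx eqxx.
  by move=> E'; apply/val_inj; rewrite /= val_insubd size_pfx eqxx.
have [_ mS] := fadd_fibers setalg_finitary madd P pf.
rewrite (_ : [set x | S (window k x)] = [set x | P (insubd [tuple of nseq K ord0] (pfx K x))]).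
  rewrite mS; apply: eq_bigr => u _; rewrite /c; congr m.
  apply/seteqP; split => x /=; rewrite size_tuple.
    by move=> E'; apply/val_inj; rewrite /= val_insubd size_pfx eqxx.
  by move=> <-; rewrite val_insubd size_pfx eqxx.
have Px x : S (window k x) <-> P (insubd [tuple of nseq K ord0] (pfx K x)).
  by rewrite fx /P/= val_insubd size_pfx eqxx; split => [?|/asboolP//]; exact/asboolP.
by apply/seteqP; split => x; case: (Px x).
Qed.

Let measurable_point_of : measurable_fun unit_itv point_of.
Proof.
have := @measurability _ _ (measurableTypeR R) BS unit_itv point_of
  finitary borel_generated.
apply => _ [B fB <-]; exact: (content_preimage fB).1.
Qed.

Let coded (B : set BS) : \bar R := lebesgue_measure (unit_itv `&` point_of @^-1` B).

Let coded0 : coded set0 = 0%E.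
Proof. by rewrite /coded preimage_set0 setI0 measure0. Qed.

Let coded_ge0 B : (0 <= coded B)%E.
Proof. exact: measure_ge0. Qed.

Let coded_sigma_additive : semi_sigma_additive coded.
Proof.
move=> F mF tF mUF; rewrite /coded preimage_bigcup setI_bigcupr.
apply: measure_semi_sigma_additive.
- by move=> n; exact: measurable_point_of.
- apply/trivIsetP => /= i j _ _ ij; apply/seteqP; split => // t [[_ Fi] [_ Fj]].
  move/trivIsetP : tF => /(_ _ _ I I ij)/seteqP[/(_ (point_of t)) F0 _].
  exact: F0.
- by rewrite -setI_bigcupr -preimage_bigcup; exact: measurable_point_of.
Qed.

HB.instance Definition _ := isMeasure.Build _ _ _
  coded coded0 coded_ge0 coded_sigma_additive.

Let coded_setT : coded setT = 1%E.
Proof.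
have [mT _ _] := madd.
by have [_] := content_preimage (@finitaryT s p); rewrite mT.
Qed.

HB.instance Definition _ := Measure_isProbability.Build _ _ _ coded coded_setT.

(** Reading coordinates in the order of an enumeration makes the content a consistent system of
    weights on words, hence a nested subdivision of [0,1[. The measure is the image of Lebesgue
    measure under [point_of] and inherits its countable additivity. *)
Lemma measure_of_content : exists mu : probability BS R,
  forall B : set FS, finitary B -> mu B = (m B)%:E.
Proof.
by exists (coded : probability BS R) => B /content_preimage[].
Qed.

End MeasureOfContent.

(** * Measures of maximal entropy: criteria and existence *)

Section UltraLimits.
Context {R : realType}.

Lemma ultra_bounded_cvg (F : set_system nat) (f : nat -> R) : UltraFilter F ->
  (\forall n \near F, 0 <= f n <= 1) -> exists l : R, f n @[n --> F] --> l.
Proof.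
move=> FU Ff; have FP : ProperFilter F by exact: ultra_proper.
have [|l [_ cl]] := @segment_compact R 0 1 (f @ F) _.
  by apply: filterS Ff => n; rewrite /= in_itv.
exists l => V Vl; have [//|FV] := in_ultra_setVsetC (f @^-1` V) FU.
have [|y [nVy Vy]] := cl (~` V) V _ Vl; first exact: FV.
by [].
Qed.

Lemma near_eq_lim (F : set_system nat) (f g : nat -> R) (l l' : R) :
  ProperFilter F -> f n @[n --> F] --> l -> g n @[n --> F] --> l' ->
  (\forall n \near F, f n = g n) -> l = l'.
Proof.
move=> FP fl gl' fg; apply/eqP; rewrite eq_le; apply/andP; split.
  by apply: (ler_cvg_to fl gl'); apply: filterS fg => n ->.
by apply: (ler_cvg_to gl' fl); apply: filterS fg => n ->.
Qed.

(** If [V] were a neighbourhood of [l] missed infinitely often, the trace of [\oo] on the indices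
    that miss it would be a proper filter, and an ultrafilter containing it would contradict the
    hypothesis. *)
Lemma cvg_ultra (T : topologicalType) (f : nat -> T) (l : T) :
  (forall F, UltraFilter F -> \oo `<=` F -> f n @[n --> F] --> l) ->
  f n @[n --> \oo] --> l.
Proof.
move=> H V Vl; apply: contrapT => nV.
pose G (B : set nat) := \forall n \near \oo, ~ V (f n) -> B n.
have GF : Filter G.
  split.
  - by rewrite /G; apply: filterE => n _; exact: I.
  - move=> P Q GP GQ.
    exact: (@filterS2 nat \oo _ _ _ _ (fun n PP QQ nV => conj (PP nV) (QQ nV)) GP GQ).
  - move=> P Q PQ GP.
    exact: (@filterS nat \oo _ _ _ (fun n PP nV => PQ n (PP nV)) GP).
have GP : ProperFilter G.
  split=> // G0; apply: nV.
  exact: (@filterS nat \oo _ _ _ (fun n PP => contrapT PP) G0).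
have [F [FU GF']] := ultraFilterLemma GP.
have ooF : \oo `<=` F.
  move=> B oB; apply: GF'.
  exact: (@filterS nat \oo _ _ _ (fun n Bn _ => Bn) oB).
have FV : F (f @^-1` V) by exact: H F FU ooF V Vl.
have nFV : F [set n | ~ V (f n)] by apply: GF'; rewrite /G; apply: filterE => n nVn; exact: nVn.
have FP : ProperFilter F by exact: ultra_proper.
by have [n []] := @filter_ex _ F _ _ (filterI FV nFV).
Qed.

Context {s : sidedness} {p : nat}.
Notation FS := (fullshift s p).
Notation BS := (borel s p).

(** Along one ultrafilter the bounded values on all finitary sets converge simultaneously, and
    finite additivity passes to the limit. *)
Lemma limit_measure (F : set_system nat) (m_ : nat -> set FS -> R) :
  UltraFilter F -> (\forall n \near F, finite_additive finitary (m_ n)) ->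
  exists mu : probability BS R, forall B : set FS, finitary B ->
    m_ n B @[n --> F] --> fine (mu B).
Proof.
move=> FU Fm; have FP : ProperFilter F by exact: ultra_proper.
have ex (B : set FS) : exists l : R, finitary B -> m_ n B @[n --> F] --> l.
  have [fB|nfB] := pselect (finitary B); last by exists 0.
  have [|l Hl] := @ultra_bounded_cvg F (fun n => m_ n B) FU; last by exists l.
  apply: filterS Fm => n mn; have [_ m0 _] := mn.
  by rewrite m0//= (fadd_le1 setalg_finitary mn).
have [m Hm] := boolp.choice ex.
have madd : finite_additive finitary m.
  split.
  - have cst1 : (fun=> 1 : R) @ F --> (1 : R) by exact: cvg_cst.
    apply: (near_eq_lim FP (Hm _ (@finitaryT s p)) cst1).
    by apply: filterS Fm => n [mT _ _].
  - move=> B fB; have cst0 : (fun=> 0 : R) @ F --> (0 : R) by exact: cvg_cst.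
    apply: (ler_cvg_to cst0 (Hm B fB)).
    by apply: filterS Fm => n [_ m0 _]; exact: m0.
  - move=> B B' fB fB' BB'.
    apply: (near_eq_lim FP (Hm _ (finitaryU fB fB')) (cvgD (Hm _ fB) (Hm _ fB'))).
    by apply: filterS Fm => n [_ _ mU]; rewrite /= mU.
have [mu Hmu] := measure_of_content madd.
by exists mu => B fB; rewrite Hmu//; exact: Hm.
Qed.

End UltraLimits.

Section MeasuresOfMaximalEntropy.
Context {R : realType} {s : sidedness} {p : nat}.
Notation A := 'I_p.+1.
Notation FS := (fullshift s p).
Notation BS := (borel s p).
Variable X : set FS.
Hypothesis X_shift : shift_space X.
Let L := language X.

Definition mass (mu : probability BS R) (B : set FS) : R := fine (mu B).

Lemma measurable_shift_space : measurable (X : set BS).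
Proof. by have [_ cX _] := X_shift; exact: measurable_closed. Qed.

Lemma finitary_language i n : finitary [set x : FS | L (subword x i n)].
Proof. exact: (finitary_subword i n L). Qed.

Lemma full_measure (mu : probability BS R) :
  (forall m, mass mu [set x | L (window m x)] = 1) -> mu X = 1%E.
Proof.
move=> H; have mX := measurable_shift_space.
suff : mu (~` X) = 0%E.
  by rewrite probability_setC// => /eqP; rewrite sube_eq// ?add0e// => /eqP <-.
apply: measure_negligible; first exact: measurableC.
rewrite [X in ~` X](shift_space_bigcap X_shift) setC_bigcap.
apply: negligible_bigcup => m.
have fm := finitary_language (lo m) (m + m).+1.
apply/negligibleP; first by apply: measurable_finitary; exact: finitaryC.
have mB := measurable_finitary fm.
apply: etrans (probability_setC mu mB) _.
by rewrite -[X in (_ - X)%E]fineK ?fin_num_measure// [fine _]H subee.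
Qed.

Lemma wd_support (mu : probability BS R) u : mu X = 1%E ->
  0 < wd (mass mu) u -> L u.
Proof.
move=> muX wu; apply: contrapT => nLu; move: wu.
rewrite lt_neqAle => /andP[/eqP + _]; apply; apply/esym.
rewrite /wd /mass; have mX := measurable_shift_space.
have fB := finitary_subword (0 : coordinate s) (size u) [set v | v = u].
have mB := measurable_finitary fB.
suff -> : mu [set x | subword x 0 (size u) = u] = 0%E by [].
apply/eqP; rewrite -measure_le0.
have <- : mu (~` X) = 0%E by rewrite probability_setC// muX subee.
apply: le_measure; rewrite ?inE//; first exact: measurableC.
move=> x /= xu Xx; apply: nLu; rewrite -xu; exact: mem_language.
Qed.

Variable h : R.
Hypothesis Lh : word_entropy R L = h%:E.
Hypothesis L_upper : forall e : R, 0 < e -> exists N, forall n, (N <= n)%N ->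
  (cnt L n)%:R <= expR (n%:R * (h + e)).

(** A measure with full mass on [X] charges only words of [L], so its block entropies are at most
    [ln (cnt L n)] and its entropy is at most [h]. Only the lower bound has to be supplied, and a
    constant [c] disappears after division by [n]. *)
Lemma mme_intro (mu : probability BS R) (c : R) :
  mu X = 1%E -> shift_invariant_measure mu ->
  (forall n, n%:R * h - c <= block_entropy (wd (mass mu)) n) -> is_mme X mu.
Proof.
move=> muX inv Hc; split=> //.
have dS : stationary (wd (mass mu)).
  apply: stationary_wd; first exact: probability_fadd_finitary.
  exact: invariant_measure_finitary.
have [_ d0 _ _] := dS.
rewrite (topological_entropyE X_shift) -/L Lh; apply/eqP; rewrite eq_le.
rewrite (measure_entropy_ge Hc) andbT; apply/lee_addgt0Pr => e e0.
have [N HN] := L_upper e0.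
apply: le_trans (measure_entropy_le inv (ltn0Sn N)) _.
rewrite -EFinD lee_fin ler_pdivrMr ?ltr0n// mulrC.
apply: (@le_trans _ _ (ln (cnt L N.+1)%:R)).
  pose D := [set w : N.+1.-tuple A | (w : word p) \in L]%SET.
  have -> : cnt L N.+1 = #|D|.
    by apply: eq_card => w; rewrite finset.in_set.
  apply: ent_le_card.
  - by move=> w; exact: d0.
  - exact: stationary_sum1.
  - move=> w dw; rewrite finset.in_set; apply: mem_set; exact: wd_support dw.
have c0 : 0 < (cnt L N.+1)%:R :> R.
  by rewrite ltr0n; apply: cntL_gt0; exact: language_shift_space.
by rewrite -ler_expR lnK ?posrE//; exact: HN.
Qed.

(** Each [block_entropy / n] bounds the entropy from above, so maximal entropy gives [n h] as a
    lower bound at every length, with no additive loss. *)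
Lemma mme_elim (mu : probability BS R) : is_mme X mu ->
  [/\ stationary (wd (mass mu)), forall u, 0 < wd (mass mu) u -> L u &
   forall n, n%:R * h <= block_entropy (wd (mass mu)) n].
Proof.
move=> [muX inv Emu].
have dS : stationary (wd (mass mu)).
  apply: stationary_wd; first exact: probability_fadd_finitary.
  exact: invariant_measure_finitary.
split=> // [u|n]; first exact: wd_support.
have [->|n0] := posnP n; first by rewrite mul0r block_entropy_ge0.
have := measure_entropy_le inv n0.
rewrite Emu (topological_entropyE X_shift) -/L Lh lee_fin ler_pdivlMr ?ltr0n//.
by rewrite mulrC.
Qed.

End MeasuresOfMaximalEntropy.

Lemma block_entropy_ge (R : realType) (p : nat) (d : word p -> R) n (M : R) :
  stationary d -> 0 < M -> (forall u, size u = n -> d u <= M) ->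
  - ln M <= block_entropy d n.
Proof.
move=> dS M0 dM; have [_ d0 _ _] := dS.
rewrite /block_entropy /ent -[leLHS]mul1r mulrN lerN2.
rewrite -(stationary_sum1 n dS) mulr_suml; apply: ler_sum => u _.
have [->|du] := eqVneq (d u) 0; first by rewrite !mul0r.
have du0 : 0 < d u by rewrite lt_neqAle eq_sym du d0.
by rewrite ler_wpM2l// ler_ln ?posrE// dM// size_tuple.
Qed.

(** * Existence by orbit averages *)

Section Empirical.
Context {R : realType} {T : Type}.

Definition empirical (J : finType) (P : {pred J}) (pt : J -> T) (B : set T) : R :=
  (\sum_(j in P) `[< B (pt j) >]%:R) / #|P|%:R.

Lemma empirical_fadd (J : finType) (P : {pred J}) (pt : J -> T) C :
  (0 < #|P|)%N -> finite_additive C (empirical P pt).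
Proof.
move=> P0; have PR : #|P|%:R != 0 :> R by rewrite pnatr_eq0 -lt0n.
split.
- rewrite /empirical (eq_bigr (fun=> 1)); first by rewrite sumr_const divff.
  by move=> j _; rewrite asboolT.
- by move=> B _; rewrite divr_ge0// sumr_ge0.
- move=> B B' _ _ BB'; rewrite /empirical -mulrDl -big_split/=; congr (_ / _).
  apply: eq_bigr => j _; rewrite -natrD; congr _%:R.
  have [Bj|nBj] := pselect (B (pt j)); have [Bj'|nBj'] := pselect (B' (pt j)).
  + by have : (B `&` B') (pt j) by []; rewrite BB'.
  + by rewrite (asboolT Bj) (asboolF nBj') asboolT//; left.
  + by rewrite (asboolF nBj) (asboolT Bj') asboolT//; right.
  + by rewrite (asboolF nBj) (asboolF nBj') asboolF// => -[].
Qed.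

Lemma empirical_full (J : finType) (P : {pred J}) (pt : J -> T) (B : set T) :
  (0 < #|P|)%N -> (forall j, j \in P -> B (pt j)) -> empirical P pt B = 1.
Proof.
move=> P0 H; have PR : #|P|%:R != 0 :> R by rewrite pnatr_eq0 -lt0n.
rewrite /empirical (eq_bigr (fun=> 1)); first by rewrite sumr_const divff.
by move=> j jP; rewrite asboolT//; exact: H.
Qed.

End Empirical.

Section Existence.
Context {R : realType} {s : sidedness} {p : nat}.
Notation A := 'I_p.+1.
Notation FS := (fullshift s p).
Notation BS := (borel s p).
Variable X : set FS.
Hypothesis X_shift : shift_space X.
Let L := language X.
Variables (h K : R).
Hypothesis h_ge0 : 0 <= h.
Hypothesis Lh : word_entropy R L = h%:E.
Hypothesis L_upper : forall e : R, 0 < e -> exists N, forall n, (N <= n)%N ->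
  (cnt L n)%:R <= expR (n%:R * (h + e)).
Hypothesis L_lower : forall n, expR (n%:R * h) <= (cnt L n)%:R.
Hypothesis K_ge1 : 1 <= K.
Hypothesis L_le : forall n, (cnt L n)%:R <= K * expR (n%:R * h).

Let Llang : language_axioms L. Proof. exact: language_shift_space. Qed.

Let K_gt0 : 0 < K. Proof. exact: lt_le_trans K_ge1. Qed.

Let ex_point (w : word p) : exists x : FS, L w -> X x /\ subword x 0 (size w) = w.
Proof.
have [Lw|nLw] := pselect (L w); last by exists point.
by have [x Xx xw] := language_at0 X_shift Lw; exists x.
Qed.

Let pt w : FS := projT1 (cid (ex_point w)).

Let ptP w : L w -> X (pt w) /\ subword (pt w) 0 (size w) = w.
Proof. exact: (projT2 (cid (ex_point w))). Qed.

Let LN N : {pred N.-tuple A} := [pred w : N.-tuple A | (w : word p) \in L].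

Let orbit_points N : {pred 'I_N * N.-tuple A} := predX predT (@LN N).

Let orbit_average N : set FS -> R :=
  empirical (@orbit_points N) (fun q => iter q.1 left_shift (pt q.2)).

Let card_orbit_points N : #|@orbit_points N| = (N * cnt L N)%N.
Proof. by rewrite /orbit_points cardX card_ord. Qed.

Let orbit_points_gt0 N : (0 < N)%N -> (0 < #|@orbit_points N|)%N.
Proof. by move=> N0; rewrite card_orbit_points muln_gt0 N0 cntL_gt0. Qed.

Let orbit_averageE N B : orbit_average N B =
  (\sum_(i < N) \sum_(w in @LN N) `[< B (iter i left_shift (pt w)) >]%:R)
    / (N * cnt L N)%:R.
Proof.
rewrite /orbit_average /empirical card_orbit_points; congr (_ / _).
rewrite pair_big/=; apply: eq_bigl => -[i w] /=.
by rewrite [LHS]inE.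
Qed.

Let cntN0 N : (0 < N)%N -> 0 < (N * cnt L N)%:R :> R.
Proof. by move=> N0; rewrite ltr0n muln_gt0 N0 cntL_gt0. Qed.

(** Along each orbit segment the difference telescopes to its two end terms. *)
Let orbit_average_invariant N B : (0 < N)%N ->
  `|orbit_average N (left_shift @^-1` B) - orbit_average N B| <= N%:R^-1.
Proof.
move=> N0; rewrite !orbit_averageE -mulrBl normrM [X in _ * X]ger0_norm ?invr_ge0 ?ler0n//.
rewrite ler_pdivrMr ?cntN0//.
rewrite natrM mulrA mulVf ?pnatr_eq0 -?lt0n// mul1r.
rewrite exchange_big/= [X in `|_ - X|]exchange_big/= -sumrB.
rewrite -[leRHS](_ : \sum_(w in @LN N) 1 = _); last by rewrite sumr_const.
apply: le_trans (ler_norm_sum _ _ _) _; apply: ler_sum => w _.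
pose f i : R := `[< B (iter i left_shift (pt w)) >]%:R.
have -> : \sum_(i < N) `[< (left_shift @^-1` B) (iter i left_shift (pt w)) >]%:R -
    \sum_(i < N) `[< B (iter i left_shift (pt w)) >]%:R = f N - f 0%N.
  rewrite -sumrB -(telescope_sumr f (leq0n N)) big_mkord.
  by apply: eq_bigr => i _.
by rewrite /f; do 2 case: asboolP => _; rewrite ?subrr ?subr0 ?sub0r ?normrN ?normr0 ?normr1.
Qed.

Let orbit_average_support N m : (0 < N)%N ->
  orbit_average N [set x | L (window m x)] = 1.
Proof.
move=> N0; apply: empirical_full; first exact: orbit_points_gt0.
move=> [i w] /andP[_ /set_mem Lw]; apply: mem_language.
by apply: iter_shift_mem => //; have [] := ptP Lw.
Qed.

Let occurs_subword N (v : N.-tuple A) w i : L v -> occurs w i v ->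
  subword (iter i left_shift (pt v)) 0 (size w) = w.
Proof.
move=> Lv; rewrite /occurs subword_shift add0r.
have [wn|wn] := posnP (size w).
  by case: w wn => //= _ _; rewrite /subword/mkseq.
have [_] := ptP Lv; rewrite size_tuple => vE occ.
have iN : (i + size w <= N)%N.
  have := congr1 size occ; rewrite size_take size_drop size_tuple.
  by case: ifP; lia.
by rewrite -[RHS]occ -[in RHS]vE take_drop_subword// add0r.
Qed.

Let sum_ltn N n : (\sum_(i < N) (i < n) <= n)%N.
Proof.
suff -> : (\sum_(i < N) (i < n) = minn N n)%N by exact: geq_minr.
elim: N => [|N IHN]; first by rewrite big_ord0 min0n.
by rewrite big_ord_recr/= IHN; lia.
Qed.

(** A word of length [N] with [u] at position [i] is fixed by what precedes and follows [u], so
    there are at most [K^2 e^((N-n)h)] of them, out of at least [e^(Nh)]. *)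
Let orbit_average_gibbs N u : (0 < N)%N ->
  orbit_average N [set x | subword x 0 (size u) = u] <=
  K ^+ 2 * expR (- ((size u)%:R * h)) + (size u)%:R / N%:R.
Proof.
move=> N0; set n := size u.
have NR : 0 < N%:R :> R by rewrite ltr0n.
rewrite orbit_averageE ler_pdivrMr ?cntN0//.
(* When [i + n > N] the word [u] sticks out of the prescribed part of the point. These at most [n]
   positions are counted in full and give the term [n / N]. *)
have bound (i : 'I_N) :
    \sum_(w in @LN N) `[< [set x | subword x 0 n = u] (iter i left_shift (pt w)) >]%:R
    <= K ^+ 2 * expR (- (n%:R * h)) * (cnt L N)%:R + (N < i + n)%:R * (cnt L N)%:R :> R.
  have [Nin|inN] := ltnP N (i + n).
    rewrite mul1r -[leLHS]add0r lerD//.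
      by rewrite !mulr_ge0 ?exprn_ge0 ?expR_ge0 ?ler0n ?(ltW K_gt0).
    rewrite -[leRHS](_ : \sum_(w in @LN N) 1 = _); last by rewrite sumr_const.
    by apply: ler_sum => w _; case: asboolP.
  rewrite mul0r addr0.
  have -> : \sum_(w in @LN N) `[< [set x | subword x 0 n = u] (iter i left_shift (pt w)) >]%:R
      = (cnt [set v | L v /\ occurs u i v] N)%:R :> R.
    rewrite cnt_sum big_mkcond/=; apply: eq_bigr => w _.
    case: ifPn => [/set_mem Lw|nLw]; last first.
      case: (boolP (_ \in _)) => // /set_mem[Lw _].
      by move: nLw; rewrite /LN inE/= mem_set.
    congr (nat_of_bool _)%:R; apply/asboolP/idP => [/=|/set_mem[_ /(occurs_subword Lw)]//].
    have [_] := ptP Lw; rewrite size_tuple => wE.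
    rewrite subword_shift add0r => E; apply/mem_set; split=> //.
    by rewrite /occurs -wE take_drop_subword// add0r.
  have EN : N = (i + (n + (N - i - n)))%N by lia.
  have H : (cnt [set v | L v /\ occurs u i v] N <= cnt L i * (1 * cnt L (N - i - n)))%N.
    rewrite [X in (cnt _ X <= _)%N]EN.
    apply: (@leq_trans (cnt L i * cnt [set v | L v /\ take n v = u] (n + (N - i - n)))).
      apply: (@cnt_cat_le R) => v w vi wn [Lvw]; rewrite /occurs drop_size_cat// => E.
      by have [_ Ll Lr _] := Llang; split; [exact: Ll Lvw|split=> //; exact: Lr Lvw].
    rewrite leq_mul2l; apply/orP; right.
    apply: (@leq_trans (cnt [set u] n * cnt L (N - i - n))).
      apply: (@cnt_cat_le R) => v w vn wn [Lvw]; rewrite take_size_cat// => E.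
      by have [_ _ Lr _] := Llang; split=> //; exact: Lr Lvw.
    rewrite leq_mul2r; apply/orP; right.
    have := @cnt_le_inj p unit predT (fun=> tt) [set u] n (fun _ _ _ => isT).
    by rewrite card_unit; apply => v w /= -> ->.
  have {}H : (cnt [set v | L v /\ occurs u i v] N)%:R <=
      (cnt L i)%:R * (cnt L (N - i - n))%:R :> R.
    by rewrite -natrM ler_nat (leq_trans H)// mul1n.
  apply: le_trans H _.
  apply: (@le_trans _ _ (K * expR (i%:R * h) * (K * expR ((N - i - n)%:R * h)))).
    by rewrite ler_pM ?ler0n.
  rewrite [leLHS](_ : _ = K ^+ 2 * expR (- (n%:R * h)) * expR (N%:R * h)).
    by rewrite ler_wpM2l ?mulr_ge0 ?exprn_ge0 ?expR_ge0 ?(ltW K_gt0).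
  rewrite (_ : N%:R = i%:R + (n%:R + (N - i - n)%:R) :> R); last by rewrite -!natrD -EN.
  by rewrite !mulrDl !expRD expRN; field; rewrite gt_eqF ?expR_gt0.
apply: le_trans (ler_sum _ (fun i _ => bound i)) _.
rewrite big_split/= sumr_const card_ord -mulr_suml mulrDl lerD//.
  by rewrite natrM -mulr_natr le_eqVlt; apply/orP; left; apply/eqP; ring.
rewrite natrM mulrA divfK ?gt_eqF// ler_wpM2r//.
rewrite -natr_sum ler_nat (reindex_inj rev_ord_inj)/=.
apply: leq_trans (sum_ltn N n); apply: leq_sum => i _.
by have := ltn_ord i; case: ltnP => //; lia.
Qed.

Variables (G : set (word p)) (t : nat).
Hypothesis glue : gluing L G t L.
Variables (tau0 : nat) (c1 : R).
Hypothesis c1_gt0 : 0 < c1.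
Hypothesis synd : forall n, exists2 j,
  (j <= tau0)%N & c1 * expR ((n + j)%:R * h) <= (cnt G (n + j))%:R.

Let pair_cylinder (w w' : word p) k : set FS :=
  [set x | subword x 0 (size w) = w] `&` [set x | subword x k%:R (size w') = w'].

Let finitary_pair w w' k : finitary (pair_cylinder w w' k).
Proof.
apply: finitaryI; first exact: (finitary_subword _ _ [set v | v = w]).
exact: (finitary_subword _ _ [set v | v = w']).
Qed.

Let orbit_average_pair (tau : nat) : exists2 c : R, 0 < c &
  forall n x w y x' w' y', size w = n -> size w' = n ->
    (size x <= tau)%N -> (size y <= tau)%N ->
    (size x' <= tau)%N -> (size y' <= tau)%N ->
    G (x ++ w ++ y) -> G (x' ++ w' ++ y') ->
    exists N0, forall N, (N0 <= N)%N ->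
      c * expR (- ((n + n)%:R * h)) <=
      orbit_average N (pair_cylinder w w' (size w + size y + t + size x')).
Proof.
have [c c0 Hc] := pair_frequency Llang glue h_ge0 c1_gt0 synd tau.
exists (c / K); first by rewrite divr_gt0.
move=> n x w y x' w' y' wn w'n xt yt x't y't Gg Gg'.
have [N0 HN0] := Hc n x w y x' w' y' wn w'n xt yt x't y't Gg Gg'.
exists N0.+1 => N NN; have N_gt0 : (0 < N)%N by exact: leq_trans NN.
have {}HN0 := HN0 N (ltnW NN).
set k := (size w + size y + t + size x')%N in HN0 *.
rewrite orbit_averageE ler_pdivlMr ?cntN0//.
apply: (@le_trans _ _ (\sum_(i < N) cnt (pair_set L w w' i k) N)%:R); last first.
  rewrite natr_sum; apply: ler_sum => i _; rewrite cnt_sum [leRHS]big_mkcond/=.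
  apply: ler_sum => v _; case: (boolP (_ \in pair_set _ _ _ _ _)) => [/set_mem[Lv o1 o2]|_]; last first.
    by case: ifP.
  have -> : (v \in @LN N) by exact: mem_set.
  rewrite asboolT//; split => /=; first exact: occurs_subword.
  have := occurs_subword Lv o2.
  by rewrite !subword_shift !add0r natrD addrC.
set E := expR ((n + n)%:R * h) in HN0 *; have E0 : 0 < E by exact: expR_gt0.
rewrite expRN -/E natrM -(ler_pM2l E0); apply: le_trans HN0.
rewrite [leLHS](_ : _ = c * N%:R * ((cnt L N)%:R / K)).
  by rewrite ler_wpM2l ?mulr_ge0 ?(ltW c0)// ler_pdivrMr// mulrC.
by field; rewrite !gt_eqF.
Qed.

(** The measure is a limit of orbit averages along an ultrafilter finer than [\oo]. The invariance
    defect and the boundary term of the upper bound vanish as [N] grows, while the pair bound holds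
    exactly for all large [N]. *)
Lemma exists_gibbs_mme : exists mu : probability BS R, is_mme X mu /\
  forall tau, exists2 c : R, 0 < c &
  forall n x w y x' w' y', size w = n -> size w' = n ->
    (size x <= tau)%N -> (size y <= tau)%N ->
    (size x' <= tau)%N -> (size y' <= tau)%N ->
    G (x ++ w ++ y) -> G (x' ++ w' ++ y') ->
    c * expR (- ((n + n)%:R * h)) <=
    mass mu ([set z | subword z 0 (size w) = w] `&`
      [set z | subword z (size w + size y + t + size x')%:R (size w') = w']).
Proof.
have [F [FU ooF]] := @ultraFilterLemma _ \oo _.
have FP : ProperFilter F by exact: ultra_proper.
have Fge N0 : \forall N \near F, (N0 <= N)%N by apply: ooF; exists N0.
have Fpos : \forall N \near F, (0 < N)%N by exact: (Fge 1%N).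
have [|mu Hmu] := @limit_measure R s p F orbit_average FU.
  by apply: filterS Fpos => N N0; exact/empirical_fadd/orbit_points_gt0.
have cstF (a : R) : (fun=> a) @ F --> a by exact: cvg_cst.
have inv : invariant_on_finitary (mass mu).
  move=> B fB; have fB' := finitary_shift 1 fB.
  apply/eqP; rewrite -subr_eq0 -normr_le0; apply/ler_addgt0Pr => e e0.
  rewrite add0r.
  have cv : (fun N => `|orbit_average N (left_shift @^-1` B) - orbit_average N B|) @ F
      --> `|mass mu (left_shift @^-1` B) - mass mu B|.
    by apply: cvg_norm; apply: cvgB; [exact: (Hmu _ fB')|exact: Hmu].
  apply: (ler_cvg_to cv (cstF e)).
  have [N1 HN1] : exists N : nat, e^-1 <= N%:R.
    by exists (Num.trunc e^-1).+1; rewrite ltW// truncnS_gt.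
  apply: filterS (Fge N1.+1) => N NN /=.
  have N0 : (0 < N)%N by exact: leq_trans NN.
  apply: le_trans (orbit_average_invariant B N0) _.
  rewrite invf_ple ?posrE ?ltr0n//; apply: le_trans HN1 _.
  by rewrite ler_nat ltnW.
have muX : mu X = 1%E.
  apply: (full_measure X_shift) => m.
  have fm : finitary [set x : FS | L (window m x)] by exact: finitary_language.
  apply: (near_eq_lim FP (Hmu _ fm) (cstF 1)).
  by apply: filterS Fpos => N N0; exact: orbit_average_support.
have dS : stationary (wd (mass mu)).
  by apply: stationary_wd => //; exact: probability_fadd_finitary.
have M0 n : 0 < K ^+ 2 * expR (- (n%:R * h)).
  by rewrite mulr_gt0 ?exprn_gt0 ?expR_gt0.
exists mu; split.
  (* In the limit no word of length [n] has mass above [K^2 e^(-nh)], which bounds the block entropy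
     below by [n h - ln (K^2)]. *)
  apply: (mme_intro X_shift Lh L_upper (c := ln (K ^+ 2))) => //.
    exact: invariant_measureW.
  move=> n; apply: le_trans (block_entropy_ge dS (M0 n) _).
    rewrite lnM ?posrE ?exprn_gt0 ?expR_gt0// expRK opprD opprK addrC lexx//.
  move=> u <-; apply/ler_addgt0Pr => e e0.
  have fu := finitary_subword (0 : coordinate s) (size u) [set v | v = u].
  apply: (ler_cvg_to (Hmu _ fu) (cstF _)).
  have [N1 HN1] : exists N : nat, (size u)%:R / e <= N%:R.
    by exists (Num.trunc ((size u)%:R / e)).+1; rewrite ltW// truncnS_gt.
  apply: filterS (Fge N1.+1) => N NN /=.
  have N0 : (0 < N)%N by exact: leq_trans NN.
  apply: le_trans (orbit_average_gibbs u N0) _; rewrite lerD2l.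
  rewrite ler_pdivrMr ?ltr0n// mulrC -ler_pdivrMr//; apply: le_trans HN1 _.
  by rewrite ler_nat ltnW.
move=> tau; have [c c0 Hc] := orbit_average_pair tau; exists c => //.
move=> n x w y x' w' y' wn w'n xt yt x't y't Gg Gg'.
have [N0 HN0] := Hc n x w y x' w' y' wn w'n xt yt x't y't Gg Gg'.
apply: (ler_cvg_to (cstF _) (Hmu _ (finitary_pair w w' _))).
by apply: filterS (Fge N0) => N /HN0.
Qed.

End Existence.

(** * Uniqueness *)

Section MassCounting.
Context {R : realType} {p : nat}.
Notation A := 'I_p.+1.
Variables (L : set (word p)) (h K : R).
Hypothesis K_ge1 : 1 <= K.
Hypothesis L_gt0 : forall n, (0 < cnt L n)%N.
Hypothesis L_le : forall n, (cnt L n)%:R <= K * expR (n%:R * h).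

(* Gibbs' inequality against the law giving weight 1/2 to the uniform
   distribution on S and 1/2 to that on the other words of L. *)
Lemma mass_count (d : word p -> R) (S : set (word p)) n (a : R) :
  stationary d -> (forall u, 0 < d u -> L u) ->
  n%:R * h <= block_entropy d n -> 0 < a ->
  a <= \sum_(w : n.-tuple A | (w : word p) \in S) d w ->
  expR (- ((ln 2 + ln K) / a)) * expR (n%:R * h) <= (cnt (S `&` L) n)%:R.
Proof.
move=> dS dL Hn a0; set al := \sum_(w | _) _ => aal.
have [_ d0 _ _] := dS.
have al0 : 0 < al by exact: lt_le_trans aal.
have c0 : (0 < cnt (S `&` L) n)%N.
  move: al0; rewrite lt_neqAle => /andP[+ _]; rewrite eq_sym psumr_neq0//.
  move=> /hasP[w _ /andP[/set_mem Sw dw]].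
  by apply/card_gt0P; exists w; apply: mem_set; split => //; exact: dL.
have cR : 0 < (cnt (S `&` L) n)%:R :> R by rewrite ltr0n.
have NR : 0 < (cnt L n)%:R :> R by rewrite ltr0n.
set c := (cnt (S `&` L) n)%:R in cR *; set N := (cnt L n)%:R in NR.
have al1 : al <= 1.
  rewrite -(stationary_sum1 n dS) [leRHS](bigID (fun w : n.-tuple A => (w : word p) \in S))/=.
  by rewrite lerDl sumr_ge0.
pose q (w : n.-tuple A) : R :=
  ((w : word p) \in S `&` L)%:R / (2 * c) + ((w : word p) \in L)%:R / (2 * N).
have q1 : \sum_w q w <= 1.
  rewrite big_split/= -!mulr_suml -!cnt_sum -/c -/N.
  by rewrite le_eqVlt; apply/orP; left; apply/eqP; field; rewrite !gt_eqF.
have q0 w : 0 <= q w by rewrite addr_ge0// mulr_ge0// invr_ge0 mulr_ge0// ltW.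
have qL (w : n.-tuple A) : 0 < d w -> (2 * N)^-1 <= q w.
  move=> /dL Lw; rewrite /q [X in _ + X / _](_ : _ = 1) ?mul1r; last by rewrite mem_set.
  by rewrite lerDr mulr_ge0// invr_ge0 mulr_ge0// ltW.
have qS (w : n.-tuple A) : 0 < d w -> S w -> (2 * c)^-1 <= q w.
  move=> /dL Lw Sw; rewrite /q [X in X / _](_ : _ = 1) ?mul1r; last first.
    by rewrite mem_set.
  by rewrite lerDl mulr_ge0// invr_ge0 mulr_ge0// ltW.
have N20 : 0 < (2 * N)^-1 by rewrite invr_gt0 mulr_gt0.
have c20 : 0 < (2 * c)^-1 by rewrite invr_gt0 mulr_gt0.
have H : n%:R * h <= al * ln (2 * c) + (1 - al) * ln (2 * N).
  apply: le_trans Hn _; apply: le_trans (@gibbs _ _ _ q _ q0 _ q1 _) _.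
  - by move=> w; exact: d0.
  - exact: stationary_sum1.
  - by move=> w /qL; exact: lt_le_trans.
  have -> : 1 - al = \sum_(w : n.-tuple A | (w : word p) \notin S) d w.
    rewrite -(stationary_sum1 n dS) (bigID (fun w : n.-tuple A => (w : word p) \in S))/=.
    by rewrite addrAC subrr add0r.
  rewrite (bigID (fun w : n.-tuple A => (w : word p) \in S))/= opprD lerD//.
    rewrite /al mulr_suml -sumrN; apply: ler_sum => w /set_mem Sw.
    have [->|dw] := eqVneq (d w) 0; first by rewrite !mul0r oppr0.
    have dw0 : 0 < d w by rewrite lt_neqAle eq_sym dw d0.
    rewrite -mulrN ler_wpM2l// lerNl -lnV ?posrE ?mulr_gt0//.
    by rewrite ler_ln ?posrE ?qS// (lt_le_trans c20)// qS.
  rewrite mulr_suml -sumrN; apply: ler_sum => w _.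
  have [->|dw] := eqVneq (d w) 0; first by rewrite !mul0r oppr0.
  have dw0 : 0 < d w by rewrite lt_neqAle eq_sym dw d0.
  rewrite -mulrN ler_wpM2l// lerNl -lnV ?posrE ?mulr_gt0//.
  by rewrite ler_ln ?posrE ?qL// (lt_le_trans N20)// qL.
have K0 : 0 < K by exact: lt_le_trans K_ge1.
have lnN : ln N <= ln K + n%:R * h.
  rewrite -[X in _ + X]expRK -lnM ?posrE ?expR_gt0//.
  by rewrite ler_ln ?posrE ?mulr_gt0 ?expR_gt0// L_le.
have lnK0 : 0 <= ln K by rewrite ln_ge0.
have ln20 : 0 <= ln 2 :> R by rewrite ln_ge0// ler1n.
rewrite -[leRHS]lnK ?posrE// -expRD ler_expR.
(* Replacing [ln N] by its bound [ln K + n h] cancels [(1 - al) n h] on both sides. Division by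
   [al >= a] then produces the constant of the statement. *)
have H2 : al * (n%:R * h) - (ln 2 + ln K) <= al * ln c.
  move: H; rewrite !lnM ?posrE// => H.
  have H3 : (1 - al) * ln N <= (1 - al) * (ln K + n%:R * h).
    by rewrite ler_wpM2l// subr_ge0.
  have H4 : (1 - al) * ln K <= ln K by rewrite ler_piMl// gerBl ltW.
  rewrite !mulrDr in H H3; move: H H3 H4.
  rewrite !mulrBl !mul1r; lra.
have H5 : (ln 2 + ln K) / al <= (ln 2 + ln K) / a.
  by rewrite ler_wpM2l ?addr_ge0// lef_pV2.
apply: (@le_trans _ _ (n%:R * h - (ln 2 + ln K) / al)).
  by rewrite addrC lerD2l lerN2.
rewrite -(ler_pM2l al0) mulrBr [X in _ - X]mulrC divfK ?gt_eqF//.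
Qed.

End MassCounting.

(** * An invariant set separating two measures *)

Section InvariantSet.
Context {R : realType} {s : sidedness} {p : nat}.
Notation FS := (fullshift s p).
Notation BS := (borel s p).
Variables mu nu : probability BS R.
Hypothesis mu_inv : shift_invariant_measure mu.
Hypothesis nu_inv : shift_invariant_measure nu.

Let l (B : set BS) : R := mass mu B - mass nu B.

Let malg := @setalg_measurable s p.

Let l_modular (B B' : set BS) : measurable B -> measurable B' ->
  l (B `|` B') + l (B `&` B') = l B + l B'.
Proof.
move=> mB mB'.
have H (m : probability BS R) :
    mass m (B `|` B') + mass m (B `&` B') = mass m B + mass m B'.
  have [_ _ mU] := probability_fadd m.
  have mD : measurable (B' `\` B) by exact: measurableD.
  rewrite (_ : B `|` B' = B `|` (B' `\` B)); last by rewrite setUDr setDv setD0.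
  rewrite [mass m (B `|` _)]mU ?setDIK// -[in RHS](setDUK (@subIsetr _ B B')).
  rewrite [mass m (_ `&` _ `|` _)]mU//.
  - by rewrite setDIr setDv setU0; rewrite /mass; lra.
  - exact: measurableI.
  - by apply: measurableD => //; exact: measurableI.
  - by rewrite setDIK.
have := H mu; have := H nu; rewrite /l; lra.
Qed.

Let l_shift k (B : set BS) : measurable B -> l (iter k left_shift @^-1` B) = l B.
Proof. by move=> mB; rewrite /l /mass !invariant_measure_iter. Qed.

Let l_limit (F : nat -> set BS) (B : set BS) :
  (forall m : probability BS R, (fun n => m (F n)) @ \oo --> m B) ->
  (forall n, measurable (F n)) -> measurable B ->
  forall M, (forall n, l (F n) = M) -> l B = M.
Proof.
move=> HF mF mB M lM.
have cvm (m : probability BS R) : (fun n => mass m (F n)) @ \oo --> mass m B.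
  apply: (@fine_cvg _ _ _ _ (fun n => m (F n))).
  by rewrite fineK ?fin_num_measure//; exact: HF.
have cvl : (fun n => mass mu (F n) - mass nu (F n)) @ \oo --> l B.
  by apply: cvgB; exact: cvm.
apply: (near_eq_lim _ cvl (cvg_cst M)).
by apply: nearW => n; exact: lM.
Qed.

(** Passing from [B] to [P] adds a part of the positive set and removes a part of the negative
    one. *)
Let hahn_set : exists P : set BS, measurable P /\
  forall B, measurable B -> l B <= l P.
Proof.
have [P [N [[mP posP] [mN negN] PN PN0]]] := Hahn_decomposition
  (cadd (charge_of_finite_measure mu) (copp (charge_of_finite_measure nu))).
exists P; split=> // B mB.
have lE C : measurable C -> (mu C - nu C)%E = (l C)%:E.
  by move=> mC; rewrite /l EFinB /mass !fineK// fin_num_measure.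
have PB : measurable (P `\` B) by exact: measurableD.
have BN : measurable (B `\` P) by exact: measurableD.
have := posP _ PB (@subDsetl _ _ _).
rewrite -[X in (0 <= X)%E -> _]/(mu (P `\` B) - nu (P `\` B))%E lE// lee_fin => H1.
have BPN : B `\` P `<=` N.
  move=> x [Bx nPx]; have : [set: BS] x by [].
  by rewrite -PN => -[].
have := negN _ BN BPN.
rewrite -[X in (X <= 0)%E -> _]/(mu (B `\` P) - nu (B `\` P))%E lE// lee_fin => H2.
have D (C C' : set BS) : measurable C -> measurable C' -> l C = l (C `&` C') + l (C `\` C').
  move=> mC mC'; have := l_modular (measurableI _ _ mC mC') (measurableD mC mC').
  rewrite setUIDK (_ : _ `&` _ `&` _ = set0).
    by rewrite /l /mass !measure0/= subrr addr0 => ->.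
  by apply/seteqP; split => x //= [[_ ?] [_]].
by rewrite (D B P)// (D P B)// setIC lerD2l (le_trans H2).
Qed.

Lemma separating_invariant_set (B : set BS) : measurable B -> mu B <> nu B ->
  exists E : set BS, [/\ measurable E, left_shift @^-1` E = E &
    mass nu E < mass mu E].
Proof.
move=> mB munu; have [P [mP Pmax]] := hahn_set.
set M := l P in Pmax.
have lP : l P = M by [].
(* Otherwise [l] would be at most 0 on [B] and on its complement, where its values are opposite,
   forcing equality on [B]. *)
have M0 : 0 < M.
  rewrite ltNge; apply/negP => M0; apply: munu.
  have := Pmax _ mB; have := Pmax _ (measurableC mB); rewrite /l /mass.
  rewrite !probability_setC// !fineB ?fin_num_measure//= => H1 H2.
  rewrite -[LHS]fineK ?fin_num_measure// -[RHS]fineK ?fin_num_measure//.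
  by congr EFin; lra.
pose Q k : set BS := iter k left_shift @^-1` P.
have mQ k : measurable (Q k) by exact: measurable_preimage_shift.
pose U n : set BS := \big[setU/set0]_(k < n.+1) Q k.
have mU n : measurable (U n) by apply: bigsetU_measurable => k _.
(* By modularity the values on union and intersection add up to [2M], and neither exceeds [M]. *)
have lU n : l (U n) = M.
  elim: n => [|n IHn]; first by rewrite /U big_ord_recr big_ord0/= set0U.
  rewrite /U big_ord_recr/= -/(U n); apply/eqP; rewrite eq_le Pmax/=; last exact: measurableU.
  have := l_modular (mU n) (mQ n.+1); rewrite IHn [l (Q _)]l_shift// -/M.
  by have := Pmax _ (measurableI _ _ (mU n) (mQ n.+1)); lra.
pose V : set BS := \bigcup_n U n.
have mV : measurable V by exact: bigcupT_measurable.
have VE x : V x <-> exists k, P (iter k left_shift x).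
  split => [[n _]|[k Pk]].
    by rewrite /U -bigcup_mkord => -[k _ Qk]; exists k.
  by exists k => //; rewrite /U big_ord_recr/=; right.
have lV : l V = M.
  apply: (@l_limit U) => // m; apply: nondecreasing_cvg_mu => // n n' nn'.
  by apply/subsetPset; exact: subset_bigsetU.
(* The points whose orbit visits [P] infinitely often. The preimages of [V] decrease, so [E] is
   exactly invariant, not just up to a null set. *)
pose E : set BS := \bigcap_n (iter n left_shift @^-1` V).
have mVn n : measurable (iter n left_shift @^-1` V : set BS).
  exact: measurable_preimage_shift.
have mE : measurable E by exact: bigcapT_measurable.
exists E; split=> //.
  apply/seteqP; split => x /= Ex [|n] _ /=.
  - have := Ex 0%N I => /= /VE[k Pk]; apply/VE; exists k.+1.
    by rewrite iterSr.
  - by have := Ex n I; rewrite /= -iterSr.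
  - by have := Ex 1%N I.
  - by have := Ex n.+2 I; rewrite /= -[iter n _ (left_shift x)]iterSr.
rewrite -subr_gt0 -/(l E).
suff -> : l E = M by [].
apply: (@l_limit (fun n => iter n left_shift @^-1` V)) => //; last first.
  by move=> n; rewrite l_shift.
move=> m; apply: nonincreasing_cvg_mu => //.
  by apply: le_lt_trans (probability_lty m); apply: le_measure; rewrite ?inE.
move=> n n' nn'; apply/subsetPset => x /= /VE[k Pk]; apply/VE.
by exists (k + (n' - n))%N; rewrite iterD -[iter (n' - n) _ _]iterD subnK.
Qed.

End InvariantSet.

Section Uniqueness.
Context {R : realType} {s : sidedness} {p : nat}.
Notation A := 'I_p.+1.
Notation FS := (fullshift s p).
Notation BS := (borel s p).
Variable X : set FS.
Hypothesis X_shift : shift_space X.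
Let L := language X.
Variables (h K : R).
Hypothesis Lh : word_entropy R L = h%:E.
Hypothesis K_ge1 : 1 <= K.
Hypothesis L_le : forall n, (cnt L n)%:R <= K * expR (n%:R * h).
Variables (Cp G Cs : set (word p)) (t : nat).
Hypothesis small_complement : forall de : R, 0 < de -> exists M, forall n,
  (cnt (L `\` enlarged L Cp G Cs M) n)%:R <= de * expR (n%:R * h).
Hypothesis ext : forall M, exists tau, forall v, enlarged L Cp G Cs M v ->
  exists u w, [/\ (size u <= tau)%N, (size w <= tau)%N & G (u ++ v ++ w)].
Variable mu : probability BS R.
Hypothesis mu_mme : is_mme X mu.
Hypothesis mu_gibbs : forall tau, exists2 c : R, 0 < c &
  forall n x w y x' w' y', size w = n -> size w' = n ->
    (size x <= tau)%N -> (size y <= tau)%N ->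
    (size x' <= tau)%N -> (size y' <= tau)%N ->
    G (x ++ w ++ y) -> G (x' ++ w' ++ y') ->
    c * expR (- ((n + n)%:R * h)) <=
    mass mu ([set z | subword z 0 (size w) = w] `&`
      [set z | subword z (size w + size y + t + size x')%:R (size w') = w']).

Let cnt_meet_enlarged (S : set (word p)) (ga : R) M n :
  ga * expR (n%:R * h) <= (cnt (S `&` L) n)%:R ->
  (cnt (L `\` enlarged L Cp G Cs M) n)%:R <= ga / 2 * expR (n%:R * h) ->
  ga / 2 * expR (n%:R * h) <= (cnt (S `&` enlarged L Cp G Cs M) n)%:R.
Proof.
move=> H1 H2.
have : (cnt (S `&` L) n <= cnt (L `\` enlarged L Cp G Cs M) n +
    cnt (S `&` enlarged L Cp G Cs M) n)%N.
  have := @cnt_cover R p bool xpredT (fun b => if b then L `\` enlarged L Cp G Cs M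
    else S `&` enlarged L Cp G Cs M) (S `&` L) n.
  rewrite big_bool/=; apply => w [Sw Lw] _.
  by have [Ew|Ew] := pselect (enlarged L Cp G Cs M w); [exists false|exists true].
rewrite -(ler_nat R) natrD => H3; move: (le_trans H1 H3) H2.
by rewrite -[in ga / 2](mulr1 ga); move=> ? ?; lra.
Qed.

(** The pair bound is summed over all pairs of words. The distance for a given pair is [n + t + j],
    where [j] is the combined length of the two extensions lying between the words; for each fixed
    [j] the pair cylinders are disjoint. *)
Let return_mass (tau : nat) (M : nat) :
  (forall v, enlarged L Cp G Cs M v -> exists u w,
    [/\ (size u <= tau)%N, (size w <= tau)%N & G (u ++ v ++ w)]) ->
  exists2 c : R, 0 < c & forall n (S S' : set (word p)),
    c * (cnt (S `&` enlarged L Cp G Cs M) n)%:R *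
        (cnt (S' `&` enlarged L Cp G Cs M) n)%:R <=
    expR ((n + n)%:R * h) * \sum_(j < (tau + tau).+1)
      mass mu ([set z | S (subword z 0 n)] `&`
        [set z | S' (subword z (n + t + j)%:R n)]).
Proof.
move=> Htau; have [c c0 Hc] := mu_gibbs tau; exists c => // n S S'.
set E := expR _; have E0 : 0 < E by exact: expR_gt0.
pose D (S : set (word p)) := [pred w : n.-tuple A |
  (w : word p) \in S `&` enlarged L Cp G Cs M].
pose cyl (j : nat) (w w' : n.-tuple A) : R :=
  mass mu ([set z | subtuple 0 n z = w] `&` [set z | subtuple (n + t + j)%:R n z = w']).
have fcyl j (w w' : n.-tuple A) : finitary
    ([set z : FS | subtuple 0 n z = w] `&` [set z | subtuple (n + t + j)%:R n z = w']).
  by apply: finitaryI; exact: finitary_subtuple.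
have cyl_ge0 j w w' : 0 <= cyl j w w' by exact: fine_ge0.
have pair_ge (w w' : n.-tuple A) : w \in D S -> w' \in D S' ->
    c / E <= \sum_(j < (tau + tau).+1) cyl j w w'.
  move=> /set_mem[_ /Htau[x [y [xt yt Gg]]]] /set_mem[_ /Htau[x' [y' [x't y't Gg']]]].
  have := Hc n x w y x' w' y' (size_tuple _) (size_tuple _) xt yt x't y't Gg Gg'.
  rewrite expRN -/E => H.
  have jt : (size y + size x' < (tau + tau).+1)%N by rewrite ltnS leq_add.
  rewrite (bigD1 (Ordinal jt))//=; apply: le_trans H _.
  rewrite -[leLHS]addr0 lerD ?sumr_ge0// le_eqVlt; apply/orP; left; apply/eqP.
  rewrite /cyl; congr (mass mu _); rewrite !size_tuple.
  rewrite (_ : (n + size y + t + size x')%N = (n + t + (size y + size x'))%N); last by lia.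
  by apply/seteqP; split => z /= [H1 H2]; split;
    [exact/val_inj|exact/val_inj|rewrite -H1|rewrite -H2].
have cov (j : nat) : \sum_(w in D S) \sum_(w' in D S') cyl j w w' <=
    mass mu ([set z | S (subword z 0 n)] `&` [set z | S' (subword z (n + t + j)%:R n)]).
  pose f (z : FS) : n.-tuple A * n.-tuple A := (subtuple 0 n z, subtuple (n + t + j)%:R n z).
  have fE w w' : [set z : FS | f z = (w, w')] =
      [set z : FS | subtuple 0 n z = w] `&` [set z | subtuple (n + t + j)%:R n z = w'].
    apply/seteqP; split => z; first by rewrite /f => -[<- <-].
    by move=> [/= E1 E2]; rewrite /f E1 E2.
  have ff q : finitary [set z : FS | f z = q] by case: q => w w'; rewrite fE.
  pose P : {pred n.-tuple A * n.-tuple A} := predX (D S) (D S').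
  have [fP mP] := fadd_fibers setalg_finitary (probability_fadd_finitary mu) P ff.
  rewrite pair_big/=.
  apply: (@le_trans _ _ (mass mu [set z | P (f z)])).
    rewrite [leRHS]mP le_eqVlt; apply/orP; left; apply/eqP.
    by apply: eq_bigr => -[w w'] _; rewrite fE.
  apply: (fadd_le setalg_finitary (probability_fadd_finitary mu)) => //.
    by apply: finitaryI; exact: finitary_subword.
  by move=> z /= /andP[/set_mem[? _] /set_mem[? _]].
apply: (@le_trans _ _ (E * \sum_(j < (tau + tau).+1)
    \sum_(w in D S) \sum_(w' in D S') cyl j w w')); last first.
  by rewrite ler_wpM2l ?(ltW E0)//; apply: ler_sum => j _; exact: cov.
rewrite exchange_big/=; under eq_bigr do rewrite exchange_big/=.
apply: (@le_trans _ _ (E * \sum_(w in D S) \sum_(w' in D S') c / E)).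
  have -> : \sum_(w in D S) \sum_(w' in D S') c / E =
      c / E * ((cnt (S `&` enlarged L Cp G Cs M) n)%:R *
               (cnt (S' `&` enlarged L Cp G Cs M) n)%:R).
    by rewrite sumr_const sumr_const -mulrnA -natrM mulr_natr mulnC.
  by rewrite mulrA [E * _]mulrC divfK ?gt_eqF// mulrA.
rewrite ler_wpM2l ?(ltW E0)//; apply: ler_sum => w wS; apply: ler_sum => w' wS'.
exact: pair_ge.
Qed.

Let no_separation (nu1 nu2 : probability BS R) (E : set BS) :
  is_mme X nu1 -> is_mme X nu2 -> measurable E -> left_shift @^-1` E = E ->
  0 < mass nu1 E -> 0 < mass nu2 (~` E) -> False.
Proof.
move=> mme1 mme2 mE invE nu1E nu2E.
have L_gt0 n : (0 < cnt L n)%N by apply: cntL_gt0; exact: language_shift_space.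
have [d1S d1L H1] := mme_elim X_shift Lh mme1.
have [d2S d2L H2] := mme_elim X_shift Lh mme2.
(* Half of the smaller mass: after an approximation error of at most [a], mass [a] remains. *)
pose a := Num.min (mass nu1 E) (mass nu2 (~` E)) / 2.
have a0 : 0 < a by rewrite divr_gt0// lt_min nu1E nu2E.
have a1 : a + a <= mass nu1 E by rewrite -splitr ge_min lexx.
have a2 : a + a <= mass nu2 (~` E) by rewrite -splitr ge_min lexx orbT.
pose ga : R := expR (- ((ln 2 + ln K) / a)).
have ga0 : 0 < ga by exact: expR_gt0.
have ga20 : 0 < ga / 2 by rewrite divr_gt0.
have [M HM] := small_complement ga20.
have [tau Htau] := ext M.
have [c c0 Hc] := return_mass Htau.
(* The second bound makes the total return mass, at most [2 e] for each of the [2 tau + 1]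
   distances, no more than half of its lower bound [c (ga / 2)^2]. *)
pose e := Num.min a (c * (ga / 2) ^+ 2 / (4 * (tau + tau).+1%:R)).
have e0 : 0 < e.
  by rewrite lt_min a0/= divr_gt0// ?mulr_gt0// exprn_gt0.
(* Approximating with respect to the sum gives one finitary set that is good for all three
   measures. *)
pose lam := measure_add (measure_add nu1 nu2) mu.
have lamE C : lam C = (nu1 C + nu2 C + mu C)%E.
  by rewrite /lam measure_addE; congr (_ + _)%E; exact: measure_addE.
have lam_lty : (lam setT < +oo)%E.
  rewrite lamE.
  apply: lte_add_pinfty (probability_lty mu).
  exact: lte_add_pinfty (probability_lty nu1) (probability_lty nu2).
have [B0 [fB0 lB0]] := finitary_approx lam_lty mE e0.
have [m [S BE]] := fB0.
have [j _ j0] := @lo_shift s m.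
set n := (m + m).+1.
pose B : set BS := [set x | S (subword x 0 n)].
have fB : finitary B by exact: finitary_subword.
have mB := measurable_finitary fB.
have mB0 := measurable_finitary fB0.
have shB : B = iter j left_shift @^-1` B0.
  by rewrite BE; apply/seteqP; split => x /=; rewrite /window subword_shift j0.
have shE k : iter k left_shift @^-1` E = E.
  elim: k => [//|k IHk]; rewrite -[in RHS]IHk -[in RHS]invE.
  by apply/seteqP; split => x /=; rewrite -iterS ?iterSr.
have mD1 : measurable (E `\` B) by exact: measurableD.
have mD2 : measurable (B `\` E) by exact: measurableD.
have mD10 : measurable (E `\` B0) by exact: measurableD.
have mD20 : measurable (B0 `\` E) by exact: measurableD.
have approx (nu : probability BS R) : shift_invariant_measure nu ->
    (forall C, nu C <= lam C)%E -> mass nu (E `\` B) <= e /\ mass nu (B `\` E) <= e.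
  move=> inv nulam.
  have E1 : E `\` B = iter j left_shift @^-1` (E `\` B0).
    by rewrite -[RHS]/(_ @^-1` E `\` _ @^-1` B0) -shB shE.
  have E2 : B `\` E = iter j left_shift @^-1` (B0 `\` E).
    by rewrite -[RHS]/(_ @^-1` B0 `\` _ @^-1` E) -shB shE.
  have mU : measurable ((E `\` B0) `|` (B0 `\` E)) by exact: measurableU.
  rewrite E1 E2 /mass !invariant_measure_iter//; split;
    rewrite -lee_fin fineK ?fin_num_measure//; apply: le_trans lB0;
    apply: le_trans (nulam _); apply: le_measure; rewrite ?inE//.
have [_ inv1 _] := mme1; have [_ inv2 _] := mme2; have [_ invm _] := mu_mme.
have [b1 _] : mass nu1 (E `\` B) <= e /\ mass nu1 (B `\` E) <= e.
  apply: approx => // C; rewrite lamE.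
  by rewrite -addeA leeDl// adde_ge0.
have [_ b2] : mass nu2 (E `\` B) <= e /\ mass nu2 (B `\` E) <= e.
  apply: approx => // C; rewrite lamE.
  by rewrite addeAC addeC leeDl// adde_ge0.
have [b3 b4] : mass mu (E `\` B) <= e /\ mass mu (B `\` E) <= e.
  apply: approx => // C; rewrite lamE.
  by rewrite leeDr// adde_ge0.
have ea : e <= a by rewrite ge_min lexx.
have addm (nu : probability BS R) := probability_fadd nu.
have malg := @setalg_measurable s p.
have g1 : a <= \sum_(w : n.-tuple A | (w : word p) \in S) wd (mass nu1) w.
  have <- := wd_sum (probability_fadd_finitary nu1) n S.
  have := fadd_leU malg (addm nu1) mB mD1.
  have -> : B `|` (E `\` B) = B `|` E by rewrite setUDr setDv setD0.
  have := fadd_le malg (addm nu1) mE (measurableU _ _ mB mE) (@subsetUr _ _ _).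
  by rewrite -/(mass nu1 _) -/(mass nu1 B); move: a1 b1 ea; rewrite /mass; lra.
have g2 : a <= \sum_(w : n.-tuple A | (w : word p) \in ~` S) wd (mass nu2) w.
  have <- := wd_sum (probability_fadd_finitary nu2) n (~` S).
  have mCB : measurable (~` B) by exact: measurableC.
  have mCE : measurable (~` E) by exact: measurableC.
  have := fadd_leU malg (addm nu2) mCB mD2.
  have sub : ~` E `<=` ~` B `|` (B `\` E).
    by move=> x nEx; have [Bx|nBx] := pselect (B x); [right|left].
  have := fadd_le malg (addm nu2) mCE (measurableU _ _ mCB mD2) sub.
  by move: a2 b2 ea; rewrite /mass; lra.
have c1 := mass_count K_ge1 L_gt0 L_le d1S d1L (H1 n) a0 g1.
have c2 := mass_count K_ge1 L_gt0 L_le d2S d2L (H2 n) a0 g2.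
have k1 := cnt_meet_enlarged c1 (HM n).
have k2 := cnt_meet_enlarged c2 (HM n).
have := Hc n S (~` S).
set sm := \sum_(i < _) _ => H.
(* A point in [B] whose [k]-th iterate is outside [B] lies either in [B] minus [E] or, by invariance
   of [E], in the preimage of [E] minus [B]. Each of these has mass at most [e]. *)
have smle : sm <= (tau + tau).+1%:R * (e + e).
  rewrite mulr_natl -[X in _ *+ X]card_ord -sumr_const; apply: ler_sum => i _.
  set k := (n + t + i)%N.
  have mk1 : measurable (iter k left_shift @^-1` (E `\` B) : set BS).
    exact: measurable_preimage_shift.
  apply: le_trans (_ : mass mu ((B `\` E) `|` (iter k left_shift @^-1` (E `\` B))) <= _).
    apply: (fadd_le malg (addm mu)).
    - by apply: measurable_finitary; apply: finitaryI; exact: finitary_subword.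
    - exact: measurableU.
    - move=> x [/= Sx nSx]; have [Ex|nEx] := pselect (E x); last by left.
      right; split; first by rewrite -(shE k) in Ex.
      by change (~ S (subword (iter k left_shift x) 0 n)); rewrite subword_shift add0r.
  apply: le_trans (fadd_leU malg (addm mu) mD2 mk1) _; apply: lerD => //.
  by rewrite /mass invariant_measure_iter.
have E0 : 0 < expR (n%:R * h) by exact: expR_gt0.
have EE : expR ((n + n)%:R * h) = expR (n%:R * h) * expR (n%:R * h).
  by rewrite natrD mulrDl expRD.
have low : c * (ga / 2) ^+ 2 <= sm.
  have E20 : 0 < expR ((n + n)%:R * h) by exact: expR_gt0.
  rewrite -(ler_pM2l E20); apply: le_trans H; rewrite EE.
  rewrite [leLHS](_ : _ = c * (ga / 2 * expR (n%:R * h)) * (ga / 2 * expR (n%:R * h))); last by ring.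
  have g0 : 0 <= ga / 2 * expR (n%:R * h) by rewrite mulr_ge0 ?ltW.
  have cge0 : 0 <= c by exact: ltW.
  apply: ler_pM => //; first exact: mulr_ge0.
  exact: ler_wpM2l.
have T0 : 0 < (tau + tau).+1%:R :> R by rewrite ltr0n.
have eT : e <= c * (ga / 2) ^+ 2 / (4 * (tau + tau).+1%:R) by rewrite ge_min lexx orbT.
have Q0 : 0 < c * (ga / 2) ^+ 2 by rewrite mulr_gt0// exprn_gt0.
have : (tau + tau).+1%:R * (e + e) <= c * (ga / 2) ^+ 2 / 2.
  have H4 := lerD eT eT; rewrite -(ler_pM2l T0) in H4; apply: le_trans H4 _.
  by rewrite le_eqVlt; apply/orP; left; apply/eqP; field; rewrite gt_eqF.
move=> H3; have := le_trans low (le_trans smle H3); lra.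
Qed.

Lemma mme_unique (nu1 nu2 : probability BS R) :
  is_mme X nu1 -> is_mme X nu2 ->
  forall B : set BS, measurable B -> nu1 B = nu2 B.
Proof.
move=> mme1 mme2 B mB; apply: contrapT => neq.
have [_ inv1 _] := mme1; have [_ inv2 _] := mme2.
have [E [mE invE lt21]] := separating_invariant_set inv1 inv2 mB neq.
apply: (no_separation mme1 mme2 mE invE).
  by apply: le_lt_trans lt21; exact: fine_ge0.
have mass1 (nu : probability BS R) : mass nu (~` E) = 1 - mass nu E.
  by rewrite /mass probability_setC// fineB ?fin_num_measure.
rewrite mass1 subr_gt0; apply: lt_le_trans lt21 _.
exact: (fadd_le1 (@setalg_measurable s p) (probability_fadd nu1) mE).
Qed.

End Uniqueness.

(** * Periodic points *)

Lemma cvg_sumr (R : realType) (T : Type) (F : set_system T) (I : Type)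
  (r : seq I) (f : I -> T -> R) (l : I -> R) : Filter F ->
  (forall i, f i x @[x --> F] --> l i) ->
  \sum_(i <- r) f i x @[x --> F] --> \sum_(i <- r) l i.
Proof. by move=> FF fl; apply: cvg_big => //; exact: add_continuous. Qed.

(* Upper semicontinuity of the entropy of words of length q: the limit law,
   mixed with a little of the uniform one, is used as reference in Gibbs'
   inequality. *)
Lemma block_entropy_usc (R : realType) (p q : nat) (F : set_system nat)
  (d_ : nat -> word p -> R) (d : word p -> R) (a : R) :
  ProperFilter F -> (\forall n \near F, stationary (d_ n)) -> stationary d ->
  (forall u, d_ n u @[n --> F] --> d u) ->
  (forall e : R, 0 < e -> \forall n \near F, a - e <= block_entropy (d_ n) q) ->
  a <= block_entropy d q.
Proof.
move=> FP dSn dS cvd Ha; apply/ler_addgt0Pr => e e0.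
pose de : R := 1 - expR (- (e / 2)).
have de1 : de < 1 by rewrite gtrBl expR_gt0.
have de0 : 0 < de by rewrite subr_gt0 -[ltRHS]expR0 ltr_expR oppr_lt0 divr_gt0.
have lnde : ln (1 - de) = - (e / 2) by rewrite /de opprB addrC subrK expRK.
have [_ d0 _ _] := dS.
set N := #|{: q.-tuple 'I_p.+1}|.
have N0 : 0 < N%:R :> R by rewrite /N card_tuple card_ord ltr0n expn_gt0.
pose r (w : q.-tuple 'I_p.+1) : R := (1 - de) * d w + de / N%:R.
have r0 w : 0 < r w.
  by rewrite ltr_wpDl ?divr_gt0// mulr_ge0// subr_ge0 ltW.
have r1 : \sum_w r w = 1.
  rewrite big_split/= -mulr_sumr (stationary_sum1 q dS) mulr1 sumr_const -/N.
  by rewrite -[X in _ + X]mulr_natr divfK ?gt_eqF// subrK.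
(* The reference law [r] does not depend on [n], so the logarithms are fixed coefficients and the
   sum converges with the [d_ n]. Positivity of [r] makes it admissible for every [d_ n]. *)
have cvr : (fun n => - \sum_(w : q.-tuple 'I_p.+1) d_ n w * ln (r w)) @ F
    --> - \sum_(w : q.-tuple 'I_p.+1) d w * ln (r w).
  apply: cvgN; apply: cvg_sumr => w; apply: cvgMl; exact: cvd.
have H1 : a - e / 2 <= - \sum_(w : q.-tuple 'I_p.+1) d w * ln (r w).
  have csta : (fun=> a - e / 2) @ F --> a - e / 2 by exact: cvg_cst.
  apply: (ler_cvg_to csta cvr).
  have e20 : 0 < e / 2 by rewrite divr_gt0.
  apply: filterS2 dSn (Ha _ e20) => n dSn an; have [_ dn0 _ _] := dSn.
  apply: le_trans an _; apply: gibbs.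
  - by move=> w; exact: dn0.
  - by move=> w; exact: ltW.
  - exact: stationary_sum1.
  - by rewrite r1.
  - by move=> w _.
have H2 : - \sum_(w : q.-tuple 'I_p.+1) d w * ln (r w) <= block_entropy d q + e / 2.
  have -> : e / 2 = \sum_(w : q.-tuple 'I_p.+1) d w * (e / 2).
    by rewrite -mulr_suml (stationary_sum1 q dS) mul1r.
  rewrite /block_entropy /ent addrC -sumrB -sumrN; apply: ler_sum => w _.
  have [->|dw] := eqVneq (d w) 0; first by rewrite !mul0r subrr oppr0.
  have dw0 : 0 < d w by rewrite lt_neqAle eq_sym dw d0.
  rewrite -mulrN -mulrBr ler_wpM2l// lerNl opprB addrC -[- (e / 2)]lnde addrC.
  rewrite -lnM ?posrE// ?subr_gt0// mulrC ler_ln ?posrE ?mulr_gt0 ?subr_gt0//.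
  by rewrite /r lerDl divr_ge0// ltW.
by have := le_trans H1 H2; lra.
Qed.

Section PeriodicPoints.
Context {R : realType} {s : sidedness} {p : nat}.
Notation A := 'I_p.+1.
Notation FS := (fullshift s p).
Notation BS := (borel s p).
Variable X : set FS.
Hypothesis X_shift : shift_space X.
Let L := language X.

Lemma coordinate_shift_nat (i : coordinate s) k : (0 < k)%N ->
  exists q j, i + (k * q)%:R = j%:R.
Proof.
move=> k0; case: s i => i.
  by exists 0%N, i; rewrite muln0 addr0 coordinate_natr.
exists `|i|%N, `|(i + (k * `|i|)%N%:Z)%R|%N; rewrite !coordinate_intr.
change (i + (k * `|i|)%N%:Z = `|(i + (k * `|i|)%N%:Z)%R|%N%:Z)%R; nia.
Qed.

Lemma iter_period (x : FS) k q : iter k left_shift x = x ->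
  iter (k * q) left_shift x = x.
Proof. by move=> kx; elim: q => [|q IHq]; rewrite ?muln0// mulnS iterD IHq. Qed.

(** The [n >= k] letters from [i] on contain a full period, and adding multiples of [k] carries
    every coordinate to the right of [i]. *)
Lemma periodic_eq (x y : FS) i k n : (0 < k <= n)%N ->
  iter k left_shift x = x -> iter k left_shift y = y ->
  subword x i n = subword y i n -> x = y.
Proof.
move=> /andP[k0 kn] kx ky /subword_eqP E.
have per (z : FS) q j : iter k left_shift z = z -> z (j + (k * q)%:R) = z j.
  by move=> kz; rewrite -iter_left_shift iter_period.
have Enat (j : nat) : x (i + j%:R) = y (i + j%:R).
  rewrite (divn_eq j k) addnC natrD addrA mulnC !per//; apply: E.
  by apply: leq_trans kn; rewrite ltn_mod.
apply/funext => j.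
have [q [l Hl]] := coordinate_shift_nat j k0.
have [q' [l' Hl']] := coordinate_shift_nat i k0.
have [q'' Hq] : exists q'' : nat, (l' <= l + k * q'')%N by exists l'; nia.
have {}Hl : j + (k * (q + q' + q''))%:R = i + (l + k * q'' - l' + k * (q' + q'))%:R.
  have H1 : j + (k * (q + q''))%:R = (l + k * q'')%:R.
    by rewrite mulnDr natrD addrA Hl -natrD.
  rewrite addnAC mulnDr natrD addrA H1 mulnDr !natrD.
  rewrite [_%:R + (_ + _)]addrCA [i + _]addrA Hl' -!natrD; congr _%:R; lia.
by rewrite -(per x (q + q' + q'')%N j kx) -(per y (q + q' + q'')%N j ky) Hl Enat.
Qed.

Lemma finite_Per n : finite_set (Per X n).
Proof.
pose g (q : 'I_n.+1 * n.-tuple A) : FS :=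
  xget point [set x | iter q.1 left_shift x = x /\ subword x 0 n = q.2].
apply: (@sub_finite_set _ _ (g @` setT)); last first.
  by apply: finite_image; exact: finite_finset.
move=> x [Xx [k /andP[k1 kn] kx]].
have kn' : (k < n.+1)%N by [].
exists (Ordinal kn', subtuple 0 n x) => //; rewrite /g /=.
have := @xgetPex _ point [set y : FS | iter k left_shift y = y /\ subword y 0 n = subword x 0 n].
case; first by exists x.
move=> ky yE; apply: periodic_eq ky kx yE; by rewrite k1.
Qed.

Notation PerF n := (fset_set (Per X n)).

Lemma in_Per n (x : FS) : x \in PerF n <-> Per X n x.
Proof.
rewrite in_fset_set; last exact: finite_Per.
by split => [/set_mem|/mem_set].
Qed.

Lemma Per_mem n (x : PerF n) : Per X n (val x).
Proof. by apply/in_Per; exact: valP. Qed.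

Definition per_average n : set FS -> R :=
  empirical (@predT (PerF n)) (fun x : PerF n => val x).

Lemma per_measure_average n (B : set BS) :
  per_measure R X n B = (per_average n B)%:E.
Proof.
rewrite /per_measure fsbig_finite/=; last exact: finite_Per.
rewrite /per_average /empirical mulrC EFinM; congr (_ * _)%E.
  by rewrite cardE -cardT -cardfE.
rewrite -sumEFin big_seq_fsetE/=; apply: eq_bigr => x _; rewrite diracE.
by congr (nat_of_bool _)%:R%:E; apply/idP/asboolP => [/set_mem|/mem_set].
Qed.

Lemma left_shift_Per n x : Per X n x -> Per X n (left_shift x).
Proof.
move=> [Xx [k kn kx]]; split; first exact: (iter_shift_mem X_shift 1).
by exists k => //; rewrite -iterSr iterS kx.
Qed.

(** The one-sided shift is not injective in general, but on points with a common period [k * k']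
    applying it [k * k' - 1] more times undoes it. *)
Lemma left_shift_Per_inj n x y : Per X n x -> Per X n y ->
  left_shift x = left_shift y -> x = y.
Proof.
move=> [_ [k /andP[k1 _] kx]] [_ [k' /andP[k'1 _] ky]] xy.
have := iter_period k' kx; have := iter_period k ky; rewrite mulnC.
have : (0 < k * k')%N by rewrite muln_gt0 k1.
by case: (k * k')%N => // m _ <- <-; rewrite !iterSr xy.
Qed.

Lemma per_average_invariant n B :
  per_average n (left_shift @^-1` B) = per_average n B.
Proof.
rewrite /per_average /empirical; congr (_ / _).
have mem (x : PerF n) : left_shift (val x) \in PerF n.
  by apply/in_Per/left_shift_Per/Per_mem.
pose g (x : PerF n) : PerF n := [` mem x]%fset.
have ginj : injective g.
  move=> x y /(congr1 val)/= gxy; apply/val_inj.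
  by apply: left_shift_Per_inj gxy; exact: Per_mem.
by rewrite [RHS](reindex_inj ginj).
Qed.

(** Each period [k <= n] admits at most one point beginning with [u], so [u] is carried by at most
    [n] points. *)
Lemma per_average_word_le n u : size u = n ->
  per_average n [set x | subword x 0 n = u] <= n%:R / #|{: PerF n}|%:R.
Proof.
move=> un; rewrite /per_average /empirical ler_wpM2r ?invr_ge0//.
have ex (x : PerF n) : exists k : nat, (1 <= k <= n)%N /\
    iter k left_shift (val x) = val x.
  by have [_ [k kn kx]] := Per_mem x; exists k.
have [k Hk] := boolp.choice ex.
have kn (x : PerF n) : ((k x).-1 < n)%N by have [/andP[k1 k2] _] := Hk x; lia.
rewrite -natr_sum ler_nat.
pose D := [set x : PerF n | `[< subword (val x) 0 n = u >]]%SET.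
have -> : (\sum_(x : PerF n) `[< [set x | subword x 0 n = u] (val x) >] = #|D|)%N.
  by rewrite -sum1_card [RHS]big_mkcond; apply: eq_bigr => x _; rewrite finset.in_set; case: asboolP.
rewrite -[X in (_ <= X)%N]card_ord.
rewrite -(@card_in_imset _ _ (fun x => Ordinal (kn x)) D) ?max_card//.
move=> x y; rewrite !finset.in_set => /asboolP xu /asboolP yu /(congr1 val)/= kxy.
have [/andP[k1 k2] kx] := Hk x; have [/andP[k1' k2'] ky] := Hk y.
have kE : k x = k y by lia.
apply/val_inj; apply: (@periodic_eq _ _ 0 (k x) n); rewrite ?k1// ?xu ?yu//.
by rewrite kE.
Qed.

Lemma per_average_support n m : (0 < #|{: PerF n}|)%N ->
  per_average n [set x | L (window m x)] = 1.
Proof.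
move=> P0; apply: empirical_full => // x _; apply: mem_language.
by have [] := Per_mem x.
Qed.

Section Counting.
Variables (G : set (word p)) (t : nat).
Hypothesis per_glue : gluing L G t [set x | L x /\
  exists2 y, cylinder X x y & iter (size x + t) left_shift y = y].

(** Periodic gluing of a single word gives a point of period [l + t] that carries the word at
    coordinates from 1 on, so different words give different points. *)
Lemma cntG_le_Per l n : (0 < l + t <= n)%N -> (cnt G l <= #|{: PerF n}|)%N.
Proof.
move=> /andP[lt0 ltn].
have ex (w : word p) : exists y : FS, G w -> [/\ X y,
    subword y 1 (size w) = w & iter (size w + t) left_shift y = y].
  have [Gw|nGw] := pselect (G w); last by exists point.
  have [|[|? ?] [//= _ _]] := per_glue (w := w) (ws := [::]).
    by move=> z; rewrite mem_seq1 => /eqP ->.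
  rewrite /interleave/= cats0 => -[_ [y [Xy yw] yt]].
  by exists y.
have [g Hg] := boolp.choice ex.
have gP (w : l.-tuple A) : G w -> g w \in PerF n.
  move=> Gw; have [Xg _] := Hg _ Gw; rewrite size_tuple => gt.
  by apply/in_Per; split => //; exists (l + t)%N => //; rewrite lt0.
(* The option type provides a value for words outside [G], since [Per X n] is not yet known to be
   nonempty. *)
have ex2 (w : word p) : exists x : option (PerF n), G w -> size w = l ->
    omap val x = Some (g w).
  have [Gw|nGw] := pselect (G w); last by exists None.
  have [wl|wl] := pselect (size w = l); last by exists None.
  have gw : g w \in PerF n by move/eqP: wl => wl; exact: (gP (Tuple wl)).
  by exists (Some [` gw]%fset).
have [f Hf] := boolp.choice ex2.
have := @cnt_le_inj p _ [pred x : option (PerF n) | x != None] f G l.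
have -> : #|[pred x : option (PerF n) | x != None]| = #|{: PerF n}|.
  have := cardC1 (None : option (PerF n)); rewrite card_option /= => <-.
  by apply: eq_card => x.
apply.
  by move=> u Gu ul; have := Hf u Gu ul; rewrite inE; case: (f u).
move=> u v Gu Gv ul vl fuv.
have := Hf u Gu ul; rewrite fuv (Hf v Gv vl) => -[gvu].
have [_ + _] := Hg u Gu; have [_ + _] := Hg v Gv.
by rewrite ul vl gvu => E1 E2; rewrite -[LHS]E2 -[RHS]E1.
Qed.

Variables (h c1 : R) (tau0 : nat).
Hypothesis h_ge0 : 0 <= h.
Hypothesis c1_gt0 : 0 < c1.
Hypothesis synd : forall n, exists2 j,
  (j <= tau0)%N & c1 * expR ((n + j)%:R * h) <= (cnt G (n + j))%:R.

Lemma card_Per_ge : exists2 c : R, 0 < c & forall n, (t + tau0 < n)%N ->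
  c * expR (n%:R * h) <= #|{: PerF n}|%:R.
Proof.
exists (c1 * expR (- ((t + tau0)%:R * h))); first by rewrite mulr_gt0 ?expR_gt0.
move=> n tn; have [j jt Hj] := synd (n - t - tau0)%N.
apply: le_trans (_ : (cnt G (n - t - tau0 + j))%:R <= _); last first.
  by rewrite ler_nat; apply: cntG_le_Per; lia.
apply: le_trans Hj; rewrite -mulrA ler_pM2l// -expRD ler_expR -mulNr -mulrDl.
rewrite ler_wpM2r// addrC lerBlDr -natrD ler_nat; lia.
Qed.

Hypothesis Lh : word_entropy R L = h%:E.
Hypothesis L_upper : forall e : R, 0 < e -> exists N, forall n, (N <= n)%N ->
  (cnt L n)%:R <= expR (n%:R * (h + e)).
Variable mu : probability BS R.
Hypothesis mu_unique : forall nu : probability BS R, is_mme X nu ->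
  forall B : set BS, measurable B -> nu B = mu B.

Lemma Per_gt0 : \forall n \near \oo, (0 < #|{: PerF n}|)%N.
Proof.
have [c c0 Hc] := card_Per_ge; exists (t + tau0).+1 => // n /= tn.
rewrite -(ltr0n R); apply: lt_le_trans (Hc n tn).
by rewrite mulr_gt0 ?expR_gt0.
Qed.

Let stationary_per n : (0 < #|{: PerF n}|)%N -> stationary (wd (per_average n)).
Proof.
move=> P0; apply: stationary_wd; first exact: empirical_fadd.
by move=> B _; exact: per_average_invariant.
Qed.

(** At length [n] every word has mass at most [n / #Per(n)], so the entropy is at least
    [n h + ln c - ln n]. The measure changes with [n], so this is transferred to the fixed length
    [q] before any limit is taken. *)
Let per_entropy q (e : R) : (0 < q)%N -> 0 < e ->
  \forall n \near \oo, q%:R * h - e <= block_entropy (wd (per_average n)) q.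
Proof.
move=> q0 e0; have [c c0 Hc] := card_Per_ge.
have qR : 0 < q%:R :> R by rewrite ltr0n.
set l := ln (p.+1%:R : R).
(* The slope in [ln n <= de n - ln de], chosen so that after multiplication by [q] the linear term
   is [n e / 2]. *)
pose de : R := e / 2 / q%:R.
have de0 : 0 < de by rewrite !divr_gt0.
pose Z : R := q%:R * (`|ln c| + `|ln de|) + q%:R * q%:R * l.
have [N HN] : exists N : nat, Z / (e / 2) <= N%:R.
  by exists (Num.trunc (Z / (e / 2))).+1; rewrite ltW// truncnS_gt.
have : \forall n \near \oo, (maxn (t + tau0).+1 N.+1 <= n)%N by exists (maxn (t + tau0).+1 N.+1).
apply: filterS2 Per_gt0 => n P0; rewrite geq_max => /andP[tn Nn].
have nR : 0 < n%:R :> R by rewrite ltr0n (leq_trans _ Nn).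
have PR : 0 < #|{: PerF n}|%:R :> R by rewrite ltr0n.
have dS := stationary_per P0.
have H1 : n%:R * h + ln c - ln n%:R <= block_entropy (wd (per_average n)) n.
  apply: le_trans (@block_entropy_ge _ _ _ n (n%:R / #|{: PerF n}|%:R) dS _ _).
  - rewrite ln_div ?posrE// opprB lerD2r.
    rewrite -[X in X + _]expRK -lnM ?posrE ?expR_gt0//.
    by rewrite ler_ln ?posrE ?mulr_gt0 ?expR_gt0// mulrC Hc.
  - by rewrite divr_gt0.
  - by move=> u un; rewrite /wd un; exact: per_average_word_le.
have H2 := block_entropy_ratio n dS q0; rewrite -/l in H2.
have H3 : ln n%:R <= de * n%:R - ln de.
  rewrite lerBrDr -lnM ?posrE//; rewrite mulrC; apply: ltW.
  by apply: ln_sublinear; rewrite mulr_gt0.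
have H4 : Z <= n%:R * (e / 2).
  rewrite -ler_pdivrMr ?divr_gt0//; apply: le_trans HN _.
  by rewrite ler_nat ltnW.
move: (block_entropy (wd (per_average n)) q) (block_entropy (wd (per_average n)) n)
  H1 H2 => be_q be_n H1 H2.
rewrite -(ler_pM2l nR).
have H5 := ler_wpM2r (ltW qR) H1.
have H6 : q%:R * (- ln c - ln de) <= q%:R * (`|ln c| + `|ln de|).
  rewrite ler_wpM2l ?(ltW qR)// lerD//; first by rewrite -normrN ler_norm.
  by rewrite -normrN ler_norm.
have H7 : q%:R * ln n%:R <= q%:R * (de * n%:R - ln de) by rewrite ler_wpM2l ?(ltW qR).
have H8 : q%:R * (de * n%:R) = n%:R * (e / 2).
  by rewrite /de mulrA [q%:R * _]mulrC divfK ?gt_eqF// mulrC.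
have H9 : n%:R * e = n%:R * (e / 2) + n%:R * (e / 2) by rewrite -mulrDr -splitr.
move: H4 H6 H7; rewrite /Z !mulrDr !mulrN H8 => H4 H6 H7.
move: (le_trans H5 H2); rewrite !mulrBl !mulrDl => H10.
have E1 : n%:R * h * q%:R = n%:R * (q%:R * h) by ring.
have E2 : ln c * q%:R = q%:R * ln c by rewrite mulrC.
have E3 : ln n%:R * q%:R = q%:R * ln n%:R :> R by rewrite mulrC.
rewrite E1 E2 E3 in H10; rewrite ?mulrBr H9; lra.
Qed.

(** Every ultrafilter limit of the averages is a measure of maximal entropy, hence agrees with [mu];
    so the sequence itself converges. *)
Lemma per_average_cvg (B : set FS) : finitary B ->
  per_average n B @[n --> \oo] --> mass mu B.
Proof.
move=> fB; apply: cvg_ultra => F FU ooF.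
have FP : ProperFilter F by exact: ultra_proper.
have FPer : \forall n \near F, (0 < #|{: PerF n}|)%N by apply: ooF; exact: Per_gt0.
have cstF (a : R) : (fun=> a) @ F --> a by exact: cvg_cst.
have [|nu Hnu] := @limit_measure R s p F per_average FU.
  by apply: filterS FPer => n P0; exact: empirical_fadd.
have inv : invariant_on_finitary (mass nu).
  move=> B' fB'; have fB1 := finitary_shift 1 fB'.
  apply: (near_eq_lim FP (Hnu _ fB1) (Hnu _ fB')).
  by apply: filterE => n; exact: per_average_invariant.
have invn := invariant_measureW inv.
have nuX : nu X = 1%E.
  apply: (full_measure X_shift) => m.
  have fm : finitary [set x : FS | L (window m x)] by exact: finitary_language.
  apply: (near_eq_lim FP (Hnu _ fm) (cstF 1)).
  by apply: filterS FPer => n; exact: per_average_support.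
have dS : stationary (wd (mass nu)).
  by apply: stationary_wd => //; exact: probability_fadd_finitary.
have nu_mme : is_mme X nu.
  apply: (mme_intro X_shift Lh L_upper (c := 0)) => // q; rewrite subr0.
  have [->|q0] := posnP q; first by rewrite mul0r block_entropy_ge0.
  apply: (block_entropy_usc FP _ dS (d_ := fun n => wd (per_average n))).
  - by apply: filterS FPer => n; exact: stationary_per.
  - by move=> u; apply: Hnu; exact: (finitary_subword 0 _ [set v | v = u]).
  - by move=> e e0; apply: ooF; exact: per_entropy.
have := Hnu _ fB; rewrite /mass.
by rewrite (mu_unique nu_mme (measurable_finitary fB)).
Qed.

End Counting.
End PeriodicPoints.

(** * From finitary sets to continuous functions *)

Section WeakConvergence.
Context {R : realType} {s : sidedness} {p : nat}.
Notation A := 'I_p.+1.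
Notation FS := (fullshift s p).
Notation BS := (borel s p).
Variable X : set FS.
Hypothesis X_shift : shift_space X.
Variable f : FS -> R.
Hypothesis f_cont : {within X, continuous f}.

Lemma uniform_continuity (e : R) : 0 < e -> exists M, forall m, (M <= m)%N ->
  forall x y, X x -> X y -> window m y = window m x -> `|f x - f y| <= e.
Proof.
move=> e0.
have [|M HM] := @uniform_window s p X X_shift (fun m y => X y -> forall m', (m <= m')%N ->
    forall z, X z -> window m' z = window m' y -> `|f y - f z| <= e); last first.
  by exists M => m Mm x y Xx Xy yx; exact: (HM x Xx Xx m Mm y Xy yx).
move=> x Xx; have e20 : 0 < e / 2 by rewrite divr_gt0.
have /cvgrPdist_le/(_ _ e20) H := (@subspace_continuousP _ X _ f).1 f_cont x Xx.
have [m Hm] := nbhs_window H.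
exists m => m1 y mm1 yx Xy m' mm' z Xz zy.
have [g gE] := @window_take s p m m' (leq_trans mm1 mm').
have zx : window m z = window m x by rewrite gE zy -gE yx.
have H1 := Hm y yx Xy; have H2 := Hm z zx Xz.
rewrite (_ : f y - f z = (f x - f z) - (f x - f y)); last by ring.
apply: le_trans (ler_normB _ _) _; rewrite [leRHS]splitr.
exact: lerD H2 H1.
Qed.

(** The representative is chosen in [X], since [f] is controlled only there. For a window word not
    seen in [X] it is arbitrary, and the corresponding piece has mass 0. *)
Let rep m (u : word p) : FS := xget point [set y | X y /\ window m y = u].

Let repP m x : X x -> X (rep m (window m x)) /\
  window m (rep m (window m x)) = window m x.
Proof.
by move=> Xx; apply: (@xgetPex _ point [set y | X y /\ window m y = window m x]); exists x.
Qed.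

Let step m (x : BS) : R := f (rep m (window m x)).

Let mX : measurable (X : set BS). Proof. exact: measurable_shift_space. Qed.

Let measurable_step m : measurable_fun (X : set BS) (step m).
Proof.
move=> _ Y mY; apply: measurableI => //.
apply: measurable_finitary.
by exists m, [set u | Y (f (rep m u))].
Qed.

(** Continuity of [f] is known within [X] only; measurability comes from the step functions, which
    converge to [f] on [X]. *)
Let measurable_f : measurable_fun (X : set BS) (f : BS -> R).
Proof.
apply: (@measurable_fun_cvg _ BS R X step f) => //.
move=> x Xx; apply/cvgrPdist_le => e /uniform_continuity[M HM].
exists M => // m /= Mm; have [Xr rE] := repP m Xx.
exact: (HM m Mm x _ Xx Xr rE).
Qed.

Let piece m (u : (m + m).+1.-tuple A) : set FS := [set x | window m x = u].

Let finitary_piece m u : finitary (@piece m u).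
Proof. exact: (finitary_subword _ _ [set v | v = tval u]). Qed.

Section Estimate.
Variable nu : {measure set BS -> \bar R}.
Hypotheses (nuX : nu X = 1%E) (nuT : nu setT = 1%E).

Let nuX_lty : (nu X < +oo)%E. Proof. by rewrite nuX ltry. Qed.

Let nu_meet (B : set BS) : measurable B -> nu (X `&` B) = nu B.
Proof.
move=> mB; apply/eqP; rewrite eq_le; apply/andP; split.
  by apply: le_measure; rewrite ?inE//; exact: measurableI.
have mC : measurable (~` X : set BS) by exact: measurableC.
have nuC : nu (~` X) = 0%E.
  have H : nu setT = (nu X + nu (~` X))%E.
    by rewrite -(setUv X); apply: measureU => //; rewrite setICr.
  move: H; rewrite nuT nuX; have := measure_ge0 nu (~` X).
  case: (nu (~` X)) => [r _| |]//= /eqP; rewrite -EFinD eqe => /eqP H.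
  by congr EFin; move: H; lra.
apply: (@le_trans _ _ (nu ((X `&` B) `|` ~` X))).
  apply: le_measure; rewrite ?inE//.
    by apply: measurableU => //; exact: measurableI.
  by move=> x Bx; have [Xx|nXx] := pselect (X x); [left|right].
apply: (@le_trans _ _ (nu (X `&` B) + nu (~` X))%E); last by rewrite nuC adde0.
by apply: measureU2 => //; exact: measurableI.
Qed.

Let bounded_f : [bounded f x | x in X].
Proof.
have [M HM] := @uniform_continuity 1 ltr01.
pose C := \sum_(u : (M + M).+1.-tuple A) `|f (rep M u)| + 1.
exists C; split; first exact: num_real.
move=> r Cr x /= Xx; apply: le_trans (ltW Cr).
have [Xr rE] := repP M Xx.
have H := HM M (leqnn M) x _ Xx Xr rE.
have -> : f x = f (rep M (window M x)) + (f x - f (rep M (window M x))) by ring.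
apply: le_trans (ler_normD _ _) _; apply: lerD => //.
have szw : size (window M x) == (M + M).+1 by rewrite size_window.
by rewrite (bigD1 (Tuple szw))//= lerDl sumr_ge0.
Qed.

Let bounded_step m : [bounded step m x | x in X].
Proof.
have [C [Cr HC]] := bounded_f; exists C; split => // r Crr x /= Xx.
by apply: (HC r Crr (rep m (window m x))); have [] := repP m Xx.
Qed.

Let int_f : nu.-integrable X (EFin \o (f : BS -> R)).
Proof. exact: measurable_bounded_integrable. Qed.

Let int_step m : nu.-integrable X (EFin \o step m).
Proof. exact: measurable_bounded_integrable. Qed.

Let integral_step m : (\int[nu]_(x in X) (step m x)%:E)%E =
  (\sum_(u : (m + m).+1.-tuple A) f (rep m u) * fine (nu (piece u)))%:E.
Proof.
have mpiece (u : (m + m).+1.-tuple A) : measurable (X `&` piece u : set BS).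
  by apply: measurableI => //; apply: measurable_finitary; exact: finitary_piece.
have XE : X = \big[setU/set0]_(u : (m + m).+1.-tuple A) (X `&` piece u).
  rewrite -bigcup_seq; apply/seteqP; split => x /= => [Xx|[u _ []//]].
  have szw : size (window m x) == (m + m).+1 by rewrite size_window.
  by exists (Tuple szw) => //=; rewrite mem_index_enum.
have := @integral_bigsetU_EFin _ BS R nu _ (fun u => X `&` @piece m u) (step m)
  (index_enum _) mpiece (index_enum_uniq _).
rewrite -XE => ->; first last.
- exact/measurable_EFinP.
- by move=> u v _ _ [x [[_ xu] [_ xv]]]; apply/val_inj; rewrite /= -xu -xv.
rewrite -sumEFin; apply: eq_bigr => u _.
have mp : measurable (piece u : set BS).
  by apply: measurable_finitary; exact: finitary_piece.
rewrite (@eq_integral _ _ _ _ _ (cst (f (rep m u))%:E)); last first.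
  by move=> x /set_mem[_ xu]; rewrite /step xu.
rewrite integral_cst// nu_meet// EFinM fineK//.
rewrite ge0_fin_numE ?measure_ge0//; apply: le_lt_trans (ltry 1).
by rewrite -nuT; apply: le_measure; rewrite ?inE.
Qed.

(** On [X] the step function is within [e] of [f], and its integral is a finite combination of
    masses of finitary sets. The choice of [m] does not depend on [nu], so the estimate is uniform
    along a sequence of measures. *)
Lemma integral_estimate (e : R) m : 0 < e ->
  (forall x y, X x -> X y -> window m y = window m x -> `|f x - f y| <= e) ->
  (\int[nu]_(x in X) (f x)%:E)%E \is a fin_num /\
  `|fine (\int[nu]_(x in X) (f x)%:E)%E -
    \sum_(u : (m + m).+1.-tuple A) f (rep m u) * fine (nu (piece u))| <= e.
Proof.
move=> e0 He.
have fin : (\int[nu]_(x in X) (f x)%:E)%E \is a fin_num.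
  exact: (integrable_fin_num mX int_f).
split=> //; rewrite -lee_fin -abse_EFin EFinB fineK// -integral_step.
rewrite -(@integralB_EFin _ BS R nu X f (step m))//.
have mB : measurable_fun (X : set BS) (fun x : BS => (f x - step m x)%:E : \bar R).
  apply/measurable_EFinP.
  exact: (@measurable_funB _ BS R X (f : BS -> R) (step m)).
apply: le_trans (le_abse_integral nu mX mB) _.
have bnd := @integral_le_bound _ BS R nu X (fun x => (f x - step m x)%:E) e%:E mX mB.
apply: le_trans (bnd _ _) _.
- by rewrite lee_fin ltW.
- apply: aeW => x Xx; rewrite abse_EFin lee_fin.
  by have [Xr rE] := repP m Xx; exact: He.
- by rewrite [nu X]nuX mule1.
Qed.

End Estimate.

Lemma integral_cvg (mu_ : nat -> {measure set BS -> \bar R})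
    (mu : {measure set BS -> \bar R}) :
  (\forall n \near \oo, mu_ n X = 1%E /\ mu_ n setT = 1%E) ->
  mu X = 1%E -> mu setT = 1%E ->
  (forall B, finitary B -> fine (mu_ n B) @[n --> \oo] --> fine (mu B)) ->
  (\int[mu_ n]_(x in X) (f x)%:E)%E @[n --> \oo] --> (\int[mu]_(x in X) (f x)%:E)%E.
Proof.
move=> mu_1 muX muT cvB.
have [M1 HM1] := @uniform_continuity 1 ltr01.
have [fin _] := integral_estimate muX muT ltr01 (HM1 M1 (leqnn _)).
rewrite -(fineK fin); apply/fine_cvgP; split.
  apply: filterS mu_1 => n [nX nT].
  by have [] := integral_estimate nX nT ltr01 (HM1 M1 (leqnn _)).
apply/cvgrPdist_le => e e0.
have e30 : 0 < e / 3 by rewrite divr_gt0.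
have [m Hm] := uniform_continuity e30.
have {}Hm := Hm m (leqnn m).
have [_ Emu] := integral_estimate muX muT e30 Hm.
have cvS : (fun n => \sum_(u : (m + m).+1.-tuple A) f (rep m u) * fine (mu_ n (piece u))) @ \oo
    --> \sum_(u : (m + m).+1.-tuple A) f (rep m u) * fine (mu (piece u)).
  apply: cvg_sumr => u; apply: cvgMr; apply: cvB; exact: finitary_piece.
have /cvgrPdist_le/(_ _ e30) cvS' := cvS.
apply: filterS2 mu_1 cvS' => n [nX nT] H.
have [_ En] := integral_estimate nX nT e30 Hm.
move: Emu H En; set a := fine _; set b := \sum_u _; set c := \sum_u _; set d := fine _.
move=> H1 H2 H3.
have -> : a - (fine \o (fun n => \int[mu_ n]_(x in X) (f x)%:E)%E) n =
    (a - b) + (b - c) - (d - c) by rewrite /d/=; ring.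
apply: le_trans (ler_normB _ _) _.
have H4 := ler_normD (a - b) (b - c).
have E3 : e = e / 3 + e / 3 + e / 3 by field.
rewrite E3; apply: lerD => //; apply: le_trans H4 _; exact: lerD.
Qed.

End WeakConvergence.

Theorem theorem3 (R : realType) (s : sidedness) (p : nat)
    (X : set (fullshift s p)) (Cp G Cs : set (word p))
    (X_shift : shift_space X)
    (L_decomp : decomposition (language X) Cp G Cs)
    (I_spec : S_specification (language X) G)
    (II_gap : (word_entropy R (Cp `|` Cs) < word_entropy R (language X))%E)
    (III_ext : forall M : nat, exists tau : nat,
       forall v, enlarged (language X) Cp G Cs M v ->
       exists u w : word p,
         [/\ (size u <= tau)%N, (size w <= tau)%N & G (u ++ v ++ w)]) :
  intrinsically_ergodic R X /\
  (Per_specification X G ->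
   forall mu : probability (borel s p) R, is_mme X mu ->
   weak_star_cvg X (fun n => per_measure R X n : {measure set _ -> \bar R}) mu).
Proof.
have [t glue] := I_spec.
have Llang := language_shift_space X_shift.
have [h [h_ge0 Lh Llow Lup]] := @language_entropy R p _ Llang.
rewrite Lh in II_gap.
have [h' [K' [h'h K'0 C_upper]]] := word_entropy_lt II_gap.
have [K K1 L_le] :=
  cntL_le L_decomp glue h_ge0 Llow Lup h'h K'0 C_upper.
have small := cnt_not_enlarged L_decomp glue h_ge0 Lup h'h K'0 C_upper.
have [tau0 [c1 [c10 synd]]] :=
  G_syndetic L_decomp glue h_ge0 Llow Lup h'h K'0 C_upper III_ext.
have [mu [mu_mme mu_gibbs]] :=
  exists_gibbs_mme X_shift h_ge0 Lh Lup Llow K1 L_le glue c10 synd.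
have uniq := mme_unique X_shift Lh K1 L_le small III_ext mu_mme mu_gibbs.
split; first by exists mu; split => // nu nu_mme B mB; exact: uniq.
(* The gap size [t'] of the periodic gluing may differ from [t]; the lower bound [synd] on [cnt G]
   obtained above serves for both. *)
move=> [t' per_glue] nu nu_mme f f_cont.
have nu_uniq (m : probability (borel s p) R) : is_mme X m ->
    forall B : set (borel s p), measurable B -> m B = nu B.
  by move=> m_mme B mB; exact: uniq.
have [nuX _ _] := nu_mme.
apply: (integral_cvg X_shift f_cont) => //; last 2 first.
- exact: probability_setT.
- move=> B fB.
  have cv := per_average_cvg X_shift per_glue h_ge0 c10 synd Lh Lup nu_uniq fB.
  have E : (fun n => fine (per_measure R X n B)) = (fun n => per_average X n B).
    by apply/funext => n; rewrite per_measure_average.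
  by rewrite -E in cv; exact: cv.
(* For small [n] there may be no periodic point and the average is then the zero measure; total mass
   1 holds only eventually. *)
have PG := Per_gt0 per_glue h_ge0 c10 synd.
apply: (@filterS _ \oo _ _ _ _ PG) => n P0.
have per1 B : X `<=` B -> per_measure R X n B = 1%E.
  move=> XB; rewrite per_measure_average /per_average empirical_full// => x _.
  by apply: XB; have [] := Per_mem x.
by split; apply: per1.
Qed.
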